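(* Let $\mathbb{S}^2=\mathrm{Spec}(\mathbb{R}[x,y,z]/(x^2+y^2+z^2-1))$. The smooth rational real affine fourfold $\mathbb{S}^{2}\times\mathbb{A}_{\mathbb{R}}^{2}$ has at least countably infinitely many pairwise non-isomorphic real forms.
   Context: A real (resp. complex) algebraic variety is a geometrically integral quasi-projective scheme of finite type over $\mathbb{R}$ (resp. $\mathbb{C}$); morphisms are morphisms of schemes over the base field. The complexification of a real algebraic variety $X$ is $X_{\mathbb{C}}=X\times_{\mathrm{Spec}(\mathbb{R})}\mathrm{Spec}(\mathbb{C})$. A real form of a real algebraic variety $X$ is a real algebraic variety $X'$ such that $X_{\mathbb{C}}$ and $X'_{\mathbb{C}}$ are isomorphic as complex algebraic varieties. Products are over $\mathrm{Spec}(\mathbb{R})$, and ''non-isomorphic'' means non-isomorphic as real algebraic varieties. *)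

(* Defs.v *)
From HB Require Import structures.
From mathcomp Require Import all_boot all_algebra.
From mathcomp Require Import boolp classical_sets reals.
From mathcomp Require Import complex mpoly.

Set Implicit Arguments.
Unset Strict Implicit.
Unset Printing Implicit Defensive.

Import GRing.Theory.
Local Open Scope ring_scope.

(* A scheme over a field k is represented by its functor of points
   A |-> X(A) = Mor_k(Spec A, X) on commutative k-algebras.  This embedding is
   fully faithful: morphisms of k-schemes are exactly natural transformations,
   and fibre products over Spec k are pointwise products.  A comAlgType has
   1 != 0; the zero algebra is left out at no cost, since every scheme has
   exactly one point with values in it. *)

(* The two laws are stated up to pointwise equality of algebra morphisms. *)
Record functor (k : fieldType) := Functor {
  points :> comAlgType k -> Type;
  act : forall A B : comAlgType k, {lrmorphism A -> B} -> points A -> points B;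
  act_id : forall (A : comAlgType k) (f : {lrmorphism A -> A}) (x : points A),
    f =1 id -> act f x = x;
  act_comp : forall (A B C : comAlgType k) (f : {lrmorphism A -> B})
      (g : {lrmorphism B -> C}) (h : {lrmorphism A -> C}) (x : points A),
    h =1 g \o f -> act h x = act g (act f x)
}.

Record morphism (k : fieldType) (X Y : functor k) := Morphism {
  mor :> forall A : comAlgType k, X A -> Y A;
  mor_natural : forall (A B : comAlgType k) (f : {lrmorphism A -> B}) (x : X A),
    mor (act f x) = act f (mor x)
}.

Definition isomorphic (k : fieldType) (X Y : functor k) : Prop :=
  exists (u : morphism X Y) (v : morphism Y X),
    forall A : comAlgType k,
      cancel (u A) (v A) /\
      cancel (v A) (u A).

Definition nonempty (k : fieldType) (X : functor k) : Prop :=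
  exists A : comAlgType k, inhabited (X A).

Section Product.
Variables (k : fieldType) (X Y : functor k).

Definition prod_points (A : comAlgType k) : Type := (X A * Y A)%type.

Definition prod_act (A B : comAlgType k) (f : {lrmorphism A -> B})
  (x : prod_points A) : prod_points B := (act f x.1, act f x.2).

Lemma prod_act_id (A : comAlgType k) (f : {lrmorphism A -> A})
  (x : prod_points A) : f =1 id -> prod_act f x = x.
Proof. by case: x => x y fE; rewrite /prod_act /= !act_id. Qed.

Lemma prod_act_comp (A B C : comAlgType k) (f : {lrmorphism A -> B})
  (g : {lrmorphism B -> C}) (h : {lrmorphism A -> C}) (x : prod_points A) :
  h =1 g \o f -> prod_act h x = prod_act g (prod_act f x).
Proof. by move=> hE; rewrite /prod_act /= !(act_comp _ hE). Qed.

Definition product : functor k := Functor prod_act_id prod_act_comp.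
End Product.

Record subfunctor (k : fieldType) (X : functor k) := Subfunctor {
  mem_sub :> forall A : comAlgType k, set (X A);
  mem_act : forall (A B : comAlgType k) (f : {lrmorphism A -> B}) (x : X A),
    mem_sub x -> mem_sub (act f x)
}.

Section SubfunctorFunctor.
Variables (k : fieldType) (X : functor k) (U : subfunctor X).

Definition sub_points (A : comAlgType k) : Type := {x : X A | U A x}.

Definition sub_act (A B : comAlgType k) (f : {lrmorphism A -> B})
  (x : sub_points A) : sub_points B :=
  exist _ (act f (sval x)) (mem_act f (svalP x)).

Lemma sub_act_id (A : comAlgType k) (f : {lrmorphism A -> A})
  (x : sub_points A) : f =1 id -> sub_act f x = x.
Proof. by case: x => x Ux fE; apply: eq_exist; exact: act_id. Qed.

Lemma sub_act_comp (A B C : comAlgType k) (f : {lrmorphism A -> B})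
  (g : {lrmorphism B -> C}) (h : {lrmorphism A -> C}) (x : sub_points A) :
  h =1 g \o f -> sub_act h x = sub_act g (sub_act f x).
Proof. by case: x => x Ux hE; apply: eq_exist; exact: act_comp. Qed.

Definition sub_functor : functor k := Functor sub_act_id sub_act_comp.
End SubfunctorFunctor.

Definition generates_unit (A : comNzRingType) (S : set A) : Prop :=
  exists (m : nat) (s c : 'I_m -> A),
    (forall i, S (s i)) /\ \sum_(i < m) c i * s i = 1.

(* The pullback of U along any point Spec A -> X is the open subscheme D(S)
   of Spec A, the complement of V(S). *)
Definition open_sub (k : fieldType) (X : functor k) (U : subfunctor X) : Prop :=
  forall (A : comAlgType k) (x : X A), exists S : set A,
    forall (B : comAlgType k) (f : {lrmorphism A -> B}),
      U B (act f x) <-> generates_unit (f @` S)%classic.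

(* The pullback of Z along any point Spec A -> X is the closed subscheme
   V(S) = Spec (A / (S)) of Spec A. *)
Definition closed_sub (k : fieldType) (X : functor k) (Z : subfunctor X) : Prop :=
  forall (A : comAlgType k) (x : X A), exists S : set A,
    forall (B : comAlgType k) (f : {lrmorphism A -> B}),
      Z B (act f x) <-> (forall s, S s -> f s = 0).

(* Spec k[x_1, .., x_n]/(E): a k-algebra morphism from the quotient ring to A
   is a point of A^n at which all the polynomials of E vanish. *)
Section AffineScheme.
Variables (k : fieldType) (n : nat) (E : set {mpoly k[n]}).

Definition zeros (A : comAlgType k) : set 'rV[A]_n :=
  fun v => forall p, E p -> mmap (in_alg A) (v ord0) p = 0.

Definition affine_points (A : comAlgType k) : Type := {v : 'rV[A]_n | zeros v}.

Lemma zeros_map (A B : comAlgType k) (f : {lrmorphism A -> B})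
  (v : 'rV[A]_n) : zeros v -> zeros (map_mx f v).
Proof.
move=> vE p Ep; rewrite -[RHS](rmorph0 f) -(vE p Ep) /mmap rmorph_sum /=.
apply: eq_bigr => m _; rewrite rmorphM /= rmorph_alg; congr (_ * _).
rewrite /mmap1 rmorph_prod; apply: eq_bigr => i _.
by rewrite rmorphXn /= mxE.
Qed.

Definition affine_act (A B : comAlgType k) (f : {lrmorphism A -> B})
  (x : affine_points A) : affine_points B :=
  exist _ (map_mx f (sval x)) (zeros_map f (svalP x)).

Lemma affine_act_id (A : comAlgType k) (f : {lrmorphism A -> A})
  (x : affine_points A) : f =1 id -> affine_act f x = x.
Proof.
case: x => v vE fE; apply: eq_exist => /=.
by apply/matrixP => i j; rewrite mxE fE.
Qed.

Lemma affine_act_comp (A B C : comAlgType k) (f : {lrmorphism A -> B})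
  (g : {lrmorphism B -> C}) (h : {lrmorphism A -> C}) (x : affine_points A) :
  h =1 g \o f -> affine_act h x = affine_act g (affine_act f x).
Proof.
case: x => v vE hE; apply: eq_exist => /=.
by apply/matrixP => i j; rewrite !mxE hE.
Qed.

Definition affine_scheme : functor k := Functor affine_act_id affine_act_comp.
End AffineScheme.

Definition affine_space (k : fieldType) (n : nat) : functor k :=
  affine_scheme (@set0 {mpoly k[n]}).

(* Affine and of finite type over k. *)
Definition affine (k : fieldType) (X : functor k) : Prop :=
  exists (n : nat) (E : set {mpoly k[n]}), isomorphic X (affine_scheme E).

(* P^n(A) is the set of direct summands of rank 1 of A^(n+1), i.e. the images
   of the projectors P of A^(n+1) which have rank 1 at every field-valued point
   of Spec A.  A morphism f : A -> B maps L to the B-submodule f(L) spans. *)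
Section ProjectiveSpace.
Variables (k : fieldType) (n : nat).

Definition is_line (A : comAlgType k) (L : set 'rV[A]_n.+1) : Prop :=
  exists P : 'M[A]_n.+1,
    [/\ P *m P = P,
        L = [set v *m P | v in setT]%classic &
        forall (K : fieldType) (h : {rmorphism A -> K}),
          \rank (map_mx h P) = 1%N].

Definition proj_points (A : comAlgType k) : Type :=
  {L : set 'rV[A]_n.+1 | is_line L}.

Definition extend_span (A B : comAlgType k) (f : A -> B)
  (L : set 'rV[A]_n.+1) : set 'rV[B]_n.+1 :=
  fun w => exists (m : nat) (c : 'rV[B]_m) (l : 'M[A]_(m, n.+1)),
    (forall i, L (row i l)) /\ w = c *m map_mx f l.

Lemma extend_spanE (A B : comAlgType k) (f : {lrmorphism A -> B})
  (P : 'M[A]_n.+1) : P *m P = P ->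
  extend_span f [set v *m P | v in setT]%classic =
  [set v *m map_mx f P | v in setT]%classic.
Proof.
move=> PP; apply/seteqP; split => [w [m [c [l [lL ->]]]]|w [v _ <-]] /=.
- exists (c *m map_mx f l) => //; rewrite -mulmxA -map_mxM.
  congr (_ *m map_mx _ _); apply/row_matrixP => i; rewrite row_mul.
  by have [v _ <-] := lL i; rewrite -mulmxA PP.
- exists n.+1, v, P; split => // i.
  by exists (delta_mx 0 i) => //; rewrite rowE.
Qed.

Lemma is_line_extend (A B : comAlgType k) (f : {lrmorphism A -> B})
  (L : set 'rV[A]_n.+1) : is_line L -> is_line (extend_span f L).
Proof.
case=> P [PP -> rkP]; exists (map_mx f P); split.
- by rewrite -map_mxM PP.
- exact: extend_spanE.
- by move=> K h; rewrite -map_mx_comp; exact: (rkP K (h \o f)).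
Qed.

Definition proj_act (A B : comAlgType k) (f : {lrmorphism A -> B})
  (x : proj_points A) : proj_points B :=
  exist _ (extend_span f (sval x)) (is_line_extend f (svalP x)).

Lemma proj_act_id (A : comAlgType k) (f : {lrmorphism A -> A})
  (x : proj_points A) : f =1 id -> proj_act f x = x.
Proof.
case: x => L [P [PP LE rkP]] fE; apply: eq_exist => /=.
rewrite {}LE extend_spanE //; suff -> : map_mx f P = P by [].
by apply/matrixP => i j; rewrite mxE fE.
Qed.

Lemma proj_act_comp (A B C : comAlgType k) (f : {lrmorphism A -> B})
  (g : {lrmorphism B -> C}) (h : {lrmorphism A -> C}) (x : proj_points A) :
  h =1 g \o f -> proj_act h x = proj_act g (proj_act f x).
Proof.
case: x => L [P [PP LE rkP]] hE; apply: eq_exist => /=.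
rewrite {}LE !extend_spanE // -?map_mxM ?PP //.
suff -> : map_mx h P = map_mx g (map_mx f P) by [].
by apply/matrixP => i j; rewrite !mxE hE.
Qed.

Definition projective_space : functor k := Functor proj_act_id proj_act_comp.
End ProjectiveSpace.

(* X admits an immersion into some P^n, i.e. a closed immersion into an open
   subscheme U of P^n.  Such an X is a scheme of finite type over k. *)
Definition quasi_projective (k : fieldType) (X : functor k) : Prop :=
  exists (n : nat) (U : subfunctor (projective_space k n))
         (Z : subfunctor (sub_functor U)),
    [/\ open_sub U, closed_sub Z & isomorphic X (sub_functor Z)].

(* O(U), the ring of morphisms from U to A^1, has no zero divisors for every
   nonempty open U. *)
Definition integral (k : fieldType) (X : functor k) : Prop :=
  nonempty X /\
  forall U : subfunctor X, open_sub U -> nonempty (sub_functor U) ->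
  forall s t : morphism (sub_functor U) (affine_space k 1),
    (forall (A : comAlgType k) (u : sub_functor U A),
       sval (s A u) ord0 ord0 * sval (t A u) ord0 ord0 = 0) ->
    (forall (A : comAlgType k) (u : sub_functor U A),
       sval (s A u) ord0 ord0 = 0) \/
    (forall (A : comAlgType k) (u : sub_functor U A),
       sval (t A u) ord0 ord0 = 0).

(* For X locally of finite presentation over k, e.g. quasi-projective:
   points lift along square-zero extensions. *)
Definition smooth (k : fieldType) (X : functor k) : Prop :=
  forall (A B : comAlgType k) (p : {lrmorphism A -> B}),
    (forall b, exists a, p a = b) ->
    (forall a a', p a = 0 -> p a' = 0 -> a * a' = 0) ->
    forall y : X B, exists x : X A, act p x = y.

(* For integral X and Y, whose nonempty open subschemes are dense. *)
Definition birational (k : fieldType) (X Y : functor k) : Prop :=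
  exists (U : subfunctor X) (V : subfunctor Y),
    [/\ open_sub U, nonempty (sub_functor U),
        open_sub V, nonempty (sub_functor V) &
        isomorphic (sub_functor U) (sub_functor V)].

(* In particular X has dimension d. *)
Definition rational_of_dim (d : nat) (k : fieldType) (X : functor k) : Prop :=
  birational X (affine_space k d).

(* A K-algebra A, seen as a k-algebra through phi. *)
Definition restrict (k K : fieldType) (phi : {rmorphism k -> K})
  (A : comAlgType K) : Type := A.

Section Restriction.
Variables (k K : fieldType) (phi : {rmorphism k -> K}).

HB.instance Definition _ (A : comAlgType K) :=
  GRing.ComNzRing.on (restrict phi A).

Section Scale.
Variable A : comAlgType K.

Definition restrict_scale (c : k) (a : restrict phi A) : restrict phi A :=
  (phi c *: (a : A)).

Lemma restrict_scaleA (a b : k) (v : restrict phi A) :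
  restrict_scale a (restrict_scale b v) = restrict_scale (a * b) v.
Proof. by rewrite /restrict_scale scalerA rmorphM. Qed.

Lemma restrict_scale1 : left_id 1 restrict_scale.
Proof. by move=> v; rewrite /restrict_scale rmorph1 scale1r. Qed.

Lemma restrict_scaleDr : right_distributive restrict_scale +%R.
Proof. by move=> c u v; rewrite /restrict_scale scalerDr. Qed.

Lemma restrict_scaleDl (v : restrict phi A) :
  {morph restrict_scale^~ v : a b / a + b}.
Proof. by move=> a b; rewrite /restrict_scale rmorphD scalerDl. Qed.

HB.instance Definition _ := GRing.Zmodule_isLmodule.Build k (restrict phi A)
  restrict_scaleA restrict_scale1 restrict_scaleDr restrict_scaleDl.

Lemma restrict_scaleAl (c : k) (u v : restrict phi A) : c *: (u * v) = c *: u * v.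
Proof. exact: (@scalerAl K A). Qed.

HB.instance Definition _ :=
  GRing.Lmodule_isLalgebra.Build k (restrict phi A) restrict_scaleAl.
HB.instance Definition _ :=
  GRing.Lalgebra_isComAlgebra.Build k (restrict phi A).
End Scale.

Section RestrictMorphism.
Variables (A B : comAlgType K) (f : {lrmorphism A -> B}).

Definition restrict_mor (a : restrict phi A) : restrict phi B := f a.

Lemma restrict_mor_additive : additive restrict_mor.
Proof. by move=> a b; exact: (rmorphB f). Qed.

Lemma restrict_mor_multiplicative : multiplicative restrict_mor.
Proof. by split=> [a b|]; [exact: (rmorphM f)|exact: (rmorph1 f)]. Qed.

Lemma restrict_mor_scalable : scalable restrict_mor.
Proof. by move=> c a; exact: (linearZZ f (phi c) a). Qed.

HB.instance Definition _ := GRing.isAdditive.Build (restrict phi A) (restrict phi B)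
  restrict_mor restrict_mor_additive.
HB.instance Definition _ := GRing.isMultiplicative.Build
  (restrict phi A) (restrict phi B) restrict_mor restrict_mor_multiplicative.
HB.instance Definition _ := GRing.isScalable.Build k
  (restrict phi A) (restrict phi B) *:%R restrict_mor restrict_mor_scalable.
End RestrictMorphism.
End Restriction.

Arguments restrict_mor {k K} phi {A B} f a.

(* The functor of points of X x_(Spec k) Spec K: a K-morphism from Spec A to it
   is a k-morphism Spec A -> X, where A is a k-algebra through phi. *)
Section BaseChange.
Variables (k K : fieldType) (phi : {rmorphism k -> K}) (X : functor k).

Definition base_change_points (A : comAlgType K) : Type := X (restrict phi A).

Definition base_change_act (A B : comAlgType K) (f : {lrmorphism A -> B})
  (x : base_change_points A) : base_change_points B :=
  @act k X (restrict phi A) (restrict phi B) (restrict_mor phi f) x.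

Lemma base_change_act_id (A : comAlgType K) (f : {lrmorphism A -> A})
  (x : base_change_points A) : f =1 id -> base_change_act f x = x.
Proof. by move=> fE; exact: act_id. Qed.

Lemma base_change_act_comp (A B C : comAlgType K) (f : {lrmorphism A -> B})
  (g : {lrmorphism B -> C}) (h : {lrmorphism A -> C})
  (x : base_change_points A) :
  h =1 g \o f -> base_change_act h x = base_change_act g (base_change_act f x).
Proof. by move=> hE; exact: act_comp. Qed.

Definition base_change : functor K :=
  Functor base_change_act_id base_change_act_comp.
End BaseChange.

Definition complexification (R : realType) (X : functor R) : functor R[i] :=
  base_change (real_complex R) X.

(* As R[i] is an algebraic closure of R, X is geometrically integral iff its
   complexification is integral. *)
Definition real_variety (R : realType) (X : functor R) : Prop :=
  quasi_projective X /\ integral (complexification X).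

Definition real_form (R : realType) (X X' : functor R) : Prop :=
  [/\ real_variety X, real_variety X' &
      isomorphic (complexification X) (complexification X')].

Definition sphere (R : realType) : functor R :=
  affine_scheme [set (\sum_(i < 3) 'X_i ^+ 2 - 1 : {mpoly R[3]})]%classic.

(* Main.v *)
From HB Require Import structures.
From mathcomp Require Import all_boot all_order all_algebra.
From mathcomp Require Import ring_quotient complex ring lra.
From mathcomp Require Import boolp classical_sets reals.
From mathcomp Require mpoly.
Require Import Defs.

Set Implicit Arguments.
Unset Strict Implicit.
Unset Printing Implicit Defensive.

Import Order.TTheory GRing.Theory Num.Theory.
Local Open Scope ring_scope.

(** Put u = x + iy, so that the sphere is u ubar + z^2 = 1. The n-th form
    [bundle R n] is the total space of a complex line bundle, seen as a real
    bundle of rank 2: its fibre over (u, z) consists of the complex vectors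
    (v, w) on the line spanned by ((1 + z)^n, ubar^n), equivalently by
    (u^n, (1 - z)^n). This is the n-th power of the tautological bundle of the
    Riemann sphere; on real points it has Euler number n up to sign.

    The complexification does not see n. When -1 is a square in A, a complex
    number with coordinates in A is a pair of elements of A, and the fibre
    becomes L + L', with L' the conjugate line. The conjugate of L is its dual,
    and L + L^* is trivial because L is generated by two sections: a Bezout
    relation between (1 + z)^n and (1 - z)^n gives explicit mutually inverse
    isomorphisms with the trivial bundle ([complexified_bundle_trivial]).

    The real forms are told apart by topology. Real polynomials with
    p^2 + q^2 + r^2 = 1 are constant, so every morphism from the affine line to
    the sphere is constant. Hence an isomorphism between the total spaces of two
    of the bundles carries fibres to fibres, over an injective continuous map
    sigma of the real sphere, and its derivative along the zero section in the
    direction of the fibres is a real-linear isomorphism from the fibre of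
    [bundle R m] at p to the fibre of [bundle R n] at sigma p, continuous in p
    ([bundle_linearization]). Continuity and differentiation are obtained by
    evaluating the isomorphism at the algebra of first-order jets of continuous
    functions.

    Split this real-linear map into its complex-linear part and its antilinear
    part. Invertibility says that their norms differ, so that over the connected
    sphere one of the two never vanishes ([complex_part_dominates]). Compare it,
    on a small circle around the north pole N, in a frame that extends over the
    disc inside the circle and in one that extends over the disc outside. The
    frames of [bundle R m] differ by the m-th power of a function of degree 1,
    those of [bundle R n] near sigma N by the n-th power of a nonvanishing
    function. A nonvanishing function on a disc has winding number 0 on its
    boundary, so m is a multiple of n ([linearized_dvd]). Exchanging the roles
    of m and n gives m = n.

    That the complexification of the product of the sphere and the plane is
    integral follows from a cover by two affine spaces of dimension 4
    ([integral_of_charts]); the integrality of the other forms is transported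
    along the isomorphism of complexifications. Quasi-projectivity is proved for
    any functor that is cut out in an affine space by natural equations
    ([quasi_projective_of_equations]). *)

(** * Adjoining a square root of -1 to a ring *)

(** A[X] / (X^2 + 1). For A = R these are the complex numbers; when A already
    contains a square root of -1, the ring is isomorphic to A x A. *)
Record gauss (A : Type) : Type := Gauss { re : A; im : A }.

Definition gauss_pair A (u : gauss A) := (re u, im u).
Definition pair_gauss A (p : A * A) := Gauss p.1 p.2.
Lemma gauss_pairK A : cancel (@gauss_pair A) (@pair_gauss A).
Proof. by case. Qed.

HB.instance Definition _ (A : eqType) := Equality.copy (gauss A) (can_type
  (@gauss_pairK A)).
HB.instance Definition _ (A : choiceType) := Choice.copy (gauss A) (can_type
  (@gauss_pairK A)).

Section GaussRing.
Variable A : comNzRingType.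
Implicit Types u v w : gauss A.

Definition gauss_add u v := Gauss (re u + re v) (im u + im v).
Definition gauss_opp u := Gauss (- re u) (- im u).
Definition gauss_mul u v :=
  Gauss (re u * re v - im u * im v) (re u * im v + im u * re v).

Lemma gauss_eq u v : re u = re v -> im u = im v -> u = v.
Proof. by case: u v => a b [c d] /= -> ->. Qed.

Lemma gauss_addA : associative gauss_add.
Proof. by move=> u v w; apply: gauss_eq => /=; rewrite addrA. Qed.
Lemma gauss_addC : commutative gauss_add.
Proof. by move=> u v; apply: gauss_eq => /=; rewrite addrC. Qed.
Lemma gauss_add0 : left_id (Gauss 0 0) gauss_add.
Proof. by move=> u; apply: gauss_eq => /=; rewrite add0r. Qed.
Lemma gauss_addN : left_inverse (Gauss 0 0) gauss_opp gauss_add.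
Proof. by move=> u; apply: gauss_eq => /=; rewrite addNr. Qed.

HB.instance Definition _ := GRing.isZmodule.Build (gauss A)
  gauss_addA gauss_addC gauss_add0 gauss_addN.

Lemma gauss_mulA : associative gauss_mul.
Proof. by move=> u v w; apply: gauss_eq => /=; ring. Qed.
Lemma gauss_mulC : commutative gauss_mul.
Proof. by move=> u v; apply: gauss_eq => /=; ring. Qed.
Lemma gauss_mul1 : left_id (Gauss 1 0) gauss_mul.
Proof. by move=> u; apply: gauss_eq => /=; ring. Qed.
Lemma gauss_mulD : left_distributive gauss_mul gauss_add.
Proof. by move=> u v w; apply: gauss_eq => /=; ring. Qed.
Lemma gauss_1neq0 : Gauss 1 0 != 0 :> gauss A.
Proof. by apply/eqP => -[] /eqP; rewrite oner_eq0. Qed.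

HB.instance Definition _ := GRing.Zmodule_isComNzRing.Build (gauss A)
  gauss_mulA gauss_mulC gauss_mul1 gauss_mulD gauss_1neq0.

Definition gauss_of (a : A) : gauss A := Gauss a 0.
Lemma gauss_of_additive : additive gauss_of.
Proof. by move=> a b; apply: gauss_eq => /=; rewrite ?subrr. Qed.
Lemma gauss_of_multiplicative : multiplicative gauss_of.
Proof. by split=> // a b; apply: gauss_eq => /=; ring. Qed.
HB.instance Definition _ := GRing.isAdditive.Build A (gauss A) gauss_of
  gauss_of_additive.
HB.instance Definition _ := GRing.isMultiplicative.Build A (gauss A) gauss_of
  gauss_of_multiplicative.

Definition gconj u := Gauss (re u) (- im u).
Lemma gconj_additive : additive gconj.
Proof. by move=> u v; apply: gauss_eq => //=; ring. Qed.
Lemma gconj_multiplicative : multiplicative gconj.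
Proof. by split=> [u v|]; apply: gauss_eq => //=; ring. Qed.
HB.instance Definition _ := GRing.isAdditive.Build (gauss A) (gauss A) gconj
  gconj_additive.
HB.instance Definition _ := GRing.isMultiplicative.Build (gauss A) (gauss A)
  gconj gconj_multiplicative.

Lemma gconjK : involutive gconj.
Proof. by move=> u; apply: gauss_eq => //=; rewrite opprK. Qed.
Lemma gconj_of a : gconj (gauss_of a) = gauss_of a.
Proof. by apply: gauss_eq => //=; rewrite oppr0. Qed.

Definition gnorm u := re u ^+ 2 + im u ^+ 2.
Lemma mul_gconj u : u * gconj u = gauss_of (gnorm u).
Proof. by apply: gauss_eq => /=; rewrite /gnorm; ring. Qed.
Lemma gnormM u v : gnorm (u * v) = gnorm u * gnorm v.
Proof. by rewrite /gnorm /=; ring. Qed.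

End GaussRing.

Section GaussMap.
Variables (A B : comNzRingType) (f : {rmorphism A -> B}).
Definition gmap (u : gauss A) := Gauss (f (re u)) (f (im u)).
Lemma gmap_additive : additive gmap.
Proof. by move=> u v; apply: gauss_eq => /=; rewrite rmorphB. Qed.
Lemma gmap_multiplicative : multiplicative gmap.
Proof.
by split=> [u v|]; apply: gauss_eq => /=;
  rewrite ?rmorphB ?rmorphD ?rmorphM ?rmorph1 ?rmorph0.
Qed.
HB.instance Definition _ := GRing.isAdditive.Build (gauss A) (gauss B) gmap
  gmap_additive.
HB.instance Definition _ := GRing.isMultiplicative.Build (gauss A) (gauss B)
  gmap gmap_multiplicative.
Lemma gmap_conj u : gmap (gconj u) = gconj (gmap u).
Proof. by apply: gauss_eq => //=; rewrite rmorphN. Qed.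
Lemma gmap_of a : gmap (gauss_of a) = gauss_of (f a).
Proof. by apply: gauss_eq => //=; rewrite rmorph0. Qed.
Lemma gnorm_gmap u : gnorm (gmap u) = f (gnorm u).
Proof. by rewrite /gnorm /=; ring. Qed.
End GaussMap.

Section Eval.
Variables (A : comNzRingType) (j : A) (jj : j ^+ 2 = -1).
(** The evaluation at a square root j of -1 in A. *)
Definition geval (u : gauss A) := re u + j * im u.
Lemma gevalM u v : geval (u * v) = geval u * geval v.
Proof.
rewrite /geval /=.
transitivity (re u * re v - im u * im v + j * (re u * im v + im u * re v)
  + (j ^+ 2 + 1) * (im u * im v)); last ring.
by rewrite jj; ring.
Qed.
End Eval.

(** * The powers of the tautological bundle over the sphere *)
Section Bundle.
Variables (k : fieldType) (n : nat).

Record bpoint (A : Type) := BPoint { bp_u : gauss A; bp_z : A; bp_v : gauss A;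
  bp_w : gauss A }.

(** The two equations are multiples of one another where 1 + z or 1 - z is
    invertible; together they define the line bundle everywhere. *)
Definition in_bundle (A : comNzRingType) (x : bpoint A) : Prop :=
  [/\ gnorm (bp_u x) + bp_z x ^+ 2 = 1,
      gauss_of (1 + bp_z x) ^+ n * bp_w x = gconj (bp_u x) ^+ n * bp_v x &
      bp_u x ^+ n * bp_w x = gauss_of (1 - bp_z x) ^+ n * bp_v x].

Definition bpoint_map (A B : comNzRingType) (f : {rmorphism A -> B}) (x :
  bpoint A) :=
  BPoint (gmap f (bp_u x)) (f (bp_z x)) (gmap f (bp_v x)) (gmap f (bp_w x)).

Lemma in_bundle_map (A B : comNzRingType) (f : {rmorphism A -> B}) (x : bpoint
  A) :
  in_bundle x -> in_bundle (bpoint_map f x).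
Proof.
case=> e1 e2 e3; split => /=.
- by rewrite gnorm_gmap -rmorphXn -rmorphD e1 rmorph1.
- have := congr1 (gmap f) e2.
  by rewrite !rmorphM !rmorphXn /= gmap_of gmap_conj rmorphD rmorph1.
- have := congr1 (gmap f) e3.
  by rewrite !rmorphM !rmorphXn /= gmap_of rmorphB rmorph1.
Qed.

Definition bundle_points (A : comAlgType k) := {x : bpoint A | in_bundle x}.
Definition bundle_act (A B : comAlgType k) (f : {lrmorphism A -> B})
  (x : bundle_points A) : bundle_points B :=
  exist _ (bpoint_map f (sval x)) (in_bundle_map f (svalP x)).

Lemma bpoint_map_id (A : comNzRingType) (f : {rmorphism A -> A}) x :
  f =1 id -> bpoint_map f x = x.
Proof. by case: x => [[a b] c [d e] [g h]] fE;
  rewrite /bpoint_map /gmap /= !fE. Qed.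
Lemma bpoint_map_comp (A B C : comNzRingType) (f : {rmorphism A -> B})
   (g : {rmorphism B -> C}) (h : {rmorphism A -> C}) x :
  h =1 g \o f -> bpoint_map h x = bpoint_map g (bpoint_map f x).
Proof. by move=> hE; rewrite /bpoint_map /gmap /= !hE. Qed.

Lemma bundle_act_id (A : comAlgType k) (f : {lrmorphism A -> A})
  (x : bundle_points A) : f =1 id -> bundle_act f x = x.
Proof. by case: x => x xE fE; apply: eq_exist; exact: bpoint_map_id. Qed.
Lemma bundle_act_comp (A B C : comAlgType k) (f : {lrmorphism A -> B})
  (g : {lrmorphism B -> C}) (h : {lrmorphism A -> C}) (x : bundle_points A) :
  h =1 g \o f -> bundle_act h x = bundle_act g (bundle_act f x).
Proof. by case: x => x xE hE; apply: eq_exist; exact: bpoint_map_comp. Qed.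

Definition bundle : functor k := Functor bundle_act_id bundle_act_comp.
End Bundle.

(** * Conjugate coordinates *)
Section PairOfConjugates.
Variables (A : comNzRingType) (j h : A) (jj : j ^+ 2 = -1) (hh : h + h = 1).

(** The element with value p at j and value q at -j; here h is one half. *)
Definition of_conjugates (p q : A) : gauss A := Gauss (h * (p + q)) (- j * h *
  (p - q)).

Lemma geval_of_conjugates p q : geval j (of_conjugates p q) = p.
Proof.
rewrite /geval /=.
transitivity (h * (p + q) - j ^+ 2 * h * (p - q)); first by ring.
by rewrite jj; transitivity ((h + h) * p); [ring | rewrite hh mul1r].
Qed.

Lemma gevalN_of_conjugates p q : geval (- j) (of_conjugates p q) = q.
Proof.
rewrite /geval /=.
transitivity (h * (p + q) + j ^+ 2 * h * (p - q)); first by ring.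
by rewrite jj; transitivity ((h + h) * q); [ring | rewrite hh mul1r].
Qed.

Lemma of_conjugatesK u : of_conjugates (geval j u) (geval (- j) u) = u.
Proof.
rewrite /of_conjugates /geval; apply: gauss_eq => /=.
  by transitivity ((h + h) * re u); [ring | rewrite hh mul1r].
transitivity (- j ^+ 2 * (h + h) * im u); first by ring.
by rewrite hh jj; ring.
Qed.

Lemma geval_inj u v : geval j u = geval j v -> geval (- j) u = geval (- j) v ->
  u = v.
Proof. by move=> e1 e2; rewrite -[u]of_conjugatesK e1 e2 of_conjugatesK. Qed.

Lemma gevalX (u : gauss A) n : geval j (u ^+ n) = geval j u ^+ n.
Proof.
elim: n => [|n IH]; first by rewrite !expr0 /geval /= mulr0 addr0.
by rewrite !exprS gevalM // IH.
Qed.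
End PairOfConjugates.

Lemma geval_of (A : comNzRingType) (j a : A) : geval j (gauss_of a) = a.
Proof. by rewrite /geval /= mulr0 addr0. Qed.
Lemma geval_conj (A : comNzRingType) (j : A) u : geval j (gconj u) = geval (-
  j) u.
Proof. by rewrite /geval /= mulrN mulNr. Qed.
Lemma geval_mul_conj (A : comNzRingType) (j : A) u : j ^+ 2 = -1 ->
  geval j u * geval (- j) u = gnorm u.
Proof. by move=> jj; rewrite -geval_conj -gevalM // mul_gconj geval_of. Qed.
Lemma gmap_geval (A B : comNzRingType) (f : {rmorphism A -> B}) j u :
  f (geval j u) = geval (f j) (gmap f u).
Proof. by rewrite /geval rmorphD rmorphM. Qed.

Lemma gmap_of_conjugates (A B : comNzRingType) (f : {rmorphism A -> B}) j h p q
  :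
  gmap f (of_conjugates j h p q) = of_conjugates (f j) (f h) (f p) (f q).
Proof. by apply: gauss_eq => /=;
  rewrite !rmorphM ?rmorphD ?rmorphN ?rmorphB. Qed.

(** 1 + X and 1 - X have sum 2, hence are coprime, and so are their powers. *)
Lemma poly_bezout (F : realFieldType) (n : nat) : exists q : {poly F} * {poly
  F},
  (1 + 'X) ^+ n * q.1 + (1 - 'X) ^+ n * q.2 = 1.
Proof.
have : coprimep ((1 + 'X) ^+ n : {poly F}) ((1 - 'X) ^+ n).
  apply: coprimep_expl; apply: coprimep_expr; apply/Bezout_eq1_coprimepP.
  exists (2^-1%:P, 2^-1%:P) => /=; rewrite -mulrDr addrACA subrr addr0.
  by rewrite -polyCD -polyCM mulVf // pnatr_eq0.
by case/Bezout_eq1_coprimepP => q qE; exists q; rewrite mulrC [_ * q.2]mulrC.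
Qed.

Lemma horner_alg_map (F : fieldType) (A B : comAlgType F)
  (f : {lrmorphism A -> B}) (a : A) (p : {poly F}) :
  f (horner_alg a p) = horner_alg (f a) p.
Proof.
elim/poly_ind: p => [|p c IH]; first by rewrite !rmorph0.
by rewrite !rmorphD !rmorphM /= !horner_algX !horner_algC IH rmorph_alg.
Qed.

(** * Coordinates on the product of the sphere and the plane *)
Section Coordinates.
Import mpoly.
Variable R : realType.
Let X : functor R := product (sphere R) (affine_space R 2).

Lemma sphere_zeros (A : comAlgType R) (v : 'rV[A]_3) :
  zeros [set (\sum_(i < 3) 'X_i ^+ 2 - 1 : {mpoly R[3]})]%classic v <->
  v ord0 0 ^+ 2 + v ord0 1 ^+ 2 + v ord0 2 ^+ 2 = 1.
Proof.
have E : mmap (in_alg A) (v ord0)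
    (\sum_(i < 3) 'X_i ^+ 2 - 1) =
    v ord0 0 ^+ 2 + v ord0 1 ^+ 2 + v ord0 2 ^+ 2 - 1.
  rewrite rmorphB rmorph1 rmorph_sum /= !big_ord_recl big_ord0 addr0.
  rewrite !rmorphXn /= !mmapX !mmap1U addrA.
  by congr (v _ _ ^+ 2 + v _ _ ^+ 2 + v _ _ ^+ 2 - 1); apply: val_inj.
split=> [/(_ _ erefl)|e]; first by rewrite E => /eqP; rewrite subr_eq0 => /eqP.
by move=> p ->; rewrite E e subrr.
Qed.

Definition X_u (A : comAlgType R) (x : X A) : gauss A :=
  Gauss (sval x.1 ord0 0) (sval x.1 ord0 1).
Definition X_z (A : comAlgType R) (x : X A) : A := sval x.1 ord0 2.
Definition X_v (A : comAlgType R) (x : X A) : A * A :=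
  (sval x.2 ord0 0, sval x.2 ord0 1).

Lemma X_sphere (A : comAlgType R) (x : X A) : gnorm (X_u x) + X_z x ^+ 2 = 1.
Proof. by case: x => [[v vE] w]; apply/sphere_zeros. Qed.

Definition row3 (A : Type) (a b c : A) : 'rV[A]_3 :=
  \row_i (if i == 0 then a else if i == 1 then b else c).
Definition row2 (A : Type) (a b : A) : 'rV[A]_2 :=
  \row_i (if i == 0 then a else b).

Lemma row3_zeros (A : comAlgType R) (u : gauss A) z :
  gnorm u + z ^+ 2 = 1 ->
  zeros [set (\sum_(i < 3) 'X_i ^+ 2 - 1 : {mpoly R[3]})]%classic
    (row3 (re u) (im u) z).
Proof. by move=> e; apply/sphere_zeros; rewrite !mxE. Qed.

Lemma no_zeros (A : comAlgType R) n (v : 'rV[A]_n) : zeros set0 v.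
Proof. by []. Qed.

Definition X_point (A : comAlgType R) (u : gauss A) z (e : gnorm u + z ^+ 2 = 1)
  (v : A * A) : X A :=
  (exist _ _ (row3_zeros e), exist _ (row2 v.1 v.2) (@no_zeros _ _ _)).

Lemma X_u_point (A : comAlgType R) (u : gauss A) z e v : X_u (@X_point A u z e
  v) = u.
Proof. by apply: gauss_eq; rewrite /= !mxE. Qed.
Lemma X_z_point (A : comAlgType R) (u : gauss A) z e v : X_z (@X_point A u z e
  v) = z.
Proof. by rewrite /X_z /= !mxE. Qed.
Lemma X_v_point (A : comAlgType R) (u : gauss A) z e v : X_v (@X_point A u z e
  v) = v.
Proof. by case: v => a b; rewrite /X_v /= !mxE. Qed.

Lemma ord3_ind (P : 'I_3 -> Prop) : P 0 -> P 1 -> P 2 -> forall i, P i.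
Proof.
move=> P0 P1 P2 [[|[|[|i]]] hi] //.
- by have -> : Ordinal hi = 0 by apply: val_inj.
- by have -> : Ordinal hi = 1 by apply: val_inj.
- by have -> : Ordinal hi = 2 by apply: val_inj.
Qed.
Lemma ord2_ind (P : 'I_2 -> Prop) : P 0 -> P 1 -> forall i, P i.
Proof.
move=> P0 P1 [[|[|i]] hi] //.
- by have -> : Ordinal hi = 0 by apply: val_inj.
- by have -> : Ordinal hi = 1 by apply: val_inj.
Qed.

Lemma X_eq (A : comAlgType R) (x y : X A) : X_u x = X_u y -> X_z x = X_z y ->
  X_v x = X_v y -> x = y.
Proof.
case: x y => [[a ?] [b ?]] [[c ?] [d ?]] [e0 e1] e2 [e3 e4].
by congr (_, _); apply: eq_exist; apply/rowP;
  [apply: ord3_ind | apply: ord2_ind].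
Qed.

Lemma X_u_act (A B : comAlgType R) (f : {lrmorphism A -> B}) (x : X A) :
  X_u (act f x) = gmap f (X_u x).
Proof. by apply: gauss_eq; rewrite /= mxE. Qed.
Lemma X_z_act (A B : comAlgType R) (f : {lrmorphism A -> B}) (x : X A) :
  X_z (act f x) = f (X_z x).
Proof. by rewrite /X_z /= mxE. Qed.
Lemma X_v_act (A B : comAlgType R) (f : {lrmorphism A -> B}) (x : X A) :
  X_v (act f x) = (f (X_v x).1, f (X_v x).2).
Proof. by rewrite /X_v /= !mxE. Qed.

End Coordinates.

Arguments X_u : simpl never.
Arguments X_z : simpl never.
Arguments X_v : simpl never.

Lemma bpoint_eq (A : Type) (x y : bpoint A) : bp_u x = bp_u y -> bp_z x = bp_z
  y ->
  bp_v x = bp_v y -> bp_w x = bp_w y -> x = y.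
Proof. by case: x y => ? ? ? ? [? ? ? ?] /= -> -> -> ->. Qed.

(** * Triviality of the complexified bundles *)
Section Splitting.
Variables (A : comNzRingType) (j h : A) (jj : j ^+ 2 = -1) (hh : h + h = 1).
Variables (n : nat) (q1 q2 : A -> A).

(** Write U and W for the values of u at j and at -j, so that
    U W = (1 + z) (1 - z). The first component of each pair parametrizes L, the
    image of the projector with columns ((1 + z)^n q1, W^n q1) and
    (U^n q2, (1 - z)^n q2); the second one parametrizes the conjugate line by the
    quotient of the trivial bundle by L. *)
Definition split_bundle (u : gauss A) (z : A) (v : A * A) : bpoint A :=
  let U := geval j u in let W := geval (- j) u in
  BPoint u z
   (of_conjugates j h ((1 + z) ^+ n * q1 z * v.1 + U ^+ n * q2 z * v.2)
              (- W ^+ n * v.1 + (1 + z) ^+ n * v.2))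
   (of_conjugates j h (W ^+ n * q1 z * v.1 + (1 - z) ^+ n * q2 z * v.2)
              (- (1 - z) ^+ n * v.1 + U ^+ n * v.2)).

Definition unsplit_bundle (x : bpoint A) : A * A :=
  (geval j (bp_v x) - q2 (bp_z x) * geval (- j) (bp_w x),
   geval j (bp_w x) + q1 (bp_z x) * geval (- j) (bp_v x)).

(** The relation U W = (1 + z) (1 - z) makes all the compatibilities below work. *)
Lemma geval_poles (u : gauss A) (z : A) : gnorm u + z ^+ 2 = 1 ->
  geval j u ^+ n * geval (- j) u ^+ n = (1 + z) ^+ n * (1 - z) ^+ n.
Proof.
move=> e; rewrite -!exprMn geval_mul_conj //; congr (_ ^+ n).
have -> : gnorm u = 1 - z ^+ 2 by rewrite -e addrK.
by ring.
Qed.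

Lemma split_bundle_in (u : gauss A) (z : A) v : gnorm u + z ^+ 2 = 1 ->
  in_bundle n (split_bundle u z v).
Proof.
move=> e; have UW := geval_poles e.
have NN : (- j) ^+ 2 = -1 by rewrite sqrrN.
split=> //=; apply: (geval_inj jj hh).
- rewrite !gevalM // !gevalX // geval_of geval_conj !geval_of_conjugates //.
  by ring: UW.
- rewrite !gevalM // !gevalX // geval_of geval_conj opprK !gevalN_of_conjugates
  //.
  by ring: UW.
- rewrite !gevalM // !gevalX // geval_of !geval_of_conjugates //.
  by ring: UW.
- rewrite !gevalM // !gevalX // geval_of !gevalN_of_conjugates //.
  by ring: UW.
Qed.

Hypothesis bez : forall z, (1 + z) ^+ n * q1 z = 1 - (1 - z) ^+ n * q2 z.

Lemma split_bundleK u z v : gnorm u + z ^+ 2 = 1 ->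
  unsplit_bundle (split_bundle u z v) = v.
Proof.
move=> e; case: v => a b; have UW := geval_poles e; have bz := bez z.
by rewrite /unsplit_bundle /= !geval_of_conjugates // !gevalN_of_conjugates //;
  move: ((1 + z) ^+ n) ((1 - z) ^+ n) (geval j u ^+ n) (geval (- j) u ^+ n)
    (q1 z) (q2 z) bz {UW} => aa bb U W Q1 Q2 bz; congr (_, _); ring: bz.
Qed.

Lemma unsplit_bundleK x : in_bundle n x -> split_bundle (bp_u x) (bp_z x)
  (unsplit_bundle x) = x.
Proof.
case: x => u z v1 v2 [] /= e e2 e3; have UW := geval_poles e; have bz := bez z.
have NN : (- j) ^+ 2 = -1 by rewrite sqrrN.
have := congr1 (geval j) e2; have := congr1 (geval (- j)) e2.
have := congr1 (geval j) e3; have := congr1 (geval (- j)) e3.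
rewrite !gevalM // !gevalX // !geval_of !geval_conj opprK => m1 m2 m3 m4.
apply: bpoint_eq => //=; apply: (geval_inj jj hh);
  rewrite ?geval_of_conjugates ?gevalN_of_conjugates //= /unsplit_bundle /=;
  move: ((1 + z) ^+ n) ((1 - z) ^+ n) (geval j u ^+ n) (geval (- j) u ^+ n)
    (q1 z) (q2 z) (geval j v1) (geval (- j) v1) (geval j v2) (geval (- j) v2)
    {UW e e2 e3} bz m1 m2 m3 m4 => aa bb U W Q1 Q2 s1 s2 t1 t2 bz m1 m2 m3 m4;
  have {}bz x : (aa * Q1 + bb * Q2) * x = x by (rewrite bz; ring).
- by rewrite -[RHS]bz; ring: m2 m3.
- by rewrite -[RHS]bz; ring: m1 m4.
- rewrite -[RHS]bz -[RHS]addr0; transitivity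
    ((aa * Q1 + bb * Q2) * t1 + Q1 * (W * s1 - aa * t1) - Q1 * Q2 * (W * t2 -
      bb * s2)).
    by ring.
  by rewrite m4 m1 !subrr; ring.
- rewrite -[RHS]bz -[RHS]addr0; transitivity
    ((aa * Q1 + bb * Q2) * t2 + (U * t1 - bb * s1) - Q1 * (aa * t2 - U * s2)).
    by ring.
  by rewrite m2 m3 !subrr; ring.
Qed.
End Splitting.

Section SplittingMap.
Variables (A B : comNzRingType) (f : {rmorphism A -> B}) (j h : A) (n : nat).
Variables (q1 q2 : A -> A) (q1' q2' : B -> B) (z : A).
Hypotheses (q1E : f (q1 z) = q1' (f z)) (q2E : f (q2 z) = q2' (f z)).

Lemma bpoint_map_split u v : bpoint_map f (split_bundle j h n q1 q2 u z v) =
  split_bundle (f j) (f h) n q1' q2' (gmap f u) (f z) (f v.1, f v.2).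
Proof.
rewrite /split_bundle; set U := geval j u; set W := geval (- j) u.
have <- : f U = geval (f j) (gmap f u) by rewrite gmap_geval.
have <- : f W = geval (- f j) (gmap f u) by rewrite gmap_geval rmorphN.
apply: bpoint_eq => //; rewrite [LHS]gmap_of_conjugates /= -q1E -q2E;
  by congr of_conjugates;
    rewrite rmorphD !rmorphM ?rmorphN !rmorphXn ?rmorphD ?rmorphN ?rmorph1.
Qed.

Lemma unsplit_bundle_map (x : bpoint A) : z = bp_z x ->
  unsplit_bundle (f j) q1' q2' (bpoint_map f x) =
  (f (unsplit_bundle j q1 q2 x).1, f (unsplit_bundle j q1 q2 x).2).
Proof.
move=> zE; rewrite /unsplit_bundle /= -!zE -q1E -q2E -rmorphN -!gmap_geval.
by rewrite [f (_ - q2 z * _)]rmorphB [f (_ + q1 z * _)]rmorphD !rmorphM.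
Qed.
End SplittingMap.

Section RealForm.
Variables (R : realType) (n : nat).
Let X : functor R := product (sphere R) (affine_space R 2).
Local Notation C := (R[i]).
Local Notation phi := (real_complex R).

Section Fibre.
Variable A : comAlgType C.
Let A' : comAlgType R := restrict phi A.

Definition imag_unit : A' := ((0 +i* 1)%C : C)%:A : A.
Definition one_half : A' := (2^-1 : R) *: 1.

Lemma imag_unit_sq : imag_unit ^+ 2 = -1.
Proof.
rewrite /imag_unit; change ((((0 +i* 1)%C : C)%:A : A) ^+ 2 = -1).
rewrite -[_%:A]/(in_alg A _) -rmorphXn /=.
have -> : ((0 +i* 1)%C : C) ^+ 2 = -1.
  by apply/eqP; rewrite expr2 eq_complex /=; apply/andP; split; apply/eqP; ring.
by rewrite scaleN1r.
Qed.

Lemma one_half_double : one_half + one_half = 1.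
Proof. by rewrite -scalerDl -[_ + _]mulr2n -[X in X *: _]mulr_natl mulfV
  ?scale1r // pnatr_eq0. Qed.
End Fibre.

Lemma imag_unit_map (A B : comAlgType C) (f : {lrmorphism A -> B}) :
  restrict_mor phi f (imag_unit A) = imag_unit B.
Proof. exact: (rmorph_alg f). Qed.

Lemma one_half_map (A B : comAlgType C) (f : {lrmorphism A -> B}) :
  restrict_mor phi f (one_half A) = one_half B.
Proof. exact: rmorph_alg. Qed.

Section Mor.
Variable q : {poly R} * {poly R}.
Hypothesis qE : (1 + 'X) ^+ n * q.1 + (1 - 'X) ^+ n * q.2 = 1.

Lemma bezout_at (A : comAlgType R) (z : A) :
  (1 + z) ^+ n * horner_alg z q.1 = 1 - (1 - z) ^+ n * horner_alg z q.2.
Proof.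
have := congr1 (horner_alg z) qE.
rewrite rmorphD !rmorphM !rmorphXn rmorphD rmorphB !rmorph1 /= horner_algX.
by move=> e; apply: (canRL (addrK _)).
Qed.

Definition to_complexified_bundle (A : comAlgType C) (x : complexification X A)
  :
  complexification (bundle R n) A :=
  exist _ _ (split_bundle_in (imag_unit_sq A) (one_half_double A) n
    (fun z => horner_alg z q.1) (fun z => horner_alg z q.2) (X_v x) (X_sphere
      x)).

Lemma to_complexified_bundle_natural (A B : comAlgType C) (f : {lrmorphism A ->
  B})
  (x : complexification X A) :
  to_complexified_bundle (act f x) = act f (to_complexified_bundle x).
Proof.
have vE : X_v (act f x) = (restrict_mor phi f (X_v x).1, restrict_mor phi f
  (X_v x).2).
  by rewrite /X_v /= !mxE.
apply: eq_exist; rewrite /to_complexified_bundle [sval _]/= vE.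
rewrite [X_u (act f x)]X_u_act [X_z (act f x)]X_z_act.
rewrite -(imag_unit_map f) -(one_half_map f).
by apply/esym; apply: bpoint_map_split; exact: horner_alg_map.
Qed.

Lemma bundle_sphere (k : fieldType) (A : comAlgType k) (x : bundle k n A) :
  gnorm (bp_u (sval x)) + bp_z (sval x) ^+ 2 = 1.
Proof. by case: x => x []. Qed.

Definition of_complexified_bundle (A : comAlgType C) (x : complexification
  (bundle R n) A) :
  complexification X A :=
  X_point (bundle_sphere x)
   (unsplit_bundle (imag_unit A) (fun z => horner_alg z q.1) (fun z =>
     horner_alg z q.2)
     (sval x)).

Lemma of_complexified_bundle_natural (A B : comAlgType C) (f : {lrmorphism A ->
  B})
  (x : complexification (bundle R n) A) :
  of_complexified_bundle (act f x) = act f (of_complexified_bundle x).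
Proof.
apply: X_eq; first by rewrite [RHS]X_u_act !X_u_point.
  by rewrite [RHS]X_z_act !X_z_point.
rewrite [RHS]X_v_act !X_v_point -(imag_unit_map f).
by apply: (@unsplit_bundle_map _ _ _ _ _ _ _ _ (bp_z (sval x))) => //;
  apply: (@horner_alg_map R (restrict phi A) (restrict phi B) (restrict_mor phi
    f)).
Qed.

Lemma real_form_iso_of_bezout :
  isomorphic (complexification X) (complexification (bundle R n)).
Proof.
exists (Morphism to_complexified_bundle_natural), (Morphism
  of_complexified_bundle_natural).
move=> A; split=> x /=.
  apply: X_eq; rewrite ?X_u_point ?X_z_point ?X_v_point //.
  exact: (split_bundleK (imag_unit_sq A) (one_half_double A) (@bezout_at _) _
     (X_sphere x)).
case: x => x xE; apply: eq_exist; rewrite X_u_point X_z_point X_v_point.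
exact: (unsplit_bundleK (imag_unit_sq A) (one_half_double A) (@bezout_at _) xE).
Qed.
End Mor.

(** The Bezout coefficients have real coefficients, so they are evaluated at the
    coordinate z of a point with values in any real algebra. *)
Lemma complexified_bundle_trivial :
  isomorphic (complexification X) (complexification (bundle R n)).
Proof. by have [q qE] := poly_bezout R n;
  exact: real_form_iso_of_bezout qE. Qed.
End RealForm.

(** * Closed subschemes of affine space are quasi-projective *)
Section Isomorphic.
Variable k : fieldType.
Implicit Types X Y Z : functor k.

Lemma isomorphic_sym X Y : isomorphic X Y -> isomorphic Y X.
Proof. by case=> u [v uv]; exists v, u => A; have [] := uv A. Qed.

End Isomorphic.

(** [c] embeds X in affine space as the zero locus of [eqs]. *)
Section QuasiProjective.
Variables (k : fieldType) (N m : nat) (X : functor k).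
Variable c : forall A : comAlgType k, X A -> 'rV[A]_N.
Variable eqs : forall A : comAlgType k, 'rV[A]_N -> 'rV[A]_m.
Hypothesis c_act : forall (A B : comAlgType k) (f : {lrmorphism A -> B}) (x : X
  A),
  c (act f x) = map_mx f (c x).
Hypothesis c_inj : forall A : comAlgType k, injective (@c A).
Hypothesis c_image : forall (A : comAlgType k) (v : 'rV[A]_N),
  (exists x, c x = v) <-> eqs v = 0.
Hypothesis eqs_map : forall (A B : comAlgType k) (f : {lrmorphism A -> B}) v,
  eqs (map_mx f v) = map_mx f (eqs v).

Local Notation P := (projective_space k N).

Definition cone (A : comNzRingType) (u : 'rV[A]_N) : 'rV[A]_N.+1 :=
  \row_i (if unlift ord0 i is Some j then u ord0 j else 1).
Definition dehom (A : comNzRingType) (v : 'rV[A]_N.+1) : 'rV[A]_N :=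
  \row_i v ord0 (lift ord0 i).

Lemma coneK (A : comNzRingType) : cancel (@cone A) (@dehom A).
Proof. by move=> u; apply/rowP => i; rewrite !mxE liftK. Qed.
Lemma cone0 (A : comNzRingType) (u : 'rV[A]_N) : cone u ord0 ord0 = 1.
Proof. by rewrite mxE unlift_none. Qed.
Lemma dehomK (A : comNzRingType) (v : 'rV[A]_N.+1) : v ord0 ord0 = 1 ->
  cone (dehom v) = v.
Proof.
move=> v1; apply/rowP => i; rewrite mxE.
by case: unliftP => [j ->|->]; rewrite ?mxE ?v1.
Qed.
Lemma map_cone (A B : comNzRingType) (f : {rmorphism A -> B}) (u : 'rV[A]_N) :
  map_mx f (cone u) = cone (map_mx f u).
Proof.
apply/rowP => i; rewrite !mxE; case: unliftP => [j _|_]; rewrite ?mxE //.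
exact: rmorph1.
Qed.
Lemma map_dehom (A B : comNzRingType) (f : {rmorphism A -> B}) v :
  map_mx f (dehom v) = dehom (map_mx f v).
Proof. by apply/rowP => i; rewrite !mxE. Qed.

(** The projector of rank 1 whose image is the line through (1, u). *)
Definition line_proj (A : comNzRingType) (u : 'rV[A]_N) : 'M[A]_N.+1 :=
  (delta_mx ord0 ord0 : 'cV[A]_N.+1) *m cone u.

Lemma mul_line_proj (A : comNzRingType) (u : 'rV[A]_N) (v : 'rV[A]_N.+1) :
  v *m line_proj u = v ord0 ord0 *: cone u.
Proof.
rewrite mulmxA -mul_scalar_mx; congr (_ *m _).
by apply/matrixP => i j; rewrite !ord1 -colE !mxE eqxx mulr1n.
Qed.

Lemma line_proj_idem (A : comNzRingType) (u : 'rV[A]_N) :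
  line_proj u *m line_proj u = line_proj u.
Proof.
apply/row_matrixP => i; rewrite row_mul mul_line_proj row_mul.
rewrite [row i (delta_mx _ _)](_ : _ = ((i == ord0)%:R)%:M); last first.
  by apply/rowP => j; rewrite !ord1 !mxE andbT mulr1n.
by rewrite mul_scalar_mx !mxE unlift_none mulr1.
Qed.

Lemma map_line_proj (A B : comNzRingType) (f : {rmorphism A -> B}) (u :
  'rV[A]_N) :
  map_mx f (line_proj u) = line_proj (map_mx f u).
Proof. by rewrite map_mxM map_delta_mx map_cone. Qed.

Lemma line_proj_rank (K : fieldType) (u : 'rV[K]_N) : \rank (line_proj u) = 1%N.
Proof.
apply/eqP; rewrite eqn_leq (leq_trans (mxrankM_maxr _ _)) ?rank_leq_row //=.
rewrite lt0n mxrank_eq0; apply/eqP => /matrixP/(_ ord0 ord0)/eqP.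
have -> : line_proj u ord0 ord0 = 1; last by rewrite mxE oner_eq0.
by rewrite mxE big_ord1 mxE !eqxx mul1r cone0.
Qed.

Definition span_line (A : comAlgType k) (u : 'rV[A]_N) : set 'rV[A]_N.+1 :=
  [set v *m line_proj u | v in setT]%classic.

Lemma span_line_is_line (A : comAlgType k) (u : 'rV[A]_N) :
  is_line (span_line u).
Proof.
exists (line_proj u); split=> //; first exact: line_proj_idem.
by move=> K h; rewrite map_line_proj line_proj_rank.
Qed.

Lemma span_lineP (A : comAlgType k) (u : 'rV[A]_N) w :
  span_line u w <-> w = w ord0 ord0 *: cone u.
Proof.
split=> [[v _ <-]|->].
  by rewrite mul_line_proj !mxE unlift_none mulr1.
by exists w => //; rewrite mul_line_proj.
Qed.

Lemma line_sub (A : comAlgType k) (L : set 'rV[A]_N.+1) u v a : is_line L ->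
  L u -> L v -> L (u - a *: v).
Proof.
by case=> Q [QQ -> _] [u' _ <-] [v' _ <-]; exists (u' - a *: v') => //;
  rewrite mulmxBl scalemxAl.
Qed.

Lemma line_scale (A : comAlgType k) (L : set 'rV[A]_N.+1) v a : is_line L ->
  L v -> L (a *: v).
Proof.
by case=> Q [QQ -> _] [v' _ <-]; exists (a *: v'); rewrite // scalemxAl.
Qed.

Lemma extend_span_mem (A B : comAlgType k) (f : {lrmorphism A -> B})
  (L : set 'rV[A]_N.+1) v : L v -> extend_span f L (map_mx f v).
Proof.
move=> Lv; exists 1, 1%:M, v; split=> [i|]; last by rewrite mul1mx.
by rewrite (_ : row i v = v) //; apply/rowP => j; rewrite mxE ord1.
Qed.

(** The complement of the hyperplane at infinity: the lines on which the first
    coordinate takes the value 1. *)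
Definition finite_chart_mem (A : comAlgType k) : set (P A) :=
  fun L => exists v, sval L v /\ v ord0 ord0 = 1.

Lemma finite_chart_act (A B : comAlgType k) (f : {lrmorphism A -> B}) (L : P A)
  :
  finite_chart_mem L -> finite_chart_mem (act f L).
Proof.
case=> v [Lv v1]; exists (map_mx f v); split; last by rewrite mxE v1 rmorph1.
exact: extend_span_mem.
Qed.

Definition finite_chart : subfunctor P := Subfunctor finite_chart_act.

(** The first coordinates of the vectors of a line generate an ideal, whose
    extension along A -> B is generated by their images. *)
Lemma finite_chart_open : open_sub finite_chart.
Proof.
move=> A L; exists [set w ord0 ord0 | w in sval L]%classic => B f; split.
- case=> _ [[m' [d [l [lL ->]]]] e1];
  exists m', (fun i => f (l i ord0)), (d ord0).
  split=> [i|].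
    exists (l i ord0) => //; exists (row i l); first exact: lL.
    by rewrite mxE.
  by rewrite -[RHS]e1 mxE; apply: eq_bigr => i _; rewrite mxE.
- case=> m' [s [d [sS e1]]].
  have /choice[w wE] i : exists w, sval L w /\ f (w ord0 ord0) = s i.
    by have [_ [w Lw <-] <-] := sS i; exists w.
  exists ((\row_i d i) *m map_mx f (\matrix_i w i)); split.
    exists m', (\row_i d i), (\matrix_i w i); split=> // i.
    by rewrite rowK; have [] := wE i.
  rewrite mxE -[RHS]e1; apply: eq_bigr => i _; rewrite !mxE.
  by have [_ ->] := wE i.
Qed.

(** The first condition says that a line is generated by its vector with first
    coordinate 1. It holds on all of the finite chart, but it is also a closed
    condition, which provides the generator without a local study of projectors
    of rank 1. *)
Definition cut_mem (A : comAlgType k) : set (sub_functor finite_chart A) :=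
  fun L => (forall w, sval (sval L) w -> w ord0 ord0 = 0 -> w = 0) /\
           (forall v, sval (sval L) v -> v ord0 ord0 = 1 -> eqs (dehom v) = 0).

Definition cut_eqs (A : comAlgType k) (L : P A) (v0 : 'rV[A]_N.+1) : set A :=
  fun s => (exists w j, [/\ sval L w, w ord0 ord0 = 0 & s = w ord0 j]) \/
           (exists i, s = eqs (dehom v0) ord0 i).

(** A vector of the line extended to B is a combination of images of vectors of
    L, and each of these is a multiple of v0 plus a vector with first coordinate 0,
    which dies in B exactly when the first family of equations does. *)
Lemma cut_memP (A B : comAlgType k) (f : {lrmorphism A -> B})
  (L : sub_functor finite_chart A) v0 :
  sval (sval L) v0 -> v0 ord0 ord0 = 1 ->
  cut_mem (act f L) <-> (forall s, cut_eqs (sval L) v0 s -> f s = 0).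
Proof.
case: L => [[L Ll] LU] /= Lv0 v01; split=> [[Z1 Z2] s []|sS].
- move=> [w [j [/= Lw w0 ->]]].
  have /rowP/(_ j) : map_mx f w = 0.
    by apply: Z1; [exact: extend_span_mem | rewrite mxE w0 rmorph0].
  by rewrite !mxE.
- move=> [i ->].
  have /rowP/(_ i) : map_mx f (eqs (dehom v0)) = 0.
    rewrite -eqs_map map_dehom; apply: Z2; last by rewrite mxE v01 rmorph1.
    exact: extend_span_mem.
  by rewrite !mxE.
- have wE w : extend_span f L w -> w = w ord0 ord0 *: map_mx f v0.
    case=> m' [d [l [lL ->]]]; apply/rowP => j.
    rewrite !mxE mulr_suml; apply: eq_bigr => i _; rewrite !mxE -mulrA.
    congr (_ * _); apply/eqP; rewrite -rmorphM -subr_eq0 -rmorphB; apply/eqP.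
    apply: sS; left; exists (row i l - l i ord0 *: v0), j; split.
    - exact: line_sub.
    - by rewrite !mxE v01 mulr1 subrr.
    - by rewrite !mxE.
  split=> w /= Lw w0; first by rewrite [w]wE // w0 scale0r.
  rewrite [w]wE // w0 scale1r -map_dehom eqs_map; apply/rowP => i.
  by rewrite !mxE; apply: sS; right; exists i.
Qed.

Lemma cut_act (A B : comAlgType k) (f : {lrmorphism A -> B})
  (L : sub_functor finite_chart A) : cut_mem L -> cut_mem (act f L).
Proof.
move=> [Z1 Z2]; have [v0 [Lv0 v01]] := svalP L.
apply/(cut_memP f Lv0 v01) => s [[w [j [Lw w0 ->]]]|[i ->]].
  by rewrite (Z1 w Lw w0) mxE rmorph0.
by rewrite Z2 // mxE rmorph0.
Qed.

Definition cut : subfunctor (sub_functor finite_chart) := Subfunctor cut_act.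

Lemma cut_closed : closed_sub cut.
Proof.
move=> A L; have [v0 [Lv0 v01]] := svalP L.
by exists (cut_eqs (sval L) v0) => B f; exact: cut_memP.
Qed.

Lemma cut_uniq (A : comAlgType k) (L : sub_functor finite_chart A) v w :
  cut_mem L -> sval (sval L) v -> v ord0 ord0 = 1 -> sval (sval L) w ->
  w = w ord0 ord0 *: v.
Proof.
move=> [Z1 _] Lv v1 Lw; apply/eqP; rewrite -subr_eq0; apply/eqP.
by apply: Z1; [exact: line_sub (svalP (sval L)) _ _|rewrite !mxE v1 mulr1
  subrr].
Qed.

Lemma span_line_chart (A : comAlgType k) (x : X A) :
  finite_chart A (exist _ _ (span_line_is_line (c x))).
Proof.
exists (cone (c x)); split; last exact: cone0.
by apply/span_lineP; rewrite cone0 scale1r.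
Qed.

Definition to_chart (A : comAlgType k) (x : X A) : sub_functor finite_chart A :=
  exist _ _ (span_line_chart x).

Lemma to_chart_cut (A : comAlgType k) (x : X A) : cut A (to_chart x).
Proof.
split=> w /span_lineP wE w0; first by rewrite wE w0 scale0r.
rewrite wE w0 scale1r coneK; apply/c_image; by exists x.
Qed.

Definition to_cut (A : comAlgType k) (x : X A) : sub_functor cut A :=
  exist _ _ (to_chart_cut x).

Lemma to_cut_natural (A B : comAlgType k) (f : {lrmorphism A -> B}) (x : X A) :
  to_cut (act f x) = act f (to_cut x).
Proof.
do 3 apply: eq_exist => /=.
rewrite extend_spanE ?line_proj_idem // map_line_proj -c_act.
by [].
Qed.

Lemma of_cut_exists (A : comAlgType k) (L : sub_functor cut A) :
  exists x : X A, sval (sval (sval L)) (cone (c x)).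
Proof.
case: L => L [Z1 Z2] /=; have [v [Lv v1]] := svalP L.
by have /c_image[x xE] := Z2 v Lv v1; exists x; rewrite xE dehomK.
Qed.

Definition of_cut (A : comAlgType k) (L : sub_functor cut A) : X A :=
  sval (cid (of_cut_exists L)).
Lemma of_cutP (A : comAlgType k) (L : sub_functor cut A) :
  sval (sval (sval L)) (cone (c (of_cut L))).
Proof. by rewrite /of_cut; case: cid. Qed.

Lemma of_cut_uniq (A : comAlgType k) (L : sub_functor cut A) (x : X A) :
  sval (sval (sval L)) (cone (c x)) -> of_cut L = x.
Proof.
move=> Lx; apply: c_inj; apply: (can_inj (@coneK A)).
rewrite [LHS](cut_uniq (svalP L) Lx) ?cone0 ?scale1r //; exact: of_cutP.
Qed.

Lemma of_cut_natural (A B : comAlgType k) (f : {lrmorphism A -> B})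
  (L : sub_functor cut A) : of_cut (act f L) = act f (of_cut L).
Proof.
apply: of_cut_uniq; rewrite c_act -map_cone.
by apply: extend_span_mem; exact: of_cutP.
Qed.

(** A point of X gives the line through (1, c x); conversely a line in the cut
    is generated by a unique vector with first coordinate 1. *)
Lemma quasi_projective_of_equations : quasi_projective X.
Proof.
exists N, finite_chart, cut; split;
  [exact: finite_chart_open|exact: cut_closed|].
exists (Morphism to_cut_natural), (Morphism of_cut_natural) => A;
  split=> [x|L] /=.
  by apply: of_cut_uniq; apply/span_lineP; rewrite cone0 scale1r.
have Lx := of_cutP L.
case: L Lx => -[[L Ll] LU] LZ Lx; do 3 apply: eq_exist => /=.
apply/seteqP; split=> w.
  by move=> /span_lineP->; exact: line_scale.
move=> Lw; apply/span_lineP.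
by apply: (cut_uniq LZ Lx); rewrite ?cone0.
Qed.
End QuasiProjective.

Lemma quasi_projective_X (R : realType) :
  quasi_projective (product (sphere R) (affine_space R 2)).
Proof.
pose c (A : comAlgType R) (x : product (sphere R) (affine_space R 2) A) :
  'rV[A]_5 :=
  \row_i [tuple re (X_u x); im (X_u x); X_z x; (X_v x).1; (X_v x).2]`_i.
pose eqs (A : comAlgType R) (v : 'rV[A]_5) : 'rV[A]_1 :=
  const_mx (v ord0 (inord 0) ^+ 2 + v ord0 (inord 1) ^+ 2 + v ord0 (inord 2) ^+
    2 - 1).
have cE (A : comAlgType R) x i : (i < 5)%N -> c A x ord0 (inord i) =
   [:: re (X_u x); im (X_u x); X_z x; (X_v x).1; (X_v x).2]`_i.
  by move=> i5; rewrite mxE inordK.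
apply: (@quasi_projective_of_equations _ _ _ _ c eqs).
- move=> A B f x; apply/rowP => i; rewrite !mxE X_u_act X_z_act X_v_act.
  by case: i => -[|[|[|[|[|]]]]].
- move=> A x y /rowP e.
  have {}e i : (i < 5)%N -> [:: re (X_u x); im (X_u x); X_z x; (X_v x).1;
    (X_v x).2]`_i
     = [:: re (X_u y); im (X_u y); X_z y; (X_v y).1; (X_v y).2]`_i.
    by move=> i5; rewrite -!cE.
  apply: X_eq; [apply: gauss_eq | | ].
  + exact: (e 0%N).
  + exact: (e 1%N).
  + exact: (e 2%N).
  + by rewrite [X_v x]surjective_pairing [X_v y]surjective_pairing;
      congr (_, _); [exact: (e 3%N) | exact: (e 4%N)].
- move=> A v; split=> [[x <-]|e].
    apply/rowP => i; rewrite ord1 [LHS]mxE !cE // -[X in _ - X](X_sphere x) mxE.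
    by rewrite /gnorm /= subrr.
  have e1 : gnorm (Gauss (v ord0 (inord 0)) (v ord0 (inord 1))) + v ord0 (inord
    2) ^+ 2 = 1.
    by apply/eqP; rewrite -subr_eq0; move/rowP/(_ 0): e; rewrite !mxE => ->.
  exists (X_point e1 (v ord0 (inord 3), v ord0 (inord 4))).
  apply/rowP => i; rewrite -(inord_val i) cE // X_u_point X_z_point X_v_point.
  by case: i => -[|[|[|[|[|]]]]].
- move=> A B f v; apply/rowP => i; rewrite !mxE.
  by rewrite rmorphB !rmorphD !rmorphXn rmorph1.
Qed.

Lemma quasi_projective_bundle (k : fieldType) n : quasi_projective (bundle k n).
Proof.
pose coord (A : comAlgType k) (x : bpoint A) := [:: re (bp_u x); im (bp_u x);
  bp_z x;
  re (bp_v x); im (bp_v x); re (bp_w x); im (bp_w x)].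
pose c (A : comAlgType k) (x : bundle k n A) : 'rV[A]_7 :=
  \row_i (coord A (sval x))`_i.
pose pt_of (A : comAlgType k) (v : 'rV[A]_7) : bpoint A :=
  BPoint (Gauss (v ord0 (inord 0)) (v ord0 (inord 1))) (v ord0 (inord 2))
     (Gauss (v ord0 (inord 3)) (v ord0 (inord 4)))
     (Gauss (v ord0 (inord 5)) (v ord0 (inord 6))).
have cK (A : comAlgType k) (x : bundle k n A) : pt_of A (c A x) = sval x.
  by apply: bpoint_eq => //=;
    [apply: gauss_eq| |apply: gauss_eq|apply: gauss_eq];
    rewrite /= mxE inordK.
have ptK (A : comAlgType k) (v : 'rV[A]_7) i : (coord A (pt_of A v))`_(i :
  'I_7) = v ord0 i.
  rewrite -[in RHS](inord_val i).
  by case: i => -[|[|[|[|[|[|[|]]]]]]].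
pose eqs (A : comAlgType k) (v : 'rV[A]_7) : 'rV[A]_5 :=
  let x := pt_of A v in
  let d2 := gauss_of (1 + bp_z x) ^+ n * bp_w x - gconj (bp_u x) ^+ n * bp_v x
    in
  let d3 := bp_u x ^+ n * bp_w x - gauss_of (1 - bp_z x) ^+ n * bp_v x in
  \row_i [:: gnorm (bp_u x) + bp_z x ^+ 2 - 1; re d2; im d2; re d3; im d3]`_i.
have eqsP (A : comAlgType k) v : eqs A v = 0 <-> in_bundle n (pt_of A v).
  split=> [/rowP e|[e1 e2 e3]].
    have {}e i : (i < 5)%N -> eqs A v ord0 (inord i) = 0 by rewrite e mxE.
    by split; [|apply: gauss_eq|apply: gauss_eq]; apply/eqP; rewrite -subr_eq0;
      apply/eqP;
      [rewrite -(e 0%N) | rewrite -(e 1%N) | rewrite -(e 2%N) | rewrite -(e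
        3%N) |
       rewrite -(e 4%N)] => //; rewrite mxE inordK.
  apply/rowP => i; rewrite !mxE e1 e2 e3 !subrr.
  by case: i => -[|[|[|[|[|]]]]].
have pt_ofM (A B : comAlgType k) (f : {lrmorphism A -> B}) (v : 'rV[A]_7) :
    pt_of B (map_mx f v) = bpoint_map f (pt_of A v).
  by rewrite /pt_of /bpoint_map /gmap /= !mxE.
apply: (@quasi_projective_of_equations _ _ _ _ c eqs).
- move=> A B f x; apply/rowP => i; rewrite !mxE /=.
  by case: i => -[|[|[|[|[|[|[|]]]]]]].
- by move=> A [x xE] [y yE] e; apply: eq_exist; have := congr1 (pt_of A) e;
  rewrite !cK.
- move=> A v; split=> [[x <-]|/eqsP e].
    by apply/eqsP; rewrite cK; case: x.
  by exists (exist _ _ e); apply/rowP => i; rewrite mxE ptK.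
- move=> A B f v; apply/rowP => i; rewrite /eqs pt_ofM !mxE.
  have d2E : gauss_of (1 + f (bp_z (pt_of A v))) = gmap f (gauss_of (1 + bp_z
    (pt_of A v))).
    by rewrite gmap_of; congr gauss_of; rewrite rmorphD rmorph1.
  have d3E : gauss_of (1 - f (bp_z (pt_of A v))) = gmap f (gauss_of (1 - bp_z
    (pt_of A v))).
    by rewrite gmap_of; congr gauss_of; rewrite rmorphB rmorph1.
  rewrite [bp_u (bpoint_map _ _)]/= [bp_z (bpoint_map _ _)]/= [bp_v (bpoint_map
    _ _)]/= [bp_w (bpoint_map _ _)]/=.
  rewrite d2E d3E -gmap_conj -!rmorphXn -!rmorphM -!rmorphB gnorm_gmap /=.
  case: i => -[|[|[|[|[|]]]]] //= _.
  by rewrite [RHS]rmorphB [X in _ = X - _]rmorphD rmorph1.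
Qed.

(** * Localization *)

(** A commutative ring B, seen as an algebra through a morphism g : k -> B. *)
Definition algebra_along (k : fieldType) (B : comNzRingType)
  (g : {rmorphism k -> B}) : Type := B.

Section AlgebraAlong.
Variables (k : fieldType) (B : comNzRingType) (g : {rmorphism k -> B}).
Local Notation algebra_along := (algebra_along g).
HB.instance Definition _ := GRing.ComNzRing.on algebra_along.

Definition along_scale (c : k) (x : algebra_along) : algebra_along := g c * x.
Lemma along_scaleA a b v : along_scale a (along_scale b v) = along_scale (a *
  b) v.
Proof. by rewrite /along_scale mulrA rmorphM. Qed.
Lemma along_scale1 : left_id 1 along_scale.
Proof. by move=> v; rewrite /along_scale rmorph1 mul1r. Qed.
Lemma along_scaleDr : right_distributive along_scale +%R.
Proof. by move=> c u v; rewrite /along_scale mulrDr. Qed.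
Lemma along_scaleDl v : {morph along_scale^~ v : a b / a + b}.
Proof. by move=> a b; rewrite /along_scale rmorphD mulrDl. Qed.
HB.instance Definition _ := GRing.Zmodule_isLmodule.Build k algebra_along
  along_scaleA along_scale1 along_scaleDr along_scaleDl.
Lemma along_scaleAl (c : k) (u v : algebra_along) : c *: (u * v) = c *: u * v.
Proof. exact: mulrA. Qed.
HB.instance Definition _ :=
  GRing.Lmodule_isLalgebra.Build k algebra_along along_scaleAl.
HB.instance Definition _ := GRing.Lalgebra_isComAlgebra.Build k algebra_along.
End AlgebraAlong.

(** A_h as A[X] / (h X - 1), for h not nilpotent. *)
Module Localization.
Section Localization.
Variables (k : fieldType) (A : comAlgType k) (h : A).
Hypothesis h_nnil : forall n, h ^+ n <> 0.

Local Notation hX1 := (h%:P * 'X - 1 : {poly A}).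
Definition loc_ideal : {pred {poly A}} := fun p => `[<exists q, p = q * hX1>].

(** If a = q (h X - 1), comparing coefficients gives q_j = - h^j a for all j, and
    q_j vanishes for large j. *)
Lemma loc_ideal_pow (a : A) : a%:P \in loc_ideal -> exists n, h ^+ n * a = 0.
Proof.
move=> /asboolP[q qE]; have q0 : q`_0 = - a.
  have := congr1 (fun p : {poly A} => p`_0) qE.
  rewrite mulrBr mulr1 mulrA coefB coefMX coefC /= => ->.
  by rewrite sub0r opprK.
have qS j : q`_j.+1 = h * q`_j.
  have := congr1 (fun p : {poly A} => p`_j.+1) qE.
  rewrite mulrBr mulr1 mulrA coefB coefMX coefMC coefC /=.
  by move=> /esym/eqP; rewrite subr_eq0 mulrC => /eqP.
have qj j : q`_j = - (h ^+ j * a).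
  by elim: j => [|j IH]; rewrite ?q0 ?mul1r // qS IH exprS mulrN mulrA.
exists (size q); apply: oppr_inj; rewrite -qj oppr0.
by rewrite nth_default.
Qed.

Lemma loc_ideal_closed : @idealr_closed {poly A} loc_ideal.
Proof.
split=> [||p q r /asboolP[s ->] /asboolP[t ->]].
- by apply/asboolP; exists 0; rewrite mul0r.
- by apply/negP => /loc_ideal_pow[n]; rewrite mulr1 => /h_nnil.
- by apply/asboolP; exists (p * s + t); rewrite mulrDl mulrA.
Qed.
HB.instance Definition _ := isIdealr.Build {poly A} loc_ideal loc_ideal_closed.

Local Notation Q := {ideal_quot loc_ideal}.
Local Notation pi := (\pi_Q%qT : {poly A} -> Q).

Lemma loc_piB : additive pi. Proof. by move=> x y; rewrite !piE. Qed.
Lemma loc_piM : multiplicative pi. Proof. by split=> [x y|]; rewrite !piE. Qed.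
Definition loc_proj : {poly A} -> Q := pi.
HB.instance Definition _ := GRing.isAdditive.Build {poly A} Q loc_proj loc_piB.
HB.instance Definition _ := GRing.isMultiplicative.Build {poly A} Q loc_proj
  loc_piM.

Definition loc_of (a : A) : Q := loc_proj a%:P.
Lemma loc_of_additive : additive loc_of.
Proof. by move=> x y; rewrite /loc_of !rmorphB. Qed.
Lemma loc_of_multiplicative : multiplicative loc_of.
Proof. by split=> [x y|]; rewrite /loc_of ?rmorphM ?rmorph1. Qed.
HB.instance Definition _ := GRing.isAdditive.Build A Q loc_of loc_of_additive.
HB.instance Definition _ := GRing.isMultiplicative.Build A Q loc_of
  loc_of_multiplicative.

Definition localization : comAlgType k :=
  algebra_along (loc_of \o in_alg A : {rmorphism k -> Q}).

Lemma loc_proj_eq0 p : (loc_proj p == 0) = (p \in loc_ideal).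
Proof. by rewrite -[p in RHS]subr0 Quotient.idealrBE -[0](rmorph0 loc_proj).
  Qed.

Definition to_loc (a : A) : localization := loc_of a.
Lemma to_loc_additive : additive to_loc. Proof. exact: (rmorphB loc_of). Qed.
Lemma to_loc_multiplicative : multiplicative to_loc.
Proof. by split=> [x y|];
  [exact: (rmorphM loc_of)|exact: (rmorph1 loc_of)]. Qed.
Lemma to_loc_scalable : scalable to_loc.
Proof. by move=> c a; rewrite -mulr_algl; exact: (rmorphM loc_of). Qed.
HB.instance Definition _ := GRing.isAdditive.Build A localization to_loc
  to_loc_additive.
HB.instance Definition _ := GRing.isMultiplicative.Build A localization to_loc
  to_loc_multiplicative.
HB.instance Definition _ := GRing.isScalable.Build k A localization *:%R to_loc
  to_loc_scalable.

Section Universal.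
Variables (D : comAlgType k) (f : {lrmorphism A -> D}) (i : D).
Hypothesis fhi : f h * i = 1.

Definition loc_lift (x : localization) : D := (map_poly f (repr (x : Q))).[i].

Lemma loc_liftE p : loc_lift (loc_proj p) = (map_poly f p).[i].
Proof.
apply/eqP; rewrite -subr_eq0 -hornerN -hornerD -rmorphB /=.
have : repr (loc_proj p) - p \in loc_ideal by rewrite Quotient.idealrBE reprK.
move=> /asboolP[q ->]; rewrite rmorphM hornerM rmorphB rmorphM rmorph1 /=.
by rewrite map_polyC map_polyX hornerD hornerN hornerM hornerC hornerX hornerC
  fhi subrr mulr0.
Qed.

Lemma loc_repr (x : localization) : x = loc_proj (repr (x : Q)).
Proof. by rewrite /loc_proj reprK. Qed.

Lemma loc_lift_additive : additive loc_lift.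
Proof.
move=> x y; rewrite [x]loc_repr [y]loc_repr.
rewrite -[X in loc_lift X](rmorphB loc_proj) !loc_liftE rmorphB.
by rewrite hornerD hornerN.
Qed.
Lemma loc_lift_multiplicative : multiplicative loc_lift.
Proof.
split=> [x y|].
  rewrite [x]loc_repr [y]loc_repr -[X in loc_lift X](rmorphM loc_proj)
    !loc_liftE.
  by rewrite rmorphM hornerM.
by rewrite -[X in loc_lift X](rmorph1 loc_proj) loc_liftE rmorph1 hornerC.
Qed.
Lemma loc_lift_of a : loc_lift (to_loc a) = f a.
Proof. by rewrite loc_liftE map_polyC hornerC. Qed.
Lemma loc_lift_scalable : scalable loc_lift.
Proof.
move=> c x; have -> : c *: x = to_loc c%:A * x by [].
by rewrite loc_lift_multiplicative.1 loc_lift_of rmorph_alg mulr_algl.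
Qed.
HB.instance Definition _ := GRing.isAdditive.Build localization D loc_lift
  loc_lift_additive.
HB.instance Definition _ := GRing.isMultiplicative.Build localization D
  loc_lift loc_lift_multiplicative.
HB.instance Definition _ := GRing.isScalable.Build k localization D *:%R
  loc_lift loc_lift_scalable.

Lemma localization_lift : exists g : {lrmorphism localization -> D},
  forall a, g (to_loc a) = f a.
Proof. by exists loc_lift; exact: loc_lift_of. Qed.
End Universal.

Lemma localization_unit : to_loc h * (loc_proj 'X : localization) = 1.
Proof.
apply/eqP; rewrite -subr_eq0; change (loc_proj h%:P * loc_proj 'X - 1 == 0).
rewrite -rmorphM -[1](rmorph1 loc_proj) -rmorphB loc_proj_eq0.
by apply/asboolP; exists 1; rewrite mul1r.
Qed.

Lemma localization_ker a : to_loc a = 0 -> exists n, h ^+ n * a = 0.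
Proof. by move=> /eqP; rewrite loc_proj_eq0 => /loc_ideal_pow. Qed.

Lemma localization_frac (x : localization) :
  exists n a, to_loc h ^+ n * x = to_loc a.
Proof.
rewrite [x]loc_repr; elim/poly_ind: (repr _) => [|p c [n [a IH]]].
  exists 0%N, 0; rewrite mul1r;
    exact: (etrans (rmorph0 loc_proj) (esym (rmorph0 to_loc))).
exists n.+1, (a + h ^+ n.+1 * c).
have -> : (loc_proj (p * 'X + c%:P) : localization) =
    (loc_proj p : localization) * loc_proj 'X + to_loc c.
  by rewrite -[LHS]/(loc_proj _) rmorphD rmorphM.
rewrite mulrDr [RHS]rmorphD [X in _ = _ + X]rmorphM [X in _ = _ + X *
  _]rmorphXn /= -IH.
congr (_ + _); rewrite exprSr mulrACA localization_unit mulr1 //.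
Qed.
End Localization.

(** The properties of A_h that are used: h becomes invertible, the kernel is the
    h-power torsion, every element is a fraction, and the universal property. *)
Lemma exists_localization (k : fieldType) (A : comAlgType k) (h : A) :
  (forall n, h ^+ n <> 0) ->
  exists (B : comAlgType k) (j : {lrmorphism A -> B}),
  [/\ exists i, j h * i = 1,
      forall a, j a = 0 -> exists n, h ^+ n * a = 0,
      forall x, exists n a, j h ^+ n * x = j a &
      forall (D : comAlgType k) (f : {lrmorphism A -> D}) (i : D), f h * i = 1
        ->
        exists g : {lrmorphism B -> D}, forall a, g (j a) = f a].
Proof.
move=> hn; exists (localization hn), (to_loc hn); split.
- by eexists; exact: localization_unit.
- exact: localization_ker.
- exact: localization_frac.
- exact: localization_lift.
Qed.

End Localization.

(** The elements with a power that annihilates a form an ideal, so vanishing can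
    be tested on the localizations at elements that generate the unit ideal. *)
Lemma nilpotent_sum (A : comNzRingType) (a : A) m (c h : 'I_m -> A) :
  (forall i, exists n, h i ^+ n * a = 0) -> \sum_(i < m) c i * h i = 1 -> a = 0.
Proof.
move=> hn s1; pose J (t : A) := exists n, t ^+ n * a = 0.
suff [n] : J 1 by rewrite expr1n mul1r.
rewrite -s1; apply: (big_ind J).
- by exists 1%N; rewrite mul0r.
- move=> t u [p tp] [q uq]; exists (p + q)%N;
  rewrite exprDn mulr_suml big1 // => i _.
  rewrite mulrnAl; case: (leqP q i) => qi.
    rewrite -(subnK qi) exprD -!mulrA uq; by rewrite !mulr0 mul0rn.
  have pi : (p <= p + q - i)%N by rewrite -addnBA ?leq_addr // ltnW.
  have -> : t ^+ (p + q - i) * u ^+ i * a = t ^+ (p + q - i - p) * u ^+ i * (t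
    ^+ p * a).
    by rewrite -{1}(subnK pi) exprD; ring.
  by rewrite tp mulr0 mul0rn.
- move=> i _; have [n hin] := hn i; exists n.
  by rewrite exprMn -mulrA hin mulr0.
Qed.

(** * Integrality from two charts *)
Section IntegralOfCharts.
Variables (k : fieldType) (X : functor k).

Lemma section_eq0 (U : subfunctor X) (s : morphism (sub_functor U)
  (affine_space k 1))
  (A : comAlgType k) (x y : sub_functor U A) : sval x = sval y -> s A x = s A y.
Proof. by case: x y => x Ux [y Uy] /= e; congr (s A _); exact: eq_exist. Qed.

Definition section_val (U : subfunctor X) (s : morphism (sub_functor U)
  (affine_space k 1))
  (A : comAlgType k) (x : sub_functor U A) : A := sval (s A x) ord0 ord0.

Lemma section_val_act (U : subfunctor X) (s : morphism (sub_functor U)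
  (affine_space k 1))
  (A B : comAlgType k) (f : {lrmorphism A -> B}) (x : sub_functor U A)
  (y : sub_functor U B) : sval y = act f (sval x) ->
  section_val s y = f (section_val s x).
Proof.
move=> yE; rewrite /section_val (@section_eq0 _ s _ y (act f x) yE).
by rewrite mor_natural /= mxE.
Qed.

(** A chart Spec B -> X with B a domain, given with an embedding of B in a
    field; the point of X over this field is the generic point of the chart. *)
Record chart := Chart {
  chart_ring : comAlgType k;
  chart_field : comAlgType k;
  chart_emb : {lrmorphism chart_ring -> chart_field};
  chart_emb_inj : forall b, chart_emb b = 0 -> b = 0;
  chart_field_inv : forall a : chart_field, a <> 0 -> exists b, a * b = 1;
  chart_pt : X chart_ring }.

Variables (U : subfunctor X) (U_open : open_sub U).

Lemma unit_generates (A : comNzRingType) (S : set A) (a b : A) :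
  S a -> a * b = 1 -> generates_unit S.
Proof.
by move=> Sa ab; exists 1%N, (fun=> a), (fun=> b); rewrite big_ord1 mulrC.
Qed.

(** A nonempty open subset of a chart contains its generic point: one of the
    elements that define the open set is nonzero, hence invertible in the field. *)
Lemma generic_mem (c : chart) (A : comAlgType k) (f : {lrmorphism chart_ring c
  -> A}) :
  U A (act f (chart_pt c)) -> U _ (act (chart_emb c) (chart_pt c)).
Proof.
have [S SE] := U_open (chart_pt c); move=> /SE[m [s [d [sS e1]]]].
have [i si0] : exists i, s i <> 0.
  apply: contrapT => /forallNP s0; have /eqP := e1.
  rewrite big1 => [|i _]; first by rewrite eq_sym oner_eq0.
  by have /contrapT -> := s0 i; rewrite mulr0.
have [g Sg gE] := sS i.
have /chart_field_inv[b gb] : chart_emb c g <> 0.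
  by move=> /chart_emb_inj g0; apply: si0; rewrite -gE g0 rmorph0.
by apply/SE; apply: unit_generates gb; exists g.
Qed.

(** A function on an open set that vanishes at the generic point of a chart
    vanishes on the chart. Where U contains the locus D(g) of Spec B, the function
    is an element of B_g, which embeds in the field, so it is 0; and an arbitrary
    point of the chart in U is covered by points with values in localizations
    that receive such a B_g. *)
Lemma section_chart_eq0 (s : morphism (sub_functor U) (affine_space k 1)) (c :
  chart)
  (x0 : sub_functor U (chart_field c)) :
  sval x0 = act (chart_emb c) (chart_pt c) -> section_val s x0 = 0 ->
  forall (A : comAlgType k) (f : {lrmorphism chart_ring c -> A}) (x :
    sub_functor U A),
  sval x = act f (chart_pt c) -> section_val s x = 0.
Proof.
move=> x0E s0 A f x xE.
have [S SE] := U_open (chart_pt c).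
have /SE[m [t [d [tS e1]]]] : U A (act f (chart_pt c)) by rewrite -xE;
  exact: svalP.
apply: (nilpotent_sum _ e1) => i; have [g Sg <-] := tS i.
have [[n n0]|/forallNP fgn] := pselect (exists n, f g ^+ n = 0).
  by exists n; rewrite n0 mul0r.
have gn n : g ^+ n <> 0 by move=> g0; apply: (fgn n);
  rewrite -rmorphXn g0 rmorph0.
(* A' = A_{f g} receives B' = B_g, and the kernel of A -> A' is annihilated by a
   power of f g. *)
have [A' [j [[w jw] jker _ _]]] := Localization.exists_localization fgn.
have [B' [l [[v lv] _ lfrac luniv]]] := Localization.exists_localization gn.
apply: jker.
have UB : U B' (act l (chart_pt c)) by apply/SE; apply: unit_generates lv;
  exists g.
pose y : sub_functor U B' := exist _ _ UB.
have [psi psiE] := luniv A' (j \o f : {lrmorphism _ -> _}) w jw.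
have [b gb] : exists b, chart_emb c g * b = 1.
  by apply: chart_field_inv => /chart_emb_inj g0; apply: (gn 1%N).
have [th thE] := luniv _ _ _ gb.
have y0 : section_val s y = 0.
  have [n [a ya]] := lfrac (section_val s y).
  have th0 : th (section_val s y) = 0.
    rewrite -s0; apply/esym; apply: section_val_act.
    by rewrite x0E; apply: act_comp => z; rewrite /= thE.
  have a0 : a = 0.
    by apply: (@chart_emb_inj c); rewrite -thE -ya rmorphM /= th0 mulr0.
  have {}ya : l g ^+ n * section_val s y = 0 by rewrite ya a0 rmorph0.
  rewrite -[LHS]mul1r -(expr1n _ n) -lv exprMn mulrAC ya mul0r //.
have -> : j (section_val s x) = section_val s (act j x).
  by apply/esym; exact: section_val_act.
rewrite (@section_val_act _ s _ _ psi y) ?y0 ?rmorph0 //=.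
rewrite xE -(@act_comp _ _ _ _ _ _ _ (j \o f : {lrmorphism _ -> _})) //.
by apply: act_comp => z; rewrite /= psiE.
Qed.

End IntegralOfCharts.

Lemma nilpotent_cover2 (A : comNzRingType) (a b ca cb x : A) :
  ca * a + cb * b = 1 -> (exists n, a ^+ n * x = 0) -> (exists n, b ^+ n * x =
    0) ->
  x = 0.
Proof.
move=> e xa xb; pose h (i : 'I_2) := if i == 0 then a else b.
pose c (i : 'I_2) := if i == 0 then ca else cb.
apply: (@nilpotent_sum _ x 2 c h); first by move=> i; rewrite /h; case: ifP.
by rewrite big_ord_recl big_ord1.
Qed.

(** The point y lies in the chart over the locus where a is invertible. *)
Definition covers (k : fieldType) (X : functor k) (c : chart X) (A : comAlgType
  k)
  (y : X A) (a : A) : Prop :=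
  forall (D : comAlgType k) (f : {lrmorphism A -> D}) (i : D), f a * i = 1 ->
  exists g : {lrmorphism chart_ring c -> D}, act f y = act g (chart_pt c).

(** The maps between the coordinate rings and the fields express that the generic
    point of each chart lies in the other chart. So a function that vanishes at
    one generic point vanishes on that chart, hence at the other generic point,
    hence everywhere; and in a field a product is 0 only if a factor is. *)
Lemma integral_of_charts (k : fieldType) (X : functor k) (c d : chart X)
  (fcd : {lrmorphism chart_ring c -> chart_field d})
  (fdc : {lrmorphism chart_ring d -> chart_field c}) :
  act fcd (chart_pt c) = act (chart_emb d) (chart_pt d) ->
  act fdc (chart_pt d) = act (chart_emb c) (chart_pt c) ->
  (forall (A : comAlgType k) (y : X A), exists a b ca cb,
    [/\ ca * a + cb * b = 1, covers c y a & covers d y b]) ->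
  integral X.
Proof.
move=> cd dc cover; split; first by exists (chart_ring c); split;
  exact: chart_pt.
move=> U Uopen [A0 [[y0 Uy0]]] s t st0.
have [Uc Ud] : U _ (act (chart_emb c) (chart_pt c)) /\
               U _ (act (chart_emb d) (chart_pt d)).
  (* If U meets one of the charts, it contains both generic points; y0 is not the
   point of the zero ring, so one of a and b is not nilpotent. *)
suff [Uc|Ud] : U _ (act (chart_emb c) (chart_pt c)) \/
               U _ (act (chart_emb d) (chart_pt d)).
  - by split=> //; apply: (@generic_mem _ _ _ Uopen _ _ fdc); rewrite // dc.
  - by split=> //; apply: (@generic_mem _ _ _ Uopen _ _ fcd); rewrite // cd.
  have [a [b [ca [cb [e Ca Cb]]]]] := cover _ y0.
  have [[n n0]|/forallNP an] := pselect (exists n, a ^+ n = 0); last first.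
    have [B [j [[i ji] _ _ _]]] := Localization.exists_localization an.
    have [g gE] := Ca _ _ _ ji.
    by left; apply: (@generic_mem _ _ _ Uopen _ _ g); rewrite // -gE;
      exact: mem_act.
  have [[m m0]|/forallNP bn] := pselect (exists n, b ^+ n = 0); last first.
    have [B [j [[i ji] _ _ _]]] := Localization.exists_localization bn.
    have [g gE] := Cb _ _ _ ji.
    by right; apply: (@generic_mem _ _ _ Uopen _ _ g); rewrite // -gE;
      exact: mem_act.
  have /eqP : 1 = 0 :> A0; last by rewrite oner_eq0.
  by apply: (nilpotent_cover2 e); [exists n; rewrite n0 mul0r|exists m;
    rewrite m0 mul0r].
pose xc : sub_functor U _ := exist _ _ Uc;
  pose xd : sub_functor U _ := exist _ _ Ud.
have main (r : morphism (sub_functor U) (affine_space k 1)) :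
    section_val r xc = 0 -> forall A u, section_val r (u : sub_functor U A) = 0.
  move=> rc; have onc := section_chart_eq0 Uopen (c := c) (x0 := xc) erefl rc.
  have rd : section_val r xd = 0 by apply: (onc _ fcd); rewrite /= cd.
  have ond := section_chart_eq0 Uopen (c := d) (x0 := xd) erefl rd.
  move=> A u; have [a [b [ca [cb [e Ca Cb]]]]] := cover _ (sval u).
  apply: (nilpotent_cover2 e).
  - have [[n n0]|/forallNP an] := pselect (exists n, a ^+ n = 0).
      by exists n; rewrite n0 mul0r.
    have [B [j [[i ji] jker _ _]]] := Localization.exists_localization an.
    apply: jker; rewrite -(@section_val_act _ _ _ r _ _ j u (act j u)) //.
    by have [g gE] := Ca _ _ _ ji; apply: (onc _ g).
  - have [[n n0]|/forallNP bn] := pselect (exists n, b ^+ n = 0).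
      by exists n; rewrite n0 mul0r.
    have [B [j [[i ji] jker _ _]]] := Localization.exists_localization bn.
    apply: jker; rewrite -(@section_val_act _ _ _ r _ _ j u (act j u)) //.
    by have [g gE] := Cb _ _ _ ji; apply: (ond _ g).
have [s0|s0] := pselect (section_val s xc = 0); first by left; exact: main.
right; apply: main; have [w sw] := chart_field_inv s0.
by rewrite -[LHS]mul1r -sw mulrAC [_ * section_val t _]st0 mul0r.
Qed.

(** Open sets and functions on them are pulled back along the isomorphism. *)
Lemma integral_iso (k : fieldType) (X Y : functor k) :
  isomorphic X Y -> integral X -> integral Y.
Proof.
case=> f [g fg] [[A0 [x0]] Xint]; split; first by exists A0; split; exact: f x0.
move=> U Uopen [A1 [[y1 Uy1]]] s t st0.
have VM (A B : comAlgType k) (h : {lrmorphism A -> B}) (x : X A) :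
  U A (f A x) -> U B (f B (act h x)) by rewrite mor_natural; exact: mem_act.
pose V : subfunctor X := @Subfunctor _ _ (fun A x => U A (f A x)) VM.
have Vopen : open_sub V.
  move=> A x; have [S SE] := Uopen A (f A x); exists S => B h.
  by rewrite -SE -mor_natural.
have Ufg A y : U A y -> U A (f A (g A y)) by rewrite (fg A).2.
pose to_U A (x : sub_functor V A) : sub_functor U A := exist _ (f A (sval x))
  (svalP x).
pose to_V A (y : sub_functor U A) : sub_functor V A :=
  exist _ (g A (sval y)) (Ufg A (sval y) (svalP y)).
have to_UN (A B : comAlgType k) (h : {lrmorphism A -> B}) x :
   to_U B (act h x) = act h (to_U A x).
  by apply: eq_exist; rewrite /= mor_natural.
have to_VN (A B : comAlgType k) (h : {lrmorphism A -> B}) y :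
   to_V B (act h y) = act h (to_V A y).
  by apply: eq_exist; rewrite /= mor_natural.
have sV (r : morphism (sub_functor U) (affine_space k 1)) A B h (x :
  sub_functor V A) :
   r B (to_U B (act h x)) = act h (r A (to_U A x)).
  by rewrite to_UN mor_natural.
have U0 (r : morphism (sub_functor U) (affine_space k 1)) :
   (forall A x, sval (r A (to_U A x)) ord0 ord0 = 0) ->
   forall A u, sval (r A u) ord0 ord0 = 0.
  move=> r0 A u; rewrite -(r0 A (to_V A u)); congr (sval (r A _) _ _).
  by case: u => u Uu; apply: eq_exist; rewrite /= (fg A).2.
have [||H|H] := Xint V Vopen _ (Morphism (sV s)) (Morphism (sV t)).
- by exists A1; split; exact: (to_V _ (exist _ y1 Uy1)).
- by move=> A x; exact: st0.
- by left; apply: U0.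
- by right; apply: U0.
Qed.

(** * The complexification is integral *)
Module MpolyUniversal.
Section MpolyUniversal.
Import mpoly.
Variables (k : fieldType) (n : nat).

Section Eval.
Variables (A : comAlgType k) (v : 'I_n -> A).
Definition mpoly_eval : {mpoly k[n]} -> A := mmap (in_alg A) v.
Lemma mpoly_eval_additive : additive mpoly_eval.
Proof. exact: (rmorphB (mmap (in_alg A) v)). Qed.
Lemma mpoly_eval_multiplicative : multiplicative mpoly_eval.
Proof.
by split=> [p q|]; [exact: (rmorphM (mmap (in_alg A) v)) |
  exact: (rmorph1 (mmap (in_alg A) v))].
Qed.
Lemma mpoly_eval_scalable : scalable mpoly_eval.
Proof. by move=> c p; rewrite /mpoly_eval mmapZ mulr_algl. Qed.
HB.instance Definition _ := GRing.isAdditive.Build {mpoly k[n]} A mpoly_eval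
  mpoly_eval_additive.
HB.instance Definition _ := GRing.isMultiplicative.Build {mpoly k[n]} A
  mpoly_eval
  mpoly_eval_multiplicative.
HB.instance Definition _ := GRing.isScalable.Build k {mpoly k[n]} A *:%R
  mpoly_eval
  mpoly_eval_scalable.

End Eval.

Definition mpoly_frac : comAlgType k :=
  algebra_along (@tofrac _ \o @mpolyC n k : {rmorphism k -> {fraction {mpoly
    k[n]}}}).

Definition to_frac : {mpoly k[n]} -> mpoly_frac := @tofrac _.
Lemma to_frac_additive : additive to_frac.
Proof. exact: (rmorphB (@tofrac _)). Qed.
Lemma to_frac_multiplicative : multiplicative to_frac.
Proof. by split=> [p q|];
  [exact: (rmorphM (@tofrac _))|exact: (rmorph1 (@tofrac _))]. Qed.
Lemma to_frac_scalable : scalable to_frac.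
Proof. by move=> c p; rewrite -mul_mpolyC; exact: (rmorphM (@tofrac _)). Qed.
HB.instance Definition _ := GRing.isAdditive.Build {mpoly k[n]} mpoly_frac
  to_frac
  to_frac_additive.
HB.instance Definition _ := GRing.isMultiplicative.Build {mpoly k[n]}
  mpoly_frac to_frac
  to_frac_multiplicative.
HB.instance Definition _ := GRing.isScalable.Build k {mpoly k[n]} mpoly_frac
  *:%R to_frac
  to_frac_scalable.

Lemma mpoly_frac_inv (a : mpoly_frac) : a <> 0 -> exists b, a * b = 1.
Proof.
by move=> /eqP a0; exists ((a : {fraction {mpoly k[n]}})^-1); exact: mulfV.
Qed.

Lemma mpoly_universal : exists (B K : comAlgType k) (j : {lrmorphism B -> K})
  (x : 'I_n -> B),
  [/\ forall b, j b = 0 -> b = 0,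
      forall a : K, a <> 0 -> exists b, a * b = 1,
      forall i, x i <> 0 &
      forall (A : comAlgType k) (v : 'I_n -> A),
        exists f : {lrmorphism B -> A}, forall i, f (x i) = v i].
Proof.
exists {mpoly k[n]}, mpoly_frac, to_frac, (fun i => 'X_i); split.
- by move=> b b0; apply/eqP; rewrite -(@tofrac_eq _ b 0) rmorph0; apply/eqP.
- exact: mpoly_frac_inv.
- move=> i /(congr1 (fun p => p@_(mnm1 i))) /eqP.
  by rewrite mcoeffX eqxx mcoeff0 oner_eq0.
- move=> A v; exists (mpoly_eval v) => i.
  by rewrite /= /mpoly_eval mmapX mmap1U.
Qed.
End MpolyUniversal.
End MpolyUniversal.

Section SphereCharts.
Variable R : realType.
Let X : functor R := product (sphere R) (affine_space R 2).
Local Notation phi := (real_complex R).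
Local Notation XC := (complexification X).

Lemma gnorm_of_conjugates (A : comNzRingType) (j h p q : A) :
  j ^+ 2 = -1 -> h + h = 1 -> gnorm (of_conjugates j h p q) = p * q.
Proof.
by move=> jj hh; rewrite -(geval_mul_conj _ jj) geval_of_conjugates //
  gevalN_of_conjugates.
Qed.

Section Point.
Variables (D : comAlgType R[i]) (e : bool).
Local Notation j := (imag_unit D).
Local Notation h := (one_half D).

Lemma chart_point_sphere (t u : restrict phi D) :
  gnorm (of_conjugates j h u (t * (2 - t * u))) + ((-1) ^+ e * (t * u - 1)) ^+
    2 = 1.
Proof.
rewrite gnorm_of_conjugates; [|exact: imag_unit_sq|exact: one_half_double].
by rewrite exprMn sqrr_sign; ring.
Qed.

(** With w the conjugate of u, the sphere is u w = (1 + z) (1 - z). Where 1 - z is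
    invertible, t = w / (1 - z) = (1 + z) / u satisfies 1 + z = t u and
    w = t (2 - t u), so (t, u) are coordinates; the sign exchanges z and - z. *)
Definition chart_point (v : 'I_4 -> restrict phi D) : XC D :=
  X_point (chart_point_sphere (v 0) (v 1)) (v (inord 2), v (inord 3)).
End Point.

Lemma chart_point_act (D E : comAlgType R[i]) (f : {lrmorphism D -> E}) e
  (v : 'I_4 -> restrict phi D) :
  act f (chart_point e v) = chart_point e (fun i => f (v i)).
Proof.
have fE (a : restrict phi D) : restrict_mor phi f a = f a by [].
apply: X_eq; [rewrite [LHS]X_u_act !X_u_point|rewrite [LHS]X_z_act !X_z_point|
  rewrite [LHS]X_v_act !X_v_point //].
- rewrite gmap_of_conjugates -(imag_unit_map f) -(one_half_map f);
  congr of_conjugates.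
  by rewrite !rmorphM rmorphB rmorphM rmorphMn rmorph1.
- by rewrite rmorphM rmorph_sign rmorphB rmorphM rmorph1.
Qed.

Lemma chart_point_covers (A : comAlgType R[i]) (y : XC A) (e : bool)
  (i : restrict phi A) : (1 - (-1) ^+ e * X_z y) * i = 1 ->
  y = chart_point e (fun l : 'I_4 =>
    [:: geval (- imag_unit A) (X_u y) * i; geval (imag_unit A) (X_u y);
        (X_v y).1; (X_v y).2]`_l).
Proof.
move=> zi; have jj := imag_unit_sq A; have hh := one_half_double A.
set U := geval (imag_unit A) _; set W := geval (- imag_unit A) _.
have UW : U * W = 1 - X_z y ^+ 2.
  by rewrite /U /W (geval_mul_conj _ jj) -[1](X_sphere y) addrK.
have tU : W * i * U = 1 + (-1) ^+ e * X_z y.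
  have -> : W * i * U = (U * W) * i by ring.
  rewrite UW; transitivity ((1 + (-1) ^+ e * X_z y) * ((1 - (-1) ^+ e * X_z y)
    * i)).
    by move: ((-1) ^+ e) (sqrr_sign (restrict phi A) e) => s ss; ring: ss.
  by rewrite zi mulr1.
apply: X_eq; rewrite ?X_u_point ?X_z_point ?X_v_point /= ?inordK //.
- rewrite tU -[LHS](of_conjugatesK jj hh); congr of_conjugates.
  by rewrite -/W -[LHS]mulr1 -[X in _ * X]zi; ring.
- by rewrite tU addrC addKr mulrA -expr2 sqrr_sign mul1r.
Qed.

(** The change of charts keeps u and replaces t by (2 - t u) / u. *)
Lemma chart_transition (K : comAlgType R[i]) (e : bool) (t u w f g : restrict
  phi K) :
  u * w = 1 ->
  chart_point (~~ e) (fun l : 'I_4 => [:: (2 - t * u) * w; u; f; g]`_l) =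
  chart_point e (fun l : 'I_4 => [:: t; u; f; g]`_l).
Proof.
move=> uw; have E : (2 - t * u) * w * u = 2 - t * u by rewrite -mulrA [w *
  u]mulrC uw mulr1.
apply: X_eq; rewrite ?X_u_point ?X_z_point ?X_v_point /= ?inordK // E.
- congr of_conjugates; rewrite (_ : 2 - (2 - t * u) = t * u); last ring.
  have -> : (2 - t * u) * w * (t * u) = (2 - t * u) * t * (u * w) by ring.
  by rewrite uw mulr1 mulrC.
- by rewrite signrN mulNr -mulrN; congr (_ * _); ring.
Qed.

Lemma integral_complexified_X : integral XC.
Proof.
have [B [K [j [x [jinj Kinv x0 univ]]]]] := MpolyUniversal.mpoly_universal R[i]
  4.
pose c e := @Chart _ XC B K j jinj Kinv (chart_point e x).
have [w xw] : exists w, j (x 1) * w = 1 by apply: (Kinv (j (x 1))) => /jinj;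
  exact: x0.
pose v (i : 'I_4) : K := [:: (2 - j (x 0) * j (x 1)) * w; j (x 1);
  j (x (inord 2)); j (x (inord 3))]`_i.
have [f fE] := univ K v.
have trans e : act f (chart_pt (c e)) = act (chart_emb (c (~~ e))) (chart_pt (c
  (~~ e))).
  change (act f (chart_point e x : XC B) = act j (chart_point (~~ e) x : XC B)).
  rewrite !chart_point_act.
  transitivity (chart_point (D := K) e v).
    by apply: X_eq; rewrite ?X_u_point ?X_z_point ?X_v_point ?fE.
  rewrite -{1}(negbK e) /v (chart_transition _ _ _ _ xw).
  by apply: X_eq; rewrite ?X_u_point ?X_z_point ?X_v_point /= ?inordK.
apply: (@integral_of_charts _ _ (c false) (c true) f f);
  [exact: (trans false)|exact: (trans true)|].
move=> A y; pose b (e : bool) : restrict phi A := 1 - (-1) ^+ e * X_z y.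
exists (b false), (b true), (one_half A), (one_half A).
have cov e : covers (c e) y (b e).
  move=> D g i gi.
  have zi : (1 - (-1) ^+ e * X_z (act g y)) * (i : restrict phi D) = 1.
    by rewrite [X_z (act g y)]X_z_act -[RHS]gi; congr (_ * _);
      rewrite rmorphB rmorphM rmorph1 rmorph_sign.
  rewrite {1}(chart_point_covers zi); set vv := (X in chart_point e X).
  have [l lE] := univ D vv; exists l.
  change (chart_point e vv = act l (chart_point e x : XC B)).
  rewrite chart_point_act.
  by apply: X_eq; rewrite ?X_u_point ?X_z_point ?X_v_point ?lE.
split; [|exact: (cov false)|exact: (cov true)].
rewrite /b /= expr0 expr1 mul1r mulN1r opprK -mulrDr.
rewrite (_ : 1 - X_z y + (1 + X_z y) = 1 + 1); last ring.
by rewrite mulrDr mulr1; exact: one_half_double.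
Qed.
End SphereCharts.

(** * Affineness, smoothness and rationality *)
Section Geometry.
Variable R : realType.
Let X : functor R := product (sphere R) (affine_space R 2).

Section Affine.
Import mpoly.

Definition X_equation : {mpoly R[5]} :=
  'X_0 ^+ 2 + 'X_1 ^+ 2 + 'X_(inord 2) ^+ 2 - 1.

Lemma X_equation_zeros (A : comAlgType R) (v : 'rV[A]_5) :
  zeros [set X_equation]%classic v <->
  gnorm (Gauss (v ord0 0) (v ord0 1)) + v ord0 (inord 2) ^+ 2 = 1.
Proof.
have E : mmap (in_alg A) (v ord0) X_equation =
    gnorm (Gauss (v ord0 0) (v ord0 1)) + v ord0 (inord 2) ^+ 2 - 1.
  by rewrite rmorphB rmorph1 !rmorphD !rmorphXn /= !mmapX !mmap1U.
split=> [/(_ _ erefl)|e]; first by rewrite E => /eqP; rewrite subr_eq0 => /eqP.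
by move=> p ->; rewrite E e subrr.
Qed.

Definition X_row (A : comAlgType R) (x : X A) : 'rV[A]_5 :=
  \row_i [:: re (X_u x); im (X_u x); X_z x; (X_v x).1; (X_v x).2]`_i.

Lemma X_row_zeros (A : comAlgType R) (x : X A) :
  zeros [set X_equation]%classic (X_row x).
Proof.
by apply/X_equation_zeros; rewrite -[RHS](X_sphere x) !mxE /= inordK.
Qed.

Lemma affine_X : affine X.
Proof.
exists 5, [set X_equation]%classic.
pose to A x : affine_scheme [set X_equation]%classic A := exist _ _
  (@X_row_zeros A x).
have toN (A B : comAlgType R) (f : {lrmorphism A -> B}) x : to B (act f x) =
  act f (to A x).
  apply: eq_exist; apply/rowP => i; rewrite !mxE X_u_act X_z_act X_v_act.
  by case: i => -[|[|[|[|[|]]]]].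
pose from A (y : affine_scheme [set X_equation]%classic A) : X A :=
  X_point ((X_equation_zeros (sval y)).1 (svalP y)) (sval y ord0 (inord 3),
    sval y ord0 (inord 4)).
have fromN (A B : comAlgType R) (f : {lrmorphism A -> B}) y : from B (act f y)
  = act f (from A y).
  by apply: X_eq; rewrite ?X_u_act ?X_z_act ?X_v_act ?X_u_point ?X_z_point
    ?X_v_point /= !mxE.
exists (Morphism toN), (Morphism fromN) => A; split=> [x|[v vE]] /=.
  by apply: X_eq; rewrite ?X_u_point ?X_z_point ?X_v_point /= !mxE /= ?inordK.
apply: eq_exist; apply/rowP => i; rewrite mxE X_u_point X_z_point X_v_point /=.
by case: i => -[|[|[|[|[|]]]]] //= i5; congr (v _ _); apply: val_inj;
  rewrite /= ?inordK.
Qed.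
End Affine.

(** Lift the coordinates arbitrarily to A. The defect e = 1 - (a^2 + b^2 + z^2)
    has square 0, and (1 + e / 2)^2 (1 - e) = 1, so multiplying the lifts by
    1 + e / 2 puts them on the sphere. *)
Lemma smooth_X : smooth X.
Proof.
move=> A B p psurj pker y.
have [a aE] := psurj (re (X_u y)); have [b bE] := psurj (im (X_u y)).
have [z zE] := psurj (X_z y).
have [f fE] := psurj (X_v y).1; have [g gE] := psurj (X_v y).2.
pose s := a ^+ 2 + b ^+ 2 + z ^+ 2; pose h : A := (2^-1 : R)%:A.
have hh : h + h = 1.
  by rewrite -scalerDl -[_ + _]mulr2n -[X in X *: _]mulr_natl mulfV ?scale1r //
    pnatr_eq0.
have ps : p (1 - s) = 0.
  rewrite rmorphB rmorph1 !rmorphD !rmorphXn /= aE bE zE.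
  by rewrite -(X_sphere y) /gnorm subrr.
have ss := pker _ _ ps ps.
pose d := 1 + h * (1 - s).
have dds : d ^+ 2 * s = 1.
  have -> : d ^+ 2 * s = 1 + (h + h - 1) * s * (1 - s) - (1 - s) * (1 - s) * (1
    - h ^+ 2 * s).
    by rewrite /d; ring.
  by rewrite ss hh subrr !mul0r subr0 addr0.
have sph : gnorm (Gauss (d * a) (d * b)) + (d * z) ^+ 2 = 1.
  by rewrite -[RHS]dds /gnorm /s /=; ring.
have pd : p d = 1 by rewrite rmorphD rmorphM rmorph1 /= ps mulr0 addr0.
exists (X_point sph (f, g)).
apply: X_eq; rewrite ?X_u_act ?X_z_act ?X_v_act ?X_u_point ?X_z_point
  ?X_v_point.
- by apply: gauss_eq; rewrite /= rmorphM /= pd mul1r ?aE ?bE.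
- by rewrite rmorphM /= pd mul1r zE.
- by rewrite /= fE gE -surjective_pairing.
Qed.

Lemma generates_unit_image1 (A B : comNzRingType) (f : A -> B) (a : A) :
  generates_unit (f @` [set a])%classic <-> exists c, c * f a = 1.
Proof.
split=> [[m [s [c [sS e]]]]|[c e]].
  exists (\sum_(i < m) c i); rewrite mulr_suml -[RHS]e; apply: eq_bigr => i _.
  by have [_ -> <-] := sS i.
exists 1%N, (fun=> f a), (fun=> c); rewrite big_ord1; split=> // _.
by exists a.
Qed.

Section Rational.
Local Notation A4 := (affine_space R 4).

Definition away_from_pole (A : comAlgType R) : set (X A) :=
  fun x => exists c, c * (1 - X_z x) = 1.
Lemma away_from_pole_act (A B : comAlgType R) (f : {lrmorphism A -> B}) (x : X
  A) :
  away_from_pole x -> away_from_pole (act f x).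
Proof.
case=> c e; exists (f c).
by rewrite X_z_act -[1 in LHS](rmorph1 f) -rmorphB -rmorphM e rmorph1.
Qed.
(** The domain of the stereographic projection from the pole z = 1. *)
Definition pole_chart : subfunctor X := Subfunctor away_from_pole_act.

Definition plane_norm (A : comAlgType R) (y : A4 A) : A :=
  1 + gnorm (Gauss (sval y ord0 0) (sval y ord0 1)).
Lemma plane_norm_act (A B : comAlgType R) (f : {lrmorphism A -> B}) (y : A4 A) :
  plane_norm (act f y) = f (plane_norm y).
Proof.
by rewrite /plane_norm /gnorm /= !mxE !rmorphD rmorph1 !rmorphXn.
Qed.
Definition off_conic (A : comAlgType R) : set (A4 A) :=
  fun y => exists c, c * plane_norm y = 1.
Lemma off_conic_act (A B : comAlgType R) (f : {lrmorphism A -> B}) (y : A4 A) :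
  off_conic y -> off_conic (act f y).
Proof. by case=> c e; exists (f c);
  rewrite plane_norm_act -rmorphM e rmorph1. Qed.
(** The image of the stereographic projection is the complement of
    1 + a^2 + b^2 = 0, which has no real point but is not empty as a scheme. *)
Definition conic_chart : subfunctor A4 := Subfunctor off_conic_act.

Lemma pole_chart_open : open_sub pole_chart.
Proof.
move=> A x; exists [set 1 - X_z x]%classic => B f.
apply: (iff_trans _ (iff_sym (generates_unit_image1 f _))).
change (away_from_pole (act f x) <-> exists c, c * f (1 - X_z x) = 1).
by rewrite /away_from_pole X_z_act rmorphB rmorph1.
Qed.
Lemma conic_chart_open : open_sub conic_chart.
Proof.
move=> A y; exists [set plane_norm y]%classic => B f.
apply: (iff_trans _ (iff_sym (generates_unit_image1 f _))).
change (off_conic (act f y) <-> exists c, c * f (plane_norm y) = 1).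
by rewrite /off_conic plane_norm_act.
Qed.

Definition pole_inv (A : comAlgType R) (x : sub_functor pole_chart A) : A :=
  sval (cid (svalP x)).
Lemma pole_invP (A : comAlgType R) (x : sub_functor pole_chart A) :
  pole_inv x * (1 - X_z (sval x)) = 1.
Proof. by rewrite /pole_inv; case: cid. Qed.
Definition conic_inv (A : comAlgType R) (y : sub_functor conic_chart A) : A :=
  sval (cid (svalP y)).
Lemma conic_invP (A : comAlgType R) (y : sub_functor conic_chart A) :
  conic_inv y * plane_norm (sval y) = 1.
Proof. by rewrite /conic_inv; case: cid. Qed.

Lemma inverse_uniq (A : comNzRingType) (a b c : A) : b * a = 1 -> c * a = 1 ->
  b = c.
Proof. by move=> ba ca; rewrite -[b]mulr1 -ca mulrCA ba mulr1. Qed.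

Definition row4 (A : comAlgType R) (u : gauss A) (v : A * A) : A4 A :=
  exist _ (\row_(i < 4) [:: re u; im u; v.1; v.2]`_i) (@no_zeros _ _ _ _).

Lemma row4_act (A B : comAlgType R) (f : {lrmorphism A -> B}) u v :
  act f (row4 u v) = row4 (gmap f u) (f v.1, f v.2).
Proof.
apply: eq_exist; apply/rowP => i; rewrite !mxE.
by case: i => -[|[|[|[|]]]].
Qed.

Lemma plane_norm_row4 (A : comAlgType R) (u : gauss A) (v : A * A) :
  plane_norm (row4 u v) = 1 + gnorm u.
Proof. by rewrite /plane_norm /= !mxE; case: u. Qed.

Definition half_alg (A : comAlgType R) : A := (2^-1 : R)%:A.
Lemma half_alg_double (A : comAlgType R) : half_alg A * 2 = 1.
Proof.
by rewrite -[half_alg A]/(in_alg A _) -(rmorph_nat (in_alg A)) -rmorphM mulVf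
  ?rmorph1 // pnatr_eq0.
Qed.

(** The projection is u / (1 - z), and 1 + |u|^2 / (1 - z)^2 = 2 / (1 - z). *)
Lemma stereo_norm (A : comAlgType R) (x : sub_functor pole_chart A) :
  off_conic (row4 (gauss_of (pole_inv x) * X_u (sval x)) (X_v (sval x))).
Proof.
set c := pole_inv x; have cP : c * _ = 1 := pole_invP x.
have sE : gnorm (X_u (sval x)) = 1 - X_z (sval x) ^+ 2.
  by rewrite -[1](X_sphere (sval x)) addrK.
exists ((1 - X_z (sval x)) * half_alg A); rewrite plane_norm_row4 gnormM sE.
have -> : gnorm (gauss_of c) = c ^+ 2 by rewrite /gnorm /= expr0n addr0.
move: (X_z (sval x)) cP => z cP; have h2 := half_alg_double A.
transitivity (half_alg A * ((1 - z) + (c * (1 - z)) * (c * (1 - z)) * (1 +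
  z))); first by ring.
by rewrite cP !mul1r -[RHS]h2; ring.
Qed.

Definition stereo (A : comAlgType R) (x : sub_functor pole_chart A) :
  sub_functor conic_chart A := exist _ _ (stereo_norm x).

Lemma unstereo_sphere (A : comAlgType R) (y : sub_functor conic_chart A) :
  gnorm (gauss_of (2 * conic_inv y) *
         Gauss (sval (sval y) ord0 0) (sval (sval y) ord0 1)) +
  (1 - 2 * conic_inv y) ^+ 2 = 1.
Proof.
have := conic_invP y; rewrite /plane_norm gnormM.
set n := gnorm (Gauss _ _); set d := conic_inv y => stereo_weight.
have -> : gnorm (gauss_of (2 * d)) = 4 * d ^+ 2 by rewrite /gnorm /=; ring.
transitivity (1 + 4 * d * (d * (1 + n) - 1)); first by ring.
by rewrite stereo_weight subrr mulr0 addr0.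
Qed.

Definition unstereo_pt (A : comAlgType R) (y : sub_functor conic_chart A) : X A
  :=
  X_point (unstereo_sphere y) (sval (sval y) ord0 (inord 2), sval (sval y) ord0
    (inord 3)).

Lemma unstereo_chart (A : comAlgType R) (y : sub_functor conic_chart A) :
  away_from_pole (unstereo_pt y).
Proof.
exists (half_alg A * plane_norm (sval y)); rewrite X_z_point opprB addrC subrK.
rewrite mulrACA half_alg_double mul1r mulrC; exact: conic_invP.
Qed.

Definition unstereo (A : comAlgType R) (y : sub_functor conic_chart A) :
  sub_functor pole_chart A := exist _ _ (unstereo_chart y).

Lemma stereo_natural (A B : comAlgType R) (f : {lrmorphism A -> B}) x :
  stereo (act f x) = act f (stereo x).
Proof.
have cE : pole_inv (act f x) = f (pole_inv x).
  apply: (inverse_uniq (pole_invP _)).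
  change (f (pole_inv x) * (1 - X_z (act f (sval x))) = 1); rewrite X_z_act.
  by rewrite -[1 in LHS](rmorph1 f) -rmorphB -rmorphM pole_invP rmorph1.
apply: eq_exist.
change (row4 (gauss_of (pole_inv (act f x)) * X_u (act f (sval x))) (X_v (act f
  (sval x))) =
  act f (row4 (gauss_of (pole_inv x) * X_u (sval x)) (X_v (sval x)))).
by rewrite row4_act cE X_u_act X_v_act rmorphM /= gmap_of.
Qed.

Lemma unstereo_natural (A B : comAlgType R) (f : {lrmorphism A -> B}) y :
  unstereo (act f y) = act f (unstereo y).
Proof.
have cE : conic_inv (act f y) = f (conic_inv y).
  apply: (inverse_uniq (conic_invP _)).
  change (f (conic_inv y) * plane_norm (act f (sval y)) = 1);
    rewrite plane_norm_act.
  by rewrite -rmorphM conic_invP rmorph1.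
apply: eq_exist; change (unstereo_pt (act f y) = act f (unstereo_pt y)).
apply: X_eq; rewrite ?X_u_act ?X_z_act ?X_v_act ?X_u_point ?X_z_point
  ?X_v_point.
- rewrite cE [RHS]rmorphM; congr (_ * _); apply: gauss_eq; rewrite /= ?mxE //.
    by rewrite rmorphM rmorphMn rmorph1.
  by rewrite rmorph0.
- by rewrite cE rmorphB rmorph1 rmorphM rmorphMn rmorph1.
- by rewrite /= !mxE.
Qed.

Lemma sub_eq (Y : functor R) (U : subfunctor Y) (A : comAlgType R)
  (x y : sub_functor U A) : sval x = sval y -> x = y.
Proof. by case: x y => x Ux [y Uy] /= e; exact: eq_exist. Qed.

Lemma stereoK (A : comAlgType R) : cancel (@stereo A) (@unstereo A).
Proof.
move=> x; have cP := pole_invP x; have h2 := half_alg_double A.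
have dE : 2 * conic_inv (stereo x) = 1 - X_z (sval x).
  apply: (inverse_uniq (a := pole_inv x)); last by rewrite mulrC.
  have := conic_invP (stereo x); rewrite /= plane_norm_row4 gnormM.
  have -> : gnorm (gauss_of (pole_inv x)) = pole_inv x ^+ 2 by rewrite /gnorm
    /= expr0n addr0.
  have -> : gnorm (X_u (sval x)) = 1 - X_z (sval x) ^+ 2.
    by rewrite -[1](X_sphere (sval x)) addrK.
  move: (conic_inv _) (pole_inv x) (X_z (sval x)) cP => d c z cP dE.
  apply: etrans dE; transitivity (d * (c * (1 - z) + c * (1 + z)));
    first by ring.
  transitivity (d * (c * (1 - z) + c * (c * (1 - z)) * (1 + z)));
    first by rewrite cP mulr1.
  by rewrite {1}cP; ring.
apply: sub_eq; change (unstereo_pt (stereo x) = sval x).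
have rE : Gauss (sval (sval (stereo x)) ord0 0) (sval (sval (stereo x)) ord0 1)
  =
    gauss_of (pole_inv x) * X_u (sval x).
  by apply: gauss_eq; rewrite [LHS]mxE.
apply: X_eq; rewrite ?X_u_point ?X_z_point ?X_v_point ?rE ?dE.
- by rewrite mulrA -rmorphM mulrC [_ * pole_inv x]mulrC cP rmorph1 mulr1.
- by rewrite subKr.
- by rewrite !mxE /= ?inordK //= -surjective_pairing.
Qed.

Lemma unstereoK (A : comAlgType R) : cancel (@unstereo A) (@stereo A).
Proof.
move=> y; have dP := conic_invP y.
have cE : pole_inv (unstereo y) * (2 * conic_inv y) = 1.
  by have := pole_invP (unstereo y); rewrite /= X_z_point opprB addrC subrK.
apply: sub_eq; change (row4 (gauss_of (pole_inv (unstereo y)) * X_u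
  (unstereo_pt y))
  (X_v (unstereo_pt y)) = sval y).
rewrite X_u_point X_v_point mulrA -rmorphM cE rmorph1 mul1r.
case: (sval y) => v v0; apply: eq_exist; apply/rowP => i; rewrite mxE.
by case: i => -[|[|[|[|]]]] //= i4; congr (v _ _); apply: val_inj;
  rewrite /= ?inordK.
Qed.

Lemma rational_X : rational_of_dim 4 X.
Proof.
exists pole_chart, conic_chart.
have e : gnorm (Gauss 1 0 : gauss R^o) + (0 : R^o) ^+ 2 = 1.
  by rewrite /gnorm /= expr1n !expr0n !addr0.
have x0 : pole_chart R^o (X_point e (0, 0)) by exists 1;
  rewrite X_z_point subr0 mulr1.
split; [exact: pole_chart_open| |exact: conic_chart_open| |].
- by exists (R^o : comAlgType R); split; exists (X_point e (0, 0)).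
- by exists (R^o : comAlgType R); split; exact: stereo (exist _ _ x0).
exists (Morphism stereo_natural), (Morphism unstereo_natural) => A.
by split; [exact: stereoK|exact: unstereoK].
Qed.
End Rational.
End Geometry.

From mathcomp Require Import topology normedtype realfun trigo.

Import numFieldNormedType.Exports.
Local Open Scope classical_set_scope.

(** * Complex numbers and angles *)
Section GaussReal.
Variable R : realType.
Local Notation G := (gauss R).
Implicit Types u v w : G.

Lemma gnorm_ge0 u : 0 <= gnorm u.
Proof. by rewrite addr_ge0 // sqr_ge0. Qed.
Lemma gnorm_eq0 u : gnorm u = 0 -> u = 0.
Proof.
move=> /eqP; rewrite paddr_eq0 ?sqr_ge0 // !expf_eq0 /= => /andP[/eqP a /eqP b].
exact: gauss_eq.
Qed.
Lemma gnorm_gt0 u : u <> 0 -> 0 < gnorm u.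
Proof. by move=> u0; rewrite lt0r gnorm_ge0 andbT; apply/eqP => /gnorm_eq0. Qed.
Lemma gnorm0 : gnorm (0 : G) = 0.
Proof. by rewrite /gnorm /= expr0n addr0. Qed.
Lemma gauss_integral u v : u * v = 0 -> u = 0 \/ v = 0.
Proof.
move=> uv; have /eqP : gnorm u * gnorm v = 0 by rewrite -gnormM uv gnorm0.
by rewrite mulf_eq0 => /orP[] /eqP/gnorm_eq0; [left|right].
Qed.
Lemma gauss_mulfI u v w : u <> 0 -> u * v = u * w -> v = w.
Proof.
move=> u0 /eqP; rewrite -subr_eq0 -mulrBr => /eqP /gauss_integral[//|/eqP].
by rewrite subr_eq0 => /eqP.
Qed.
Lemma gauss_expf_neq0 u n : u <> 0 -> u ^+ n <> 0.
Proof.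
move=> u0; elim: n => [|n IH]; first by move/eqP; rewrite expr0 oner_eq0.
by rewrite exprS => /gauss_integral[].
Qed.
Lemma gauss_of_inj (a b : R) : gauss_of a = gauss_of b -> a = b.
Proof. by case. Qed.
Lemma gauss_of_neq0 (a : R) : a != 0 -> gauss_of a <> 0.
Proof. by move=> /eqP a0 /gauss_of_inj. Qed.

Definition expi (t : R) : G := Gauss (cos t) (sin t).
Lemma expiD s t : expi (s + t) = expi s * expi t.
Proof. by apply: gauss_eq; rewrite /= ?cosD ?sinD //; ring. Qed.
Lemma expi0 : expi 0 = 1.
Proof. by apply: gauss_eq; rewrite /= ?cos0 ?sin0. Qed.
Lemma expiN t : expi (- t) = gconj (expi t).
Proof. by apply: gauss_eq; rewrite /= ?cosN ?sinN. Qed.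
Lemma gnorm_expi t : gnorm (expi t) = 1.
Proof. exact: cos2Dsin2. Qed.
Lemma expi_neq0 t : expi t <> 0.
Proof. by move=> e; have := gnorm_expi t; rewrite e gnorm0 => /eqP;
  rewrite eq_sym oner_eq0. Qed.
Lemma expiMn t n : expi (t *+ n) = expi t ^+ n.
Proof. by elim: n => [|n IH]; rewrite ?expi0 // mulrS expiD IH exprS. Qed.
Lemma expi2pi : expi (pi *+ 2) = 1.
Proof. by apply: gauss_eq; rewrite /= ?cos2pi ?sin2pi. Qed.

(** A complex number determines its modulus. *)
Lemma expi_pos (r s : R) (t u : R) : 0 < r -> 0 < s ->
  gauss_of r * expi t = gauss_of s * expi u -> expi t = expi u.
Proof.
move=> r0 s0 e; have rs : r = s.
  have := congr1 (@gnorm _) e;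
    rewrite !gnormM !gnorm_expi !mulr1 /gnorm /= expr0n !addr0.
  by move=> /eqP; rewrite eqrXn2 ?ltW // => /eqP.
by move: e; rewrite -rs; apply: gauss_mulfI; apply: gauss_of_neq0;
  rewrite gt_eqF.
Qed.

Lemma expi_eq1_small (y : R) : 0 <= y < pi *+ 2 -> expi y = 1 -> y = 0.
Proof.
move=> /andP[y0 y2] [cy sy]; case: (leP y pi) => ypi.
  apply: (@cos_inj R); rewrite ?cy ?cos0 // in_itv /=; first by rewrite y0.
  by rewrite lexx pi_ge0.
have : y = pi + (y - pi) by rewrite addrC subrK.
have yp : 0 < y - pi < pi.
  by rewrite subr_gt0 ypi ltrBlDr -mulr2n.
have := sin_gt0_pi yp; rewrite -[y - pi]opprK sinN opprB.
have := sinDpi (y - pi); rewrite subrK sy => /eqP.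
rewrite eq_sym oppr_eq0 => /eqP sz.
by rewrite -opprB sinN sz !oppr0 ltxx.
Qed.

Lemma expi_eq1 (x : R) : expi x = 1 -> exists z : int, x = pi *+ 2 *~ z.
Proof.
move=> ex; pose P := pi *+ 2 : R;
  have P0 : 0 < P by rewrite mulrn_wgt0 // pi_gt0.
pose z := Num.floor (x / P); exists z.
have z1 : z%:~R <= x / P := floor_le (x / P).
have z2 : x / P < z%:~R + 1 by rewrite -[1]/(1%:~R) -intrD; exact: floorD1_gt.
rewrite ler_pdivlMr // in z1; rewrite ltr_pdivrMr // mulrDl mul1r in z2.
have Pz (m : int) : expi (P *~ m) = 1.
  case: m => m; first by rewrite -pmulrn expiMn expi2pi expr1n.
  by rewrite NegzE mulrNz -pmulrn expiN expiMn expi2pi expr1n rmorph1.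
apply/eqP; rewrite -subr_eq0; apply/eqP/expi_eq1_small.
  by rewrite -/P -[P *~ z]mulrzl subr_ge0 z1 /= ltrBlDl.
by rewrite expiD ex mul1r expiN -/P Pz rmorph1.
Qed.

(** By the intermediate value theorem a nonconstant angle would take a value at
    distance less than a full turn from f 0. *)
Lemma angle_const (f : R -> R) (L : R) : 0 <= L ->
  (forall t, 0 <= t <= L -> {for t, continuous f}) ->
  (forall t, 0 <= t <= L -> expi (f t) = expi (f 0)) -> f L = f 0.
Proof.
move=> L0 fc fe; apply/eqP/negPn/negP => fne.
have fw : {within `[0, L], continuous f}.
  by apply: continuous_in_subspaceT => t; rewrite inE /= in_itv /=; exact: fc.
have key (d : R) : 0 < `|d| < pi *+ 2 -> Num.min (f 0) (f L) <= f 0 + d <=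
  Num.max (f 0) (f L) -> False.
  move=> /andP[d0 d2] /(IVT L0 fw)[c]; rewrite in_itv /= => c0 fcE.
  have := fe c c0; rewrite fcE expiD -[RHS]mulr1 => /(gauss_mulfI (@expi_neq0
    _)) ed.
  have en : expi `|d| = 1.
    by case: (leP 0 d) => ?;
      [rewrite ger0_norm | rewrite ltr0_norm // expiN ed rmorph1].
  have := expi_eq1_small _ en; rewrite (ltW d0) d2 => /(_ isT) d00.
  by rewrite d00 ltxx in d0.
have P0 : (0 : R) < pi *+ 2 by rewrite mulrn_wgt0 // pi_gt0.
have pp : pi < pi *+ 2 :> R by rewrite mulr2n ltrDl pi_gt0.
have [lt|gt|e] := ltgtP (f 0) (f L); last by rewrite e eqxx in fne.
  apply: (key (Num.min (f L - f 0) pi)).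
    have m0 : 0 < Num.min (f L - f 0) pi by rewrite lt_min subr_gt0 lt pi_gt0.
    by rewrite gtr0_norm // m0 gt_min pp orbT.
  rewrite ge_min lerDl le_min subr_ge0 (ltW lt) pi_ge0 /=.
  rewrite le_max; apply/orP; right; rewrite -lerBrDl ge_min lexx //.
apply: (key (- Num.min (f 0 - f L) pi)).
  have m0 : 0 < Num.min (f 0 - f L) pi by rewrite lt_min subr_gt0 gt pi_gt0.
  by rewrite normrN gtr0_norm // m0 gt_min pp orbT.
have m0 : 0 <= Num.min (f 0 - f L) pi by rewrite le_min subr_ge0 (ltW gt)
  pi_ge0.
rewrite le_max gerDl oppr_le0 m0 /= andbT.
by rewrite ge_min; apply/orP; right; rewrite lerBrDr -lerBrDl ge_min lexx.
Qed.

End GaussReal.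

(** * Lifting of arguments and winding numbers *)
Section Continuity.
Variable R : realType.
Local Notation G := (gauss R).

Definition gcont_at (T : topologicalType) (f : T -> G) (x : T) : Prop :=
  {for x, continuous (fun t => re (f t))} /\ {for x, continuous (fun t => im (f
    t))}.
Definition gcont (T : topologicalType) (f : T -> G) : Prop :=
  forall x, gcont_at f x.

Section Closure.
Variables (T : topologicalType) (x : T).
Implicit Types f g : T -> G.
Lemma gcont_atM f g : gcont_at f x -> gcont_at g x -> gcont_at (fun t => f t *
  g t) x.
Proof.
case=> f1 f2 [g1 g2]; split.
  by apply: (@continuousB _ R); apply: continuousM.
by apply: (@continuousD _ R); apply: continuousM.
Qed.
Lemma gcont_atD f g : gcont_at f x -> gcont_at g x -> gcont_at (fun t => f t +
  g t) x.
Proof. by case=> f1 f2 [g1 g2]; split; apply: (@continuousD _ R). Qed.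
Lemma gcont_at_conj f : gcont_at f x -> gcont_at (fun t => gconj (f t)) x.
Proof. by case=> f1 f2; split => //; apply: (@continuousN _ R). Qed.
Lemma gcont_at_cst (c : G) : gcont_at (fun _ : T => c) x.
Proof. by split; exact: cst_continuous. Qed.
Lemma gcont_at_of (f : T -> R) : {for x, continuous f} -> gcont_at (fun t =>
  gauss_of (f t)) x.
Proof. by move=> fc; split => //=; exact: cst_continuous. Qed.
Lemma gcont_atX f n : gcont_at f x -> gcont_at (fun t => f t ^+ n) x.
Proof.
move=> fc; elim: n => [|n IH]; first exact: gcont_at_cst.
have -> : (fun t => f t ^+ n.+1) = (fun t => f t * f t ^+ n) by apply/funext =>
  t; rewrite exprS.
exact: gcont_atM.
Qed.
Lemma gcont_at_norm f : gcont_at f x -> {for x, continuous (fun t => gnorm (f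
  t))}.
Proof. by case=> f1 f2; apply: (@continuousD _ R); apply: continuousM. Qed.
End Closure.

Lemma gcont_at_comp (T U : topologicalType) (f : U -> G) (h : T -> U) x :
  {for x, continuous h} -> gcont_at f (h x) -> gcont_at (fun t => f (h t)) x.
Proof.
by move=> hc [f1 f2]; split;
  [exact: (continuous_comp hc f1) | exact: (continuous_comp hc f2)].
Qed.

Lemma pair_continuous (T U V : topologicalType) (f : T -> U) (g : T -> V) x :
  {for x, continuous f} -> {for x, continuous g} ->
  {for x, continuous (fun t => (f t, g t))}.
Proof. by move=> fc gc; exact: (cvg_pair fc gc). Qed.
Lemma fst_continuous (U V : topologicalType) (x : U * V) : {for x, continuous
  fst}.
Proof. exact: cvg_fst. Qed.
Lemma snd_continuous (U V : topologicalType) (x : U * V) : {for x, continuous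
  snd}.
Proof. exact: cvg_snd. Qed.

(** On the compact rectangle g is bounded away from 0 and uniformly continuous, so
    the quotient of two values at nearby parameters s lies in the right half
    plane. The proof is the tube argument: the inequality holds on a neighbourhood
    of each point of the rectangle for all small d, hence uniformly. *)
Lemma lift_mesh (g : R * R -> G) (L : R) : gcont g ->
  (forall s t, 0 <= s <= 1 -> 0 <= t <= L -> g (s, t) <> 0) ->
  exists2 e : R, 0 < e & forall s d t, 0 <= s <= 1 -> 0 <= t <= L -> `|d| < e ->
    0 < re (g (s + d, t) * gconj (g (s, t))).
Proof.
move=> gc g0.
pose h (x : (R * R) * R) : R := re (g (x.1.1 + x.2, x.1.2) * gconj (g x.1)).
have hc : continuous h.
  move=> x; have [] // : gcont_at (fun x : (R * R) * R => g (x.1.1 + x.2,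
    x.1.2) * gconj (g x.1)) x.
  apply: gcont_atM.
    apply: (@gcont_at_comp _ _ g (fun x : (R * R) * R => (x.1.1 + x.2,
      x.1.2))); last exact: gc.
    apply: pair_continuous.
      apply: (@continuousD _ R); last exact: snd_continuous.
      exact: (continuous_comp (@fst_continuous _ _ x) (@fst_continuous _ _
        x.1)).
    exact: (continuous_comp (@fst_continuous _ _ x) (@snd_continuous _ _ x.1)).
  apply: gcont_at_conj.
  by apply: (@gcont_at_comp _ _ g fst); [exact: fst_continuous|exact: gc].
have K : compact (`[0, 1] `*` `[0, L] : set (R * R)) by apply: compact_setX;
  exact: segment_compact.
have := (compact_near_coveringP _).1 K R (nbhs (0 : R))
  (fun e x => forall d, `|d| < e -> 0 < h (x, d)) _.
case=> [[s t] /= [sI tI]|e /= e0 eP].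
  have h0 : 0 < h ((s, t), 0).
    have -> : h ((s, t), 0) = gnorm (g (s, t)) by rewrite /h /= addr0 /gnorm;
      ring.
    apply: gnorm_gt0.
    by apply: g0; [move: sI|move: tI]; rewrite in_itv.
  have := hc ((s, t), 0) _ (@open_nbhs_nbhs _ _ _ (conj (@open_gt R 0) h0)).
  case=> -[A B] /= [nA nB] AB.
  have /nbhs_ballP[r r0 rB] := nB.
  exists (A, ball 0 r) => /=; first by split=> //; exact: nbhsx_ballx.
  move=> [x e] /= [Ax e_r] d de; apply: (AB (x, d)); split=> //=; apply: rB.
  move: e_r; rewrite /ball /= !sub0r !normrN => er.
  by apply: lt_trans de (le_lt_trans _ er); exact: ler_norm.
exists (e / 2); first by rewrite divr_gt0.
move=> s d t sI tI de.
have /eP : ball_ Num.norm 0 e (e / 2).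
  by rewrite /ball_ /= sub0r normrN gtr0_norm ?divr_gt0 // ltr_pdivrMr //
    mulr_natr mulr2n ltrDl.
move=> /(_ (s, t)) /=; apply => //; by split; rewrite /= in_itv.
Qed.

(** The argument of a number of the right half plane. *)
Definition principal_arg (u : G) : R := atan (im u / re u).
Lemma principal_argP (u : G) : 0 < re u -> exists2 r, 0 < r & u = gauss_of r *
  expi (principal_arg u).
Proof.
move=> u0; have := atan_gtNpi2 (im u / re u); have := atan_ltpi2 (im u / re u).
have := atanK (im u / re u); rewrite /tan -/(principal_arg u) => tE a1 a2.
have c0 : 0 < cos (principal_arg u) by apply: cos_gt0_pihalf; rewrite a1 a2.
exists (re u / cos (principal_arg u)); first by rewrite divr_gt0.
have u1 := lt0r_neq0 u0; have c1 := lt0r_neq0 c0.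
apply: gauss_eq => /=; rewrite mul0r ?subr0 ?addr0; first by rewrite divfK.
by rewrite mulrAC -mulrA tE mulrC divfK.
Qed.
Lemma principal_arg_cont (T : topologicalType) (f : T -> G) x : gcont_at f x ->
  0 < re (f x) -> {for x, continuous (fun t => principal_arg (f t))}.
Proof.
move=> [f1 f2] fx; apply: (@continuous_comp _ _ _ (fun t => im (f t) / re (f
  t)) atan).
  apply: (@continuousM R) => //; apply: (@continuousV R) => //.
  by rewrite gt_eqF.
exact: continuous_atan.
Qed.

(** Subdivide [0, 1] finely enough; the quotient g (1, t) / g (0, t) is then a
    product of numbers of the right half plane, and theta t is the sum of their
    principal arguments. It depends only on the restriction of g to the vertical
    of t, so it agrees at two verticals on which g agrees. *)
Lemma arg_lift (g : R * R -> G) (L : R) : gcont g ->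
  (forall s t, 0 <= s <= 1 -> 0 <= t <= L -> g (s, t) <> 0) ->
  exists theta : R -> R, [/\ forall t, 0 <= t <= L -> {for t, continuous theta},
    forall t, 0 <= t <= L -> exists2 r, 0 < r &
      g (1, t) = gauss_of r * expi (theta t) * g (0, t) &
    (forall s, g (s, 0) = g (s, L)) -> theta 0 = theta L].
Proof.
move=> gc g0; have [e e0 eP] := lift_mesh gc g0.
pose N := (Num.bound e^-1).+1; have N0 : 0 < N%:R :> R by rewrite ltr0n.
have Ne : N%:R^-1 < e.
  rewrite -[e]invrK ltf_pV2 ?posrE ?invr_gt0 //.
  apply: lt_trans (archi_boundP _) _; first by rewrite invr_ge0 ltW.
  by rewrite ltr_nat.
pose q (j : nat) (t : R) := g (j.+1%:R / N%:R, t) * gconj (g (j%:R / N%:R, t)).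
have jN (j : nat) : (j <= N)%N -> 0 <= (j%:R / N%:R : R) <= 1.
  move=> jN; rewrite divr_ge0 ?ler0n //= ler_pdivrMr // mul1r ler_nat //.
have q0 (j : nat) t : (j < N)%N -> 0 <= t <= L -> 0 < re (q j t).
  move=> jlt tI; rewrite /q -natr1 mulrDl mul1r; apply: eP => //; last first.
    by rewrite gtr0_norm // invr_gt0.
  by apply: jN; exact: ltnW.
have qc j t : gcont_at (q j) t.
  have sl s : gcont_at (fun t => g (s, t)) t.
    apply: (@gcont_at_comp _ _ g (fun t : R => (s, t))); last exact: gc.
    by apply: pair_continuous; [exact: cvg_cst|exact: cvg_id].
  by apply: gcont_atM => //; apply: gcont_at_conj.
pose theta (n : nat) (t : R) := \sum_(j < n) principal_arg (q j t).
have thE n t : (n <= N)%N -> 0 <= t <= L -> exists2 r, 0 < r &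
    g (n%:R / N%:R, t) = gauss_of r * expi (theta n t) * g (0, t).
  move=> + tI; elim: n => [|n IH] nN.
    by exists 1; rewrite // /theta big_ord0 expi0 !mul1r mul0r.
  have [r r0 rE] := IH (ltnW nN);
    have [s s0 sE] := principal_argP (q0 n t nN tI).
  have gn0 : g (n%:R / N%:R, t) <> 0 by apply: g0 => //; apply: jN; exact: ltnW.
  exists (s / gnorm (g (n%:R / N%:R, t)) * r).
    by rewrite mulr_gt0 // divr_gt0 // gnorm_gt0.
  rewrite /theta big_ord_recr /= -/(theta n t) expiD.
  have E : gauss_of (gnorm (g (n%:R / N%:R, t))) * g (n.+1%:R / N%:R, t) =
      gauss_of s * expi (principal_arg (q n t)) * (gauss_of r * expi (theta n
        t) * g (0, t)).
    by rewrite -rE -sE /q -mul_gconj; ring.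
  apply: gauss_mulfI (gauss_of_neq0 (lt0r_neq0 (gnorm_gt0 gn0))) _.
  rewrite E rmorphM rmorphM /=.
  have gV : gauss_of (gnorm (g (n%:R / N%:R, t))) * gauss_of (gnorm (g (n%:R /
    N%:R, t)))^-1 = 1.
    by rewrite -rmorphM mulfV ?rmorph1 // lt0r_neq0 // gnorm_gt0.
  rewrite -[LHS]mul1r -[X in X * _ = _]gV; ring.
exists (theta N); split.
- move=> t tI.
  have gen n : (n <= N)%N -> {for t, continuous (theta n)}.
    elim: n => [_|n IH nN].
      have -> : theta 0%N = (fun=> 0) by apply/funext => u;
        rewrite /theta big_ord0.
      exact: cst_continuous.
    have -> : theta n.+1 = (fun u => theta n u + principal_arg (q n u)).
      by apply/funext => u; rewrite /theta big_ord_recr.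
    apply: (@continuousD _ R); first exact: IH (ltnW nN).
    by apply: principal_arg_cont; [exact: qc|exact: q0].
  exact: gen.
- move=> t tI; have [r r0] := thE N t (leqnn N) tI;
  rewrite divff ?lt0r_neq0 // => rE.
  by exists r.
- by move=> gL; rewrite /theta; apply: eq_bigr => j _; rewrite /q !gL.
Qed.
End Continuity.

Section Winding.
Variable R : realType.
Local Notation G := (gauss R).
Local Notation turn := (pi *+ 2 : R).

Definition polar (r t : R) : R * R := (r * cos t, r * sin t).

Lemma turn_gt0 : 0 < turn. Proof. by rewrite mulrn_wgt0 // pi_gt0. Qed.

Lemma polar_turn r : polar r turn = polar r 0.
Proof. by rewrite /polar cos2pi sin2pi cos0 sin0. Qed.

Lemma polar_continuous (T : topologicalType) (r t : T -> R) x :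
  {for x, continuous r} -> {for x, continuous t} ->
  {for x, continuous (fun y => polar (r y) (t y))}.
Proof.
move=> rc tc; apply: pair_continuous; apply: (@continuousM R) => //.
  exact: (continuous_comp tc (@continuous_cos R _)).
exact: (continuous_comp tc (@continuous_sin R _)).
Qed.

(** Winding number 0: apply [arg_lift] to the retraction of the disc to its
    centre. *)
Lemma disc_lift (f : R * R -> G) (rho : R) : gcont f ->
  (forall x, x.1 ^+ 2 + x.2 ^+ 2 <= rho ^+ 2 -> f x <> 0) ->
  exists theta : R -> R, [/\ forall t, 0 <= t <= turn -> {for t, continuous
    theta},
    forall t, 0 <= t <= turn -> exists2 r, 0 < r &
      f (polar rho t) = gauss_of r * expi (theta t) * f (0, 0) &
    theta 0 = theta turn].
Proof.
move=> fc f0; pose g (x : R * R) := f (polar (x.1 * rho) x.2).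
have gc : gcont g.
  move=> x; apply: (@gcont_at_comp R _ _ f (fun x : R * R => polar (x.1 * rho)
    x.2)); last exact: fc.
  apply: polar_continuous; last exact: snd_continuous.
  apply: (@continuousM R); first exact: fst_continuous.
  exact: cst_continuous.
have [|th [thc thE th0]] := @arg_lift _ g turn gc.
  move=> s t /andP[s0 s1] _; apply: f0;
    rewrite /= !exprMn -mulrDr cos2Dsin2 mulr1.
  by rewrite ler_piMl ?sqr_ge0 // expr_le1.
exists th; split=> //; last by apply: th0 => s; rewrite /g /= polar_turn.
move=> t tI; have [r r0] := thE t tI; rewrite /g /= mul1r mul0r => ->.
by exists r => //; rewrite /polar !mul0r.
Qed.

(** Apply [arg_lift] to (s, t) |-> k (s t). *)
Lemma path_lift (k : R -> G) (L : R) : gcont k ->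
  (forall t, 0 <= t <= L -> k t <> 0) ->
  exists theta : R -> R, (forall t, 0 <= t <= L -> {for t, continuous theta}) /\
    (forall t, 0 <= t <= L -> exists2 r, 0 < r &
      k t = gauss_of r * expi (theta t) * k 0).
Proof.
move=> kc k0; pose g (x : R * R) := k (x.1 * x.2).
have gc : gcont g.
  move=> x; apply: (@gcont_at_comp R _ _ k (fun x : R * R => x.1 * x.2));
    last exact: kc.
  by apply: (@continuousM R); [exact: fst_continuous|exact: snd_continuous].
have [|th [thc thE _]] := @arg_lift _ g L gc.
  move=> s t /andP[s0 s1] /andP[t0 tL]; apply: k0; rewrite mulr_ge0 //=.
  by apply: le_trans tL; rewrite ler_piMl.
exists th; split=> // t tI; have [r r0] := thE t tI;
  rewrite /g /= mul1r mul0r => ->.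
by exists r.
Qed.

(** In terms of winding numbers on the circle: aN and aS have winding number 0,
    the relation reads 0 = (m or - m) - n d with d the winding number of k. *)
Lemma winding_dvd (n m : nat) (b : bool) (aN aS : R * R -> G) (k : R -> G) (rho
  sig : R) :
  gcont aN -> gcont aS -> gcont k ->
  (forall x, x.1 ^+ 2 + x.2 ^+ 2 <= rho ^+ 2 -> aN x <> 0) ->
  (forall x, x.1 ^+ 2 + x.2 ^+ 2 <= sig ^+ 2 -> aS x <> 0) ->
  (forall t, 0 <= t <= turn -> k t <> 0) -> k turn = k 0 ->
  (forall t, 0 <= t <= turn -> exists2 p, 0 < p &
     gauss_of p * aN (polar rho t) =
     expi ((-1) ^+ b * t) ^+ m * gconj (k t) ^+ n * aS (polar sig t)) ->
  (n %| m)%N.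
Proof.
move=> aNc aSc kc aN0 aS0 k0 kturn rel.
have [thN [Nc NE N0]] := disc_lift aNc aN0.
have [thS [Sc SE S0]] := disc_lift aSc aS0.
have [ph [pc pE]] := path_lift kc k0.
(* The total argument of the relation: expi (psi t) is constant up to a positive
   factor, so psi takes the same value at the two ends of the circle. *)
pose psi t := thN t - (-1) ^+ b * t *+ m + ph t *+ n - thS t.
have T0 := turn_gt0; have I0 : 0 <= (0 : R) <= turn by rewrite lexx ltW.
have I1 : 0 <= turn <= turn by rewrite lexx ltW.
have z0 : ((0 : R) ^+ 2 + 0 ^+ 2 <= rho ^+ 2) by rewrite expr0n addr0 sqr_ge0.
have s0 : ((0 : R) ^+ 2 + 0 ^+ 2 <= sig ^+ 2) by rewrite expr0n addr0 sqr_ge0.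
have aN00 := aN0 (0, 0) z0; have aS00 := aS0 (0, 0) s0; have k00 := k0 0 I0.
have psiE t : 0 <= t <= turn -> exists2 P, 0 < P &
    gauss_of P * expi (psi t) * aN (0, 0) = gconj (k 0) ^+ n * aS (0, 0).
  move=> tI; have [p p0] := rel t tI; have [r r0 ->] := NE t tI.
  have [s s1 ->] := SE t tI; have [q q0 ->] := pE t tI.
  rewrite !rmorphM /= gconj_of -expiN => e.
  exists (p * r / (q ^+ n * s)); first by rewrite divr_gt0 ?mulr_gt0 ?exprn_gt0.
  have qs : q ^+ n * s != 0 by rewrite lt0r_neq0 // mulr_gt0 ?exprn_gt0.
  have expV x : expi x * expi (- x) = 1 :> G by rewrite -expiD subrr expi0.
  have psiX : expi (psi t) = expi (thN t) * expi (- ((-1) ^+ b * t)) ^+ m *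
      expi (ph t) ^+ n * expi (- thS t).
    by rewrite /psi !expiD -mulNrn !expiMn.
  have e2 : gauss_of (p * r) * (expi (psi t) * aN (0, 0)) =
      gauss_of (q ^+ n * s) * (gconj (k 0) ^+ n * aS (0, 0)).
    rewrite psiX; transitivity ((gauss_of p * (gauss_of r * expi (thN t) * aN
      (0, 0))) *
      (expi (- ((-1) ^+ b * t)) ^+ m * expi (ph t) ^+ n * expi (- thS t))).
      by rewrite rmorphM; ring.
    rewrite e; transitivity (gauss_of (q ^+ n * s) * (gconj (k 0) ^+ n * aS (0,
      0)) *
      ((expi ((-1) ^+ b * t) * expi (- ((-1) ^+ b * t))) ^+ m *
       (expi (ph t) * expi (- ph t)) ^+ n * (expi (thS t) * expi (- thS t)))).
      by rewrite rmorphM rmorphXn !exprMn; ring.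
    by rewrite !expV !expr1n !mulr1.
  apply: (gauss_mulfI (gauss_of_neq0 qs)); rewrite -e2.
  by rewrite -[in RHS](divfK qs (p * r)) (rmorphM _ (p * r / _)) /=; ring.
have [P P0 PE] := psiE 0 I0.
have psi_const t : 0 <= t <= turn -> expi (psi t) = expi (psi 0).
  move=> /psiE[Q Q0 QE]; apply: (expi_pos Q0 P0).
  by apply: (gauss_mulfI aN00); rewrite mulrC QE -PE mulrC.
have psic t : 0 <= t <= turn -> {for t, continuous psi}.
  move=> tI; have mc (h : R -> R) l : {for t, continuous h} -> {for t,
    continuous (fun u => h u *+ l)}.
    move=> hc; have -> : (fun u => h u *+ l) = (fun u => l%:R * h u).
      by apply/funext => u; rewrite mulr_natl.
    by apply: (@continuousM R) => //; exact: cst_continuous.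
  apply: (@continuousD _ R); last by apply: (@continuousN _ R); exact: Sc.
  apply: (@continuousD _ R); last by apply: mc; exact: pc.
  apply: (@continuousD _ R); first exact: Nc.
  apply: (@continuousN _ R); apply: mc; apply: (@continuousM R);
    first exact: cst_continuous.
  exact: cvg_id.
have := angle_const (ltW T0) psic psi_const.
(* z is the winding number of k. *)
have [z zE] : exists z : int, ph turn - ph 0 = turn *~ z.
  apply: expi_eq1; have [r r0 rE] := pE turn I1; have [r' r0' rE'] := pE 0 I0.
  have e : expi (ph turn) = expi (ph 0).
    by apply: (expi_pos r0 r0'); apply: (gauss_mulfI k00);
      rewrite ![k 0 * _]mulrC -rE -rE'.
  by rewrite expiD e -expiD subrr expi0.
rewrite /psi N0 S0 mulr0 mul0rn => psiT.
have {psiT} : ((-1) ^+ b * turn) *+ m = (turn *~ z) *+ n.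
  rewrite -zE mulrnBl; move: psiT.
  move: (ph turn *+ n) (ph 0 *+ n) ((-1) ^+ b * turn *+ m) => A B C; lra.
rewrite -mulrnAr -[turn *+ m]mulr_natl mulrCA -mulrzl -[_ *+ n]mulr_natl.
move=> e; have {}e : (-1) ^+ b * m%:R = n%:R * z%:~R :> R.
  apply: (mulIf (lt0r_neq0 T0)); rewrite -mulrA -[RHS]mulrA -e; ring.
have ez : ((-1) ^+ b * m%:Z = n%:Z * z)%R.
  apply/eqP; rewrite -(eqr_int R) !intrM rmorph_sign; apply/eqP; exact: e.
have := congr1 absz ez; rewrite !abszM abszX /= exp1n mul1n => ->.
exact: dvdn_mulr.
Qed.
End Winding.

(** * Polynomial paths on the sphere *)
Section PolynomialSpheres.
Variable R : realType.

Lemma coef_sqr_top (p : {poly R}) d : (size p <= d.+1)%N ->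
  (p ^+ 2)`_(d + d) = p`_d ^+ 2.
Proof.
move=> pd; have dd : (d < (d + d).+1)%N by rewrite ltnS leq_addr.
rewrite expr2 coefM (bigD1 (Ordinal dd)) //= addnK -expr2 big1 ?addr0 // => i.
rewrite -val_eqE /= => id; have [lt|gt|e] := ltngtP i d;
  last by rewrite e eqxx in id.
- rewrite [X in _ * X]nth_default ?mulr0 //; apply: leq_trans pd _.
  by rewrite -addnBA ?(ltnW lt) // -addn1 leq_add2l subn_gt0.
- by rewrite nth_default ?mul0r //; apply: leq_trans pd gt.
Qed.

(** The coefficients of degree 2d of the three squares are squares, and their sum
    is 0 when d > 0 bounds the degrees; so d can be lowered. *)
Lemma poly_sphere_const (p q r : {poly R}) : p ^+ 2 + q ^+ 2 + r ^+ 2 = 1 ->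
  [/\ p = (p`_0)%:P, q = (q`_0)%:P & r = (r`_0)%:P].
Proof.
move=> e; suff H d : (size p <= d.+1)%N /\ (size q <= d.+1)%N /\ (size r <=
  d.+1)%N ->
   (size p <= 1)%N /\ (size q <= 1)%N /\ (size r <= 1)%N.
  have [|sp [sq sr]] := H (size p + size q + size r)%N.
    split; [|split]; apply: leqW; first by rewrite -addnA leq_addr.
      by rewrite addnAC leq_addl.
    by rewrite leq_addl.
  by split; exact: size1_polyC.
elim: d => [//|d IH] [sp [sq sr]]; apply: IH.
have := congr1 (fun f : {poly R} => f`_(d.+1 + d.+1)) e.
rewrite !coefD !coef_sqr_top // coef1 addnS /= => /eqP.
rewrite !paddr_eq0 ?addr_ge0 ?sqr_ge0 // !expf_eq0 /= => /andP[/andP[/eqP p0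
  /eqP q0] /eqP r0].
have low (f : {poly R}) : (size f <= d.+2)%N -> f`_d.+1 = 0 -> (size f <=
  d.+1)%N.
  move=> sf f0; apply/leq_sizeP => j; rewrite leq_eqVlt => /orP[/eqP <- //|dj].
  by apply/(leq_sizeP _ _ sf).
by split; [|split]; exact: low.
Qed.
End PolynomialSpheres.

(** * First-order jets of continuous functions *)
Section Jets.
Variable R : realType.
Local Notation T := (R * R)%type.

(** C(T)[e1, e2] / (e1, e2)^2, where C(T) is the algebra of continuous functions
    on T = R^2. A point of a scheme with values in C(T) is a continuous family of
    real points, so evaluating a morphism at this algebra shows that it acts
    continuously; e1 and e2 give its derivatives in two directions. *)
Record jet := Jet { j0 : T -> R; j1 : T -> R; j2 : T -> R;
  j0c : continuous j0; j1c : continuous j1; j2c : continuous j2 }.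

Lemma jet_eq (f g : jet) : j0 f =1 j0 g -> j1 f =1 j1 g -> j2 f =1 j2 g -> f =
  g.
Proof.
case: f g => f0 f1 f2 c0 c1 c2 [g0 g1 g2 d0 d1 d2] /= /funext e0 /funext e1
  /funext e2.
by subst; congr Jet; exact: Prop_irrelevance.
Qed.

HB.instance Definition _ := gen_eqMixin jet.
HB.instance Definition _ := gen_choiceMixin jet.

Definition jet_cst (a b c : R) : jet :=
  Jet (@cst_continuous _ _ a) (@cst_continuous _ _ b) (@cst_continuous _ _ c).

Definition jet_add (f g : jet) : jet :=
  @Jet (fun t => j0 f t + j0 g t) (fun t => j1 f t + j1 g t) (fun t => j2 f t +
    j2 g t)
   (fun t => continuousD (@j0c f t) (@j0c g t)) (fun t => continuousD (@j1c f
     t) (@j1c g t))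
   (fun t => continuousD (@j2c f t) (@j2c g t)).
Definition jet_opp (f : jet) : jet :=
  @Jet (fun t => - j0 f t) (fun t => - j1 f t) (fun t => - j2 f t)
   (fun t => continuousN (@j0c f t)) (fun t => continuousN (@j1c f t))
   (fun t => continuousN (@j2c f t)).
Definition jet_mul (f g : jet) : jet :=
  @Jet (fun t => j0 f t * j0 g t) (fun t => j0 f t * j1 g t + j1 f t * j0 g t)
   (fun t => j0 f t * j2 g t + j2 f t * j0 g t)
   (fun t => continuousM (@j0c f t) (@j0c g t))
   (fun t => continuousD (continuousM (@j0c f t) (@j1c g t)) (continuousM (@j1c
     f t) (@j0c g t)))
   (fun t => continuousD (continuousM (@j0c f t) (@j2c g t)) (continuousM (@j2c
     f t) (@j0c g t))).

Lemma jet_addA : associative jet_add.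
Proof. by move=> f g h; apply: jet_eq => t /=; rewrite addrA. Qed.
Lemma jet_addC : commutative jet_add.
Proof. by move=> f g; apply: jet_eq => t /=; rewrite addrC. Qed.
Lemma jet_add0 : left_id (jet_cst 0 0 0) jet_add.
Proof. by move=> f; apply: jet_eq => t /=; rewrite add0r. Qed.
Lemma jet_addN : left_inverse (jet_cst 0 0 0) jet_opp jet_add.
Proof. by move=> f; apply: jet_eq => t /=; rewrite addNr. Qed.
HB.instance Definition _ := GRing.isZmodule.Build jet jet_addA jet_addC
  jet_add0 jet_addN.

Lemma jet_mulA : associative jet_mul.
Proof. by move=> f g h; apply: jet_eq => t /=; ring. Qed.
Lemma jet_mulC : commutative jet_mul.
Proof. by move=> f g; apply: jet_eq => t /=; ring. Qed.
Lemma jet_mul1 : left_id (jet_cst 1 0 0) jet_mul.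
Proof. by move=> f; apply: jet_eq => t /=; ring. Qed.
Lemma jet_mulD : left_distributive jet_mul jet_add.
Proof. by move=> f g h; apply: jet_eq => t /=; ring. Qed.
Lemma jet_1neq0 : jet_cst 1 0 0 != 0.
Proof.
by apply/eqP => /(congr1 (fun f => j0 f (0, 0))) /= /eqP; rewrite oner_eq0.
Qed.
HB.instance Definition _ := GRing.Zmodule_isComNzRing.Build jet
  jet_mulA jet_mulC jet_mul1 jet_mulD jet_1neq0.

Definition jet_scale (c : R) (f : jet) : jet := jet_cst c 0 0 * f.
Lemma jet_scaleA a b f : jet_scale a (jet_scale b f) = jet_scale (a * b) f.
Proof. by apply: jet_eq => t /=; ring. Qed.
Lemma jet_scale1 : left_id 1 jet_scale.
Proof. by move=> f; apply: jet_eq => t /=; ring. Qed.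
Lemma jet_scaleDr : right_distributive jet_scale +%R.
Proof. by move=> c f g; apply: jet_eq => t /=; ring. Qed.
Lemma jet_scaleDl f : {morph jet_scale^~ f : a b / a + b}.
Proof. by move=> a b; apply: jet_eq => t /=; ring. Qed.
HB.instance Definition _ := GRing.Zmodule_isLmodule.Build R jet
  jet_scaleA jet_scale1 jet_scaleDr jet_scaleDl.
Lemma jet_scaleAl (c : R) (f g : jet) : c *: (f * g) = c *: f * g.
Proof. exact: mulrA. Qed.
HB.instance Definition _ := GRing.Lmodule_isLalgebra.Build R jet jet_scaleAl.
HB.instance Definition _ := GRing.Lalgebra_isComAlgebra.Build R jet.

Section Evaluate.
Variables (t : T) (a b : R).
(** Evaluation at t followed by e1 |-> a e1 and e2 |-> b e1, the result being
    seen as a constant family. *)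
Definition jet_eval (f : jet) : jet := jet_cst (j0 f t) (a * j1 f t + b * j2 f
  t) 0.
Lemma jet_eval_additive : additive jet_eval.
Proof. by move=> f g; apply: jet_eq => s /=; ring. Qed.
Lemma jet_eval_multiplicative : multiplicative jet_eval.
Proof. by split=> [f g|]; apply: jet_eq => s /=; ring. Qed.
Lemma jet_eval_scalable : scalable jet_eval.
Proof. by move=> c f; apply: jet_eq => s /=; ring. Qed.
HB.instance Definition _ := GRing.isAdditive.Build jet jet jet_eval
  jet_eval_additive.
HB.instance Definition _ := GRing.isMultiplicative.Build jet jet jet_eval
  jet_eval_multiplicative.
HB.instance Definition _ := GRing.isScalable.Build R jet jet *:%R jet_eval
  jet_eval_scalable.
End Evaluate.

Lemma jet_separation (f g : jet) : (forall t a b, jet_eval t a b f = jet_eval t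
  a b g) -> f = g.
Proof.
move=> e; apply: jet_eq => t.
- by have := congr1 (fun h => j0 h t) (e t 0 0).
- by have := congr1 (fun h => j1 h t) (e t 1 0);
  rewrite /= !mul1r !mul0r !addr0.
- by have := congr1 (fun h => j1 h t) (e t 0 1);
  rewrite /= !mul1r !mul0r !add0r.
Qed.

Lemma jet_alg (c : R) : c%:A = jet_cst c 0 0.
Proof. by apply: jet_eq => t /=; ring. Qed.
End Jets.

(** * Morphisms of bundles cover maps of the sphere *)
Lemma in_bundle_reflect n (A B : comNzRingType) (f : {rmorphism A -> B}) (x :
  bpoint A) :
  in_bundle n (bpoint_map f x) ->
  [/\ f (gnorm (bp_u x) + bp_z x ^+ 2) = f 1,
      gmap f (gauss_of (1 + bp_z x) ^+ n * bp_w x) = gmap f (gconj (bp_u x) ^+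
        n * bp_v x) &
      gmap f (bp_u x ^+ n * bp_w x) = gmap f (gauss_of (1 - bp_z x) ^+ n * bp_v
        x)].
Proof.
case=> /= e1 e2 e3; split.
- by rewrite rmorphD rmorphXn -gnorm_gmap rmorph1.
- by rewrite !rmorphM !rmorphXn /= gmap_of gmap_conj rmorphD rmorph1.
- by rewrite !rmorphM !rmorphXn /= gmap_of rmorphB rmorph1.
Qed.

Section ScaledPoints.
Variable R : realType.
Local Notation G := (gauss R).

(** The point over the same real base point whose fibre coordinates are
    multiplied by a. *)
Definition scaled_bpoint (A : comAlgType R) (x : bpoint R) (a : A) : bpoint A :=
  BPoint (gmap (in_alg A) (bp_u x)) (in_alg A (bp_z x))
     (gauss_of a * gmap (in_alg A) (bp_v x)) (gauss_of a * gmap (in_alg A)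
       (bp_w x)).

Lemma gmap_comp_alg (A B : comAlgType R) (f : {lrmorphism A -> B}) (u : G) :
  gmap f (gmap (in_alg A) u) = gmap (in_alg B) u.
Proof. by apply: gauss_eq => /=; rewrite rmorph_alg. Qed.

Lemma scaled_bpoint_map (A B : comAlgType R) (f : {lrmorphism A -> B}) x a :
  bpoint_map f (scaled_bpoint x a) = scaled_bpoint x (f a).
Proof.
by apply: bpoint_eq; rewrite /= ?gmap_comp_alg ?rmorph_alg // rmorphM /=
  gmap_of gmap_comp_alg.
Qed.

Lemma scaled_bpoint_in (A : comAlgType R) n x (a : A) : in_bundle n x ->
  in_bundle n (scaled_bpoint x a).
Proof.
move=> /(in_bundle_map (in_alg A)) [e1 e2 e3]; split=> //=.
  by rewrite mulrCA e2 mulrCA.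
by rewrite mulrCA e3 mulrCA.
Qed.

Definition scaled_point (A : comAlgType R) n x (a : A) (h : in_bundle n x) :
  bundle R n A :=
  exist _ _ (scaled_bpoint_in a h).

Lemma zero_section_in n (u : G) (z : R) : gnorm u + z ^+ 2 = 1 -> in_bundle n
  (BPoint u z 0 0).
Proof.
move=> e; split; first exact: e.
  exact: (etrans (mulr0 _) (esym (mulr0 _))).
exact: (etrans (mulr0 _) (esym (mulr0 _))).
Qed.

Lemma mor_val n m (f : morphism (bundle R m) (bundle R n)) (A : comAlgType R)
  (x y : bundle R m A) : sval x = sval y -> sval (f A x) = sval (f A y).
Proof. by case: x y => x ? [y ?] /= e; congr (sval (f A _));
  exact: eq_exist. Qed.

Lemma gmap_alg_inj (A : comAlgType R) (u v : G) :
  gmap (in_alg A) u = gmap (in_alg A) v -> u = v.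
Proof.
move=> e; apply: gauss_eq; apply: (fmorph_inj (in_alg A)).
  exact: (congr1 (@re A) e).
exact: (congr1 (@im A) e).
Qed.

Section PolyAt.
Variables (A : comAlgType R) (a : A).
Definition poly_at (p : {poly R}) : A := horner_alg a p.
Lemma poly_at_additive : additive poly_at. Proof. exact: (rmorphB (horner_alg
  a)). Qed.
Lemma poly_at_multiplicative : multiplicative poly_at.
Proof. by split=> [p q|];
  [exact: (rmorphM (horner_alg a))|exact: (rmorph1 (horner_alg a))]. Qed.
Lemma poly_at_scalable : scalable poly_at.
Proof.
by move=> c p; rewrite /poly_at -mul_polyC rmorphM /= horner_algC mulr_algl.
Qed.
HB.instance Definition _ := GRing.isAdditive.Build {poly R} A poly_at
  poly_at_additive.
HB.instance Definition _ := GRing.isMultiplicative.Build {poly R} A poly_at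
  poly_at_multiplicative.
HB.instance Definition _ := GRing.isScalable.Build R {poly R} A *:%R poly_at
  poly_at_scalable.
End PolyAt.

(** Over R[t], the point with fibre coordinates multiplied by t is mapped to a
    point whose base coordinates form a polynomial path on the sphere, hence are
    constant; every other scaling is a specialization of t. *)
Lemma base_constant_pt n m (f : morphism (bundle R m) (bundle R n)) x :
  in_bundle m x -> exists b : G * R, forall (A : comAlgType R) (a : A) y,
  sval y = scaled_bpoint x a -> bp_u (sval (f A y)) = gmap (in_alg A) b.1 /\
    bp_z (sval (f A y)) = in_alg A b.2.
Proof.
move=> xE; pose w := sval (f {poly R} (scaled_point 'X xE)).
have [w1 _ _] : in_bundle n w := svalP (f {poly R} (scaled_point 'X xE)).
have [u1 u2 uz] := poly_sphere_const w1.
exists (Gauss (re (bp_u w))`_0 (im (bp_u w))`_0, (bp_z w)`_0) => A a y yE.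
pose ev : {lrmorphism {poly R} -> A} := poly_at a.
have -> : sval (f A y) = bpoint_map ev w.
  rewrite -[RHS]/(sval (act ev (f _ (scaled_point 'X xE)))) -mor_natural.
  by apply: mor_val; rewrite yE /= scaled_bpoint_map /= /poly_at horner_algX.
split; last by rewrite /= {1}uz /poly_at horner_algC.
by apply: gauss_eq; rewrite /=; [rewrite {1}u1 | rewrite {1}u2];
  rewrite /poly_at horner_algC.
Qed.

(** The constant does not depend on the fibre coordinates of x, as one sees by
    scaling them by 0. *)
Lemma base_map n m (f : morphism (bundle R m) (bundle R n)) :
  exists s : G * R -> G * R, forall x, in_bundle m x ->
  forall (A : comAlgType R) (a : A) y, sval y = scaled_bpoint x a ->
  bp_u (sval (f A y)) = gmap (in_alg A) (s (bp_u x, bp_z x)).1 /\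
  bp_z (sval (f A y)) = in_alg A (s (bp_u x, bp_z x)).2.
Proof.
have /choice[s sE] (p : G * R) : exists b : G * R, forall e : in_bundle m
  (BPoint p.1 p.2 0 0),
    forall (A : comAlgType R) (a : A) y, sval y = scaled_bpoint (BPoint p.1 p.2
      0 0) a ->
    bp_u (sval (f A y)) = gmap (in_alg A) b.1 /\ bp_z (sval (f A y)) = in_alg A
      b.2.
  have [e|ne] := pselect (in_bundle m (BPoint p.1 p.2 0 0)); last by exists p.
  by have [b bE] := base_constant_pt f e; exists b.
exists s => x xE A a y yE.
have x0E : in_bundle m (BPoint (bp_u x) (bp_z x) 0 0) by apply:
  zero_section_in; case: xE.
have [b bE] := base_constant_pt f xE.
suff -> : s (bp_u x, bp_z x) = b by exact: bE yE.
have [b1 b2] := bE R^o 0 (scaled_point 0 xE) erefl.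
have [|s1 s2] := sE (bp_u x, bp_z x) x0E R^o 0 (scaled_point 0 xE).
  by apply: bpoint_eq; rewrite //= rmorph0 !mul0r.
rewrite [LHS]surjective_pairing [RHS]surjective_pairing; congr (_, _).
  by apply: (@gmap_alg_inj R^o); rewrite -b1 -s1.
by apply: (fmorph_inj (in_alg R^o)); exact: (etrans (esym s2) b2).
Qed.
End ScaledPoints.

Definition on_sphere (R : realType) (p : gauss R * R) := gnorm p.1 + p.2 ^+ 2 =
  1.

(** * The derivative along the zero section *)
Section Linearization.
Variable R : realType.
Local Notation G := (gauss R).
Local Notation T := (R * R)%type.
Local Notation L := (jet R).

Definition jet_eps : L := jet_cst 0 1 0.

Definition coef1 (t : T) (w : gauss L) : G := Gauss (j1 (re w) t) (j1 (im w) t).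

Lemma coef1M t (u : G) w : coef1 t (gmap (in_alg L) u * w) = u * coef1 t w.
Proof. by apply: gauss_eq; rewrite /=; ring. Qed.

(** Once the base point is constant, the equations of the bundle are linear in the
    fibre coordinates, so they hold for the coefficient of e1. *)
Lemma coef1_in n (p : G * R) (w : bpoint L) t : in_bundle n w ->
  bp_u w = gmap (in_alg L) p.1 -> bp_z w = in_alg L p.2 -> on_sphere p ->
  in_bundle n (BPoint p.1 p.2 (coef1 t (bp_v w)) (coef1 t (bp_w w))).
Proof.
case=> _ e2 e3 uE zE pS; split=> //=.
  rewrite -!coef1M !rmorphXn /= gmap_of rmorphD rmorph1 gmap_conj -uE.
  by move: zE => /= <-; rewrite e2.
rewrite -!coef1M !rmorphXn /= gmap_of rmorphB rmorph1 -uE.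
by move: zE => /= <-; rewrite e3.
Qed.

Section Family.
Variables (u : T -> G) (z : T -> R) (v1 v2 w1 w2 : T -> G).
Hypotheses (uc : gcont u) (zc : continuous z) (v1c : gcont v1) (v2c : gcont v2)
  (w1c : gcont w1) (w2c : gcont w2).

Definition jet_base (f : T -> G) (c : gcont f) : gauss L :=
  Gauss (Jet (fun t => (c t).1) (@cst_continuous _ _ (0 : R)) (@cst_continuous
    _ _ (0 : R)))
        (Jet (fun t => (c t).2) (@cst_continuous _ _ (0 : R)) (@cst_continuous
          _ _ (0 : R))).
Definition jet_tangent (f g : T -> G) (c : gcont f) (d : gcont g) : gauss L :=
  Gauss (Jet (@cst_continuous _ _ (0 : R)) (fun t => (c t).1) (fun t => (d
    t).1))
        (Jet (@cst_continuous _ _ (0 : R)) (fun t => (c t).2) (fun t => (d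
          t).2)).
(** The family of tangent vectors e1 (v1, v2) + e2 (w1, w2) to the fibres along
    the zero section, over the continuous family (u, z) of base points. *)
Definition jet_family : bpoint L :=
  BPoint (jet_base uc) (Jet zc (@cst_continuous _ _ (0 : R)) (@cst_continuous _
    _ (0 : R)))
     (jet_tangent v1c w1c) (jet_tangent v2c w2c).

Definition fibre_comb (t : T) (a b : R) : bpoint R :=
  BPoint (u t) (z t) (gauss_of a * v1 t + gauss_of b * w1 t)
     (gauss_of a * v2 t + gauss_of b * w2 t).

Lemma jet_eval_family t a b : bpoint_map (jet_eval t a b) jet_family =
  scaled_bpoint (fibre_comb t a b) jet_eps.
Proof.
by apply: bpoint_eq; rewrite /= ?jet_alg; try apply: gauss_eq;
  apply: jet_eq => s; rewrite /= ?jet_alg /=; ring.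
Qed.

Lemma fibre_comb_in n t a b : in_bundle n (BPoint (u t) (z t) (v1 t) (v2 t)) ->
  in_bundle n (BPoint (u t) (z t) (w1 t) (w2 t)) -> in_bundle n (fibre_comb t a
    b).
Proof.
case=> /= e1 e2 e3 [/= _ d2 d3]; split=> //=; rewrite !mulrDr.
  by rewrite !(mulrCA _ (gauss_of _)) e2 d2.
by rewrite !(mulrCA _ (gauss_of _)) e3 d3.
Qed.

Lemma jet_family_in n : (forall t, in_bundle n (BPoint (u t) (z t) (v1 t) (v2
  t))) ->
  (forall t, in_bundle n (BPoint (u t) (z t) (w1 t) (w2 t))) -> in_bundle n
    jet_family.
Proof.
move=> vI wI; have H t a b : in_bundle n (bpoint_map (jet_eval t a b)
  jet_family).
  by rewrite jet_eval_family; apply: scaled_bpoint_in; exact: fibre_comb_in.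
have sep (f g : gauss L) : (forall t a b, gmap (jet_eval t a b) f = gmap
  (jet_eval t a b) g) -> f = g.
  move=> e; apply: gauss_eq; apply: jet_separation => t a b.
    exact: (congr1 (@re _) (e t a b)).
  exact: (congr1 (@im _) (e t a b)).
split.
- apply: jet_separation => t a b; have [e _ _] := in_bundle_reflect (H t a b).
  exact: e.
- by apply: sep => t a b; have [_ e _] := in_bundle_reflect (H t a b).
- by apply: sep => t a b; have [_ _ e] := in_bundle_reflect (H t a b).
Qed.
End Family.
End Linearization.

Section LinearizationTheorem.
Variable R : realType.
Local Notation G := (gauss R).
Local Notation T := (R * R)%type.
Local Notation L := (jet R).
Local Notation jet_eps := (jet_eps R).

(** What an isomorphism between the total spaces induces on real points: a map s
    of the sphere, and for each base point p a real-linear map D from the fibre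
    at p to the fibre at s p. *)
Record linearized (m n : nat) (s : G * R -> G * R) (D : bpoint R -> G * G) :
  Prop := {
  lin_sphere : forall p, on_sphere p -> on_sphere (s p);
  lin_inj : forall p q, on_sphere p -> on_sphere q -> s p = s q -> p = q;
  lin_in : forall x, in_bundle m x ->
    in_bundle n (BPoint (s (bp_u x, bp_z x)).1 (s (bp_u x, bp_z x)).2 (D x).1
      (D x).2);
  lin_comb : forall u z v1 v2 w1 w2 a b,
    in_bundle m (BPoint u z v1 v2) -> in_bundle m (BPoint u z w1 w2) ->
    D (BPoint u z (gauss_of a * v1 + gauss_of b * w1) (gauss_of a * v2 +
      gauss_of b * w2)) =
    (gauss_of a * (D (BPoint u z v1 v2)).1 + gauss_of b * (D (BPoint u z w1
      w2)).1,
     gauss_of a * (D (BPoint u z v1 v2)).2 + gauss_of b * (D (BPoint u z w1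
       w2)).2);
  lin_ker : forall x, in_bundle m x -> D x = (0, 0) -> bp_v x = 0 /\ bp_w x = 0;
  lin_cont : forall (u : T -> G) (z : T -> R) (v1 v2 : T -> G),
    gcont u -> continuous z -> gcont v1 -> gcont v2 ->
    (forall t, in_bundle m (BPoint (u t) (z t) (v1 t) (v2 t))) ->
    [/\ gcont (fun t => (s (u t, z t)).1), continuous (fun t => (s (u t, z
      t)).2),
        gcont (fun t => (D (BPoint (u t) (z t) (v1 t) (v2 t))).1) &
        gcont (fun t => (D (BPoint (u t) (z t) (v1 t) (v2 t))).2)] }.

Variables (m n : nat) (f : morphism (bundle R m) (bundle R n)).
Variables (g : morphism (bundle R n) (bundle R m)).
Hypotheses (fK : forall A : comAlgType R, cancel (f A) (g A)).

Variable s : G * R -> G * R.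
Hypothesis sE : forall x, in_bundle m x ->
  forall (A : comAlgType R) (a : A) y, sval y = scaled_bpoint x a ->
  bp_u (sval (f A y)) = gmap (in_alg A) (s (bp_u x, bp_z x)).1 /\
  bp_z (sval (f A y)) = in_alg A (s (bp_u x, bp_z x)).2.

(** The coefficient of e1 of the image of e1 x; the value outside of the bundle is
    arbitrary. *)
Definition vertical_deriv (x : bpoint R) : G * G :=
  if pselect (in_bundle m x) is left h then
    let w := sval (f L (scaled_point jet_eps h)) in (coef1 (0, 0) (bp_v w),
      coef1 (0, 0) (bp_w w))
  else (0, 0).

Lemma vertical_derivE x y : in_bundle m x -> sval y = scaled_bpoint x jet_eps ->
  vertical_deriv x = (coef1 (0, 0) (bp_v (sval (f L y))), coef1 (0, 0) (bp_w
    (sval (f L y)))).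
Proof.
move=> xE yE; rewrite /vertical_deriv; case: pselect => // h.
by rewrite (@mor_val _ _ _ f _ y (scaled_point jet_eps h)).
Qed.

Definition coef0 (t : T) (w : gauss L) : G := Gauss (j0 (re w) t) (j0 (im w) t).
Definition coef2 (t : T) (w : gauss L) : G := Gauss (j2 (re w) t) (j2 (im w) t).

Lemma coef0_alg t (u : G) : coef0 t (gmap (in_alg L) u) = u.
Proof. by apply: gauss_eq => /=; rewrite mulr1. Qed.
Lemma coef1_jet_eval t a b (w : gauss L) :
  coef1 (0, 0) (gmap (jet_eval t a b) w) = gauss_of a * coef1 t w + gauss_of b
    * coef2 t w.
Proof. by apply: gauss_eq => /=; ring. Qed.

Lemma coef0_gcont (w : gauss L) : gcont (fun t => coef0 t w).
Proof. by move=> t; split;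
  [exact: (@j0c _ (re w) t)|exact: (@j0c _ (im w) t)]. Qed.
Lemma coef1_gcont (w : gauss L) : gcont (fun t => coef1 t w).
Proof. by move=> t; split;
  [exact: (@j1c _ (re w) t)|exact: (@j1c _ (im w) t)]. Qed.

Section OnFamily.
Variables (u : T -> G) (z : T -> R) (v1 v2 w1 w2 : T -> G).
Hypotheses (uc : gcont u) (zc : continuous z) (v1c : gcont v1) (v2c : gcont v2)
  (w1c : gcont w1) (w2c : gcont w2).
Hypothesis vI : forall t, in_bundle m (BPoint (u t) (z t) (v1 t) (v2 t)).
Hypothesis wI : forall t, in_bundle m (BPoint (u t) (z t) (w1 t) (w2 t)).

Let y : bundle R m L := exist _ _ (jet_family_in uc zc v1c v2c w1c w2c vI wI).
Let w := sval (f L y).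

Lemma image_family t a b (y' : bundle R m L) :
  sval y' = scaled_bpoint (fibre_comb u z v1 v2 w1 w2 t a b) jet_eps -> sval (f
    L y') = bpoint_map (jet_eval t a b) w.
Proof.
move=> y'E; rewrite -[RHS]/(sval (act (jet_eval t a b) (f L y))) -mor_natural.
by apply: mor_val; rewrite y'E /= jet_eval_family.
Qed.

Lemma vertical_deriv_family t a b : vertical_deriv (fibre_comb u z v1 v2 w1 w2
  t a b) =
  (gauss_of a * coef1 t (bp_v w) + gauss_of b * coef2 t (bp_v w),
   gauss_of a * coef1 t (bp_w w) + gauss_of b * coef2 t (bp_w w)).
Proof.
have cI := fibre_comb_in a b (vI t) (wI t).
rewrite (vertical_derivE cI (y := scaled_point jet_eps cI)) // (@image_family t
  a b) //.
by rewrite -!coef1_jet_eval.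
Qed.

Lemma base_family t : s (u t, z t) = (coef0 t (bp_u w), j0 (bp_z w) t).
Proof.
have cI := fibre_comb_in 1 0 (vI t) (wI t).
have [b1 b2] := sE cI (erefl (sval (scaled_point jet_eps cI))).
rewrite (@image_family t 1 0) // in b1 b2.
rewrite [LHS]surjective_pairing; congr (_, _).
  by rewrite -[LHS](coef0_alg (0, 0)) -b1.
by have := congr1 (fun h => j0 h (0, 0)) b2; rewrite /= mulr1 => ->.
Qed.
End OnFamily.

Lemma vertical_deriv_comb u z v1 v2 w1 w2 a b :
  in_bundle m (BPoint u z v1 v2) -> in_bundle m (BPoint u z w1 w2) ->
  vertical_deriv (BPoint u z (gauss_of a * v1 + gauss_of b * w1) (gauss_of a *
    v2 + gauss_of b * w2)) =
  (gauss_of a * (vertical_deriv (BPoint u z v1 v2)).1 + gauss_of b *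
    (vertical_deriv (BPoint u z w1 w2)).1,
   gauss_of a * (vertical_deriv (BPoint u z v1 v2)).2 + gauss_of b *
     (vertical_deriv (BPoint u z w1 w2)).2).
Proof.
move=> vI wI; have cc (c : G) : gcont (fun _ : T => c) by move=> x;
  exact: gcont_at_cst.
have zc : continuous (fun _ : T => z) by exact: cst_continuous.
have E a' b' := vertical_deriv_family (cc u) zc (cc v1) (cc v2) (cc w1) (cc w2)
  (fun=> vI) (fun=> wI) (0, 0) a' b'.
rewrite /fibre_comb in E; rewrite E.
have := E 1 0; have := E 0 1.
rewrite !rmorph1 !rmorph0 !mul1r !mul0r !add0r !addr0 => -> -> /=.
by [].
Qed.

Lemma base_on_sphere p : on_sphere p -> on_sphere (s p).
Proof.
case: p => u z pS; have xE := zero_section_in m pS.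
have [e _ _] := svalP (f R^o (scaled_point (0 : R^o) xE)).
have [uE zE] := sE xE (erefl (sval (scaled_point (0 : R^o) xE))).
apply: (fmorph_inj (in_alg R^o)); rewrite rmorph1 -[RHS]e uE zE gnorm_gmap.
by rewrite rmorphD rmorphXn.
Qed.

Lemma bundle_on_sphere k (x : bpoint R) : in_bundle k x -> on_sphere (bp_u x,
  bp_z x).
Proof. by case. Qed.

Lemma vertical_deriv_in x : in_bundle m x ->
  in_bundle n (BPoint (s (bp_u x, bp_z x)).1 (s (bp_u x, bp_z x)).2
    (vertical_deriv x).1 (vertical_deriv x).2).
Proof.
move=> xE; have [uE zE] := sE xE (erefl (sval (scaled_point jet_eps xE))).
rewrite (vertical_derivE xE (y := scaled_point jet_eps xE)) //.
apply: (@coef1_in _ n (s (bp_u x, bp_z x))) => //; first exact: svalP.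
exact: base_on_sphere (bundle_on_sphere xE).
Qed.

Lemma bundle_eq k (A : comAlgType R) (x y : bundle R k A) : sval x = sval y ->
  x = y.
Proof. by case: x y => x ? [y ?] /= e; exact: eq_exist. Qed.

(** If the derivative kills x, then f takes the same value at e1 x and at 0, and f
    is injective. *)
Lemma vertical_deriv_ker x : in_bundle m x -> vertical_deriv x = (0, 0) -> bp_v
  x = 0 /\ bp_w x = 0.
Proof.
move=> xE; pose y1 := scaled_point jet_eps xE;
  pose y0 := scaled_point (0 : L) xE.
rewrite (vertical_derivE xE (y := y1)) //;
  set w := sval (f L y1) => -[a1 a2 b1 b2].
have [uE zE] := sE xE (erefl (sval y1)).
have w1 : w = bpoint_map (jet_eval (0, 0) 1 0) w.
  rewrite -[RHS]/(sval (act (jet_eval (0, 0) 1 0) (f L y1))) -mor_natural.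
  apply: mor_val; rewrite /= scaled_bpoint_map; congr scaled_bpoint.
  by apply: jet_eq => t /=; ring.
have w0 : sval (f L y0) = bpoint_map (jet_eval (0, 0) 0 0) w.
  rewrite -[RHS]/(sval (act (jet_eval (0, 0) 0 0) (f L y1))) -mor_natural.
  apply: mor_val; rewrite /= scaled_bpoint_map; congr scaled_bpoint.
  by apply: jet_eq => t /=; ring.
have jj (h : L) : j1 h (0, 0) = 0 -> jet_eval (0, 0) 1 0 h = jet_eval (0, 0) 0
  0 h.
  by move=> h0; apply: jet_eq => t //=; rewrite h0; ring.
have j1cst (c : R) : j1 (in_alg L c) (0, 0) = 0 by rewrite /=; ring.
have ww : w = sval (f L y0).
  rewrite w0 {1}w1; apply: bpoint_eq; rewrite /= ?[bp_u w]uE ?[bp_z w]zE.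
  - by apply: gauss_eq; apply: jj; exact: j1cst.
  - by apply: jj; exact: j1cst.
  - by apply: gauss_eq; apply: jj.
  - by apply: gauss_eq; apply: jj.
have {}ww : y1 = y0.
  by rewrite -[LHS](fK (A := L)) -[RHS](fK (A := L)) (@bundle_eq n L (f L y1)
    (f L y0) ww).
have cE (v : G) : coef1 (0, 0) (gauss_of jet_eps * gmap (in_alg L) v) = v.
  by apply: gauss_eq => /=; ring.
have c0 (v : G) : coef1 (0, 0) (gauss_of (0 : L) * gmap (in_alg L) v) = 0.
  by rewrite rmorph0 mul0r.
have e := congr1 sval ww.
split.
  exact: (etrans (esym (cE _)) (etrans (congr1 (fun y => coef1 (0, 0) (bp_v y))
    e) (c0 _))).
exact: (etrans (esym (cE _)) (etrans (congr1 (fun y => coef1 (0, 0) (bp_w y))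
  e) (c0 _))).
Qed.

(** The image of a zero vector need not be a zero vector, but the map induced by
    g on the sphere does not depend on fibre coordinates. *)
Lemma base_inj (s' : G * R -> G * R) :
  (forall x, in_bundle n x -> forall (A : comAlgType R) (a : A) y, sval y =
    scaled_bpoint x a ->
   bp_u (sval (g A y)) = gmap (in_alg A) (s' (bp_u x, bp_z x)).1 /\
   bp_z (sval (g A y)) = in_alg A (s' (bp_u x, bp_z x)).2) ->
  forall p, on_sphere p -> s' (s p) = p.
Proof.
move=> s'E [u z] pS; have xE := zero_section_in m pS;
  pose y := scaled_point (0 : R^o) xE.
have [uE zE] := sE xE (erefl (sval y)).
have wI : in_bundle n (sval (f R^o y) : bpoint R) := svalP (f R^o y).
have idG (v : G) : gmap (in_alg R^o) v = v.
  by apply: gauss_eq; rewrite /= -[_ *: _]/(_ * _) mulr1.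
have idR (c : R) : in_alg R^o c = c by rewrite /= -[_ *: _]/(_ * _) mulr1.
have yE : sval (f R^o y) = scaled_bpoint (sval (f R^o y) : bpoint R) (1 : R^o).
  apply: bpoint_eq; rewrite /scaled_bpoint.
  - by rewrite [RHS]idG.
  - by rewrite [RHS]idR.
  - by rewrite [RHS]/= rmorph1 mul1r idG.
  - by rewrite [RHS]/= rmorph1 mul1r idG.
have [b1 b2] := s'E _ wI R^o 1 (f R^o y) yE.
have gE : g R^o (f R^o y) = y := fK (A := R^o) y.
rewrite gE in b1 b2.
have sE' : (bp_u (sval (f R^o y)), bp_z (sval (f R^o y))) = s (u, z).
  rewrite [RHS]surjective_pairing; congr (_, _); first by rewrite uE idG.
  by rewrite zE idR.
rewrite sE' in b1 b2.
rewrite [LHS]surjective_pairing; congr (_, _).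
  exact: (etrans (esym (idG _)) (etrans (esym b1) (idG u))).
exact: (etrans (esym (idR _)) (etrans (esym b2) (idR z))).
Qed.
End LinearizationTheorem.

Lemma bundle_linearization (R : realType) (m n : nat) :
  isomorphic (bundle R m) (bundle R n) -> exists s D, @linearized R m n s D.
Proof.
case=> f [g fg]; have fK A : cancel (f A) (g A) := (fg A).1.
have [s sE] := base_map f; have [s' s'E] := base_map g.
have ss' := base_inj fK sE s'E.
exists s, (vertical_deriv f); split.
- exact: base_on_sphere sE.
- by move=> p q pS qS e; rewrite -[p]ss' // e ss'.
- by move=> x; exact: (vertical_deriv_in sE).
- by move=> u z v1 v2 w1 w2 a b; exact: vertical_deriv_comb.
- by move=> x; exact: (vertical_deriv_ker fK sE).
- move=> u z v1 v2 uc zc v1c v2c vI.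
  have c0 : gcont (fun _ : R * R => 0 : gauss R) by move=> x;
    exact: gcont_at_cst.
  have zI t : in_bundle m (BPoint (u t) (z t) 0 0) by apply: zero_section_in;
    case: (vI t).
  have sF t := base_family sE uc zc v1c v2c c0 c0 vI zI t.
  have DF t := vertical_deriv_family f uc zc v1c v2c c0 c0 vI zI t 1 0.
  set w := sval _ in sF DF.
  have DE t : vertical_deriv f (BPoint (u t) (z t) (v1 t) (v2 t)) = (coef1 t
    (bp_v w), coef1 t (bp_w w)).
    have := DF t; rewrite /fibre_comb !rmorph1 !rmorph0 !mul1r !mul0r !addr0 =>
      ->.
    by [].
  split.
  + have -> : (fun t => (s (u t, z t)).1) = (fun t => coef0 t (bp_u w)) by
    apply/funext => t; rewrite sF.
    exact: coef0_gcont.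
  + have -> : (fun t => (s (u t, z t)).2) = j0 (bp_z w) by apply/funext => t;
    rewrite sF.
    exact: j0c.
  + have -> : (fun t => (vertical_deriv f (BPoint (u t) (z t) (v1 t) (v2
    t))).1) = (fun t => coef1 t (bp_v w)).
      by apply/funext => t; rewrite DE.
    exact: coef1_gcont.
  + have -> : (fun t => (vertical_deriv f (BPoint (u t) (z t) (v1 t) (v2
    t))).2) = (fun t => coef1 t (bp_w w)).
      by apply/funext => t; rewrite DE.
    exact: coef1_gcont.
Qed.

(** * Complex lines in the Hermitian plane *)
Lemma pair_eq (A B : Type) (x y : A * B) : x = y -> x.1 = y.1 /\ x.2 = y.2.
Proof. by move=> ->. Qed.

Section HermitianPlane.
Variable R : realType.
Local Notation G := (gauss R).
Implicit Types v w : G * G.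

Definition hdot v w : G := v.1 * gconj w.1 + v.2 * gconj w.2.
Definition hnorm v : R := gnorm v.1 + gnorm v.2.
Definition collinear v w : Prop := v.1 * w.2 = v.2 * w.1.
Definition hscale (c : G) v : G * G := (c * v.1, c * v.2).
Definition hadd v w : G * G := (v.1 + w.1, v.2 + w.2).

Lemma hnorm_ge0 v : 0 <= hnorm v.
Proof. by rewrite addr_ge0 // gnorm_ge0. Qed.
Lemma hnorm_eq0 v : hnorm v = 0 -> v = (0, 0).
Proof.
move=> /eqP; rewrite paddr_eq0 ?gnorm_ge0 // => /andP[/eqP/gnorm_eq0 e1
  /eqP/gnorm_eq0 e2].
by rewrite [v]surjective_pairing e1 e2.
Qed.
Lemma hnorm_gt0 v : v <> (0, 0) -> 0 < hnorm v.
Proof. by move=> v0; rewrite lt0r hnorm_ge0 andbT; apply/eqP => /hnorm_eq0. Qed.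
Lemma hdot_self v : hdot v v = gauss_of (hnorm v).
Proof. by rewrite /hdot !mul_gconj -rmorphD. Qed.

(** Equality in the Cauchy-Schwarz inequality, from Lagrange's identity. *)
Lemma gnorm_hdot v w : collinear v w -> gnorm (hdot v w) = hnorm v * hnorm w.
Proof.
move=> vw; have e0 : gnorm (v.1 * w.2 - v.2 * w.1) = 0 by rewrite vw subrr
  gnorm0.
by rewrite -[LHS]addr0 -e0 /hnorm /hdot /gnorm /=; ring.
Qed.
Lemma hdot_neq0 v w : collinear v w -> v <> (0, 0) -> w <> (0, 0) -> hdot v w
  <> 0.
Proof.
move=> vw v0 w0 e; have := gnorm_hdot vw; rewrite e gnorm0 => /esym/eqP.
by rewrite mulf_eq0 !gt_eqF ?hnorm_gt0.
Qed.
(** The orthogonal projection of v on the line of w is v itself. *)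
Lemma hdot_proj v w : collinear v w ->
  hscale (hdot v w) w = hscale (gauss_of (hnorm w)) v.
Proof.
move=> vw; rewrite -hdot_self /hscale /hdot; congr (_, _).
  transitivity (v.1 * gconj w.1 * w.1 + v.2 * w.1 * gconj w.2); first by ring.
  by rewrite -vw; ring.
transitivity (v.1 * w.2 * gconj w.1 + v.2 * gconj w.2 * w.2); first by ring.
by rewrite vw; ring.
Qed.
Lemma hdot_scalel c v w : hdot (hscale c v) w = c * hdot v w.
Proof. by rewrite /hdot /=; ring. Qed.
Lemma hdot_scaler c v w : hdot v (hscale c w) = gconj c * hdot v w.
Proof. by rewrite /hdot /= !rmorphM; ring. Qed.

(** The real-linear map mu |-> mu A + conj mu B is singular when |A| = |B|. Up to
    a positive factor B = omega A with |omega| = 1, and mu = 1 - omega is a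
    solution of mu / conj mu = - omega, unless omega = 1, where mu = i is one. *)
Lemma antilinear_kernel (A B : G * G) : collinear A B -> hnorm A = hnorm B ->
  exists2 mu : G, mu <> 0 & hadd (hscale mu A) (hscale (gconj mu) B) = (0, 0).
Proof.
move=> AB nAB.
have i0 : Gauss 0 1 <> 0 :> G by move/(congr1 (@im R)) => /= /eqP;
  rewrite oner_eq0.
have [A0|A0] := pselect (A = (0, 0)).
  have B0 : B = (0, 0) by apply: hnorm_eq0;
    rewrite -nAB A0 /hnorm /= gnorm0 addr0.
  by exists (Gauss 0 1) => //; rewrite A0 B0 /hadd /hscale /= !mulr0 addr0.
have BA : collinear B A by rewrite /collinear mulrC -AB mulrC.
pose w := hdot B A; have wA := hdot_proj BA; have wB := hdot_proj AB.
have wc : gconj w = hdot A B by rewrite /w /hdot rmorphD !rmorphM /= !gconjK;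
  ring.
have [e|ne] := pselect (gauss_of (hnorm A) - w = 0).
  have {}e : w = gauss_of (hnorm A) by apply/eqP; rewrite eq_sym -subr_eq0 e.
  have EAB : A = B.
    rewrite -/w e in wA; have [a1 a2] := pair_eq wA.
    have n0 : gauss_of (hnorm A) <> 0 by apply: gauss_of_neq0;
      rewrite gt_eqF ?hnorm_gt0.
    by rewrite [A]surjective_pairing [B]surjective_pairing (gauss_mulfI n0 a1)
      (gauss_mulfI n0 a2).
  exists (Gauss 0 1) => //; rewrite -EAB /hadd /hscale.
  have -> : gconj (Gauss 0 1) = - Gauss 0 1 :> G by apply: gauss_eq;
    rewrite /= ?oppr0.
  by rewrite !mulNr !subrr.
exists (gauss_of (hnorm A) - w) => //.
rewrite rmorphB /= gconj_of wc /hadd /hscale [LHS]/=.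
have [a1 a2] := pair_eq wA; have [b1 b2] := pair_eq wB.
rewrite /= -/w in a1 a2; rewrite /= -nAB in b1 b2.
congr (_, _).
  transitivity (gauss_of (hnorm A) * A.1 - w * A.1 + (gauss_of (hnorm A) * B.1
    - hdot A B * B.1)); first by ring.
  by rewrite a1 b1; ring.
transitivity (gauss_of (hnorm A) * A.2 - w * A.2 + (gauss_of (hnorm A) * B.2 -
  hdot A B * B.2)); first by ring.
by rewrite a2 b2; ring.
Qed.
End HermitianPlane.

Section Lines.
Variable R : realType.
Local Notation G := (gauss R).

Definition in_line (n : nat) (p : G * R) (v : G * G) : Prop :=
  in_bundle n (BPoint p.1 p.2 v.1 v.2).

(** Multiply by (1 + z)^n or by (1 - z)^n, one of which is not 0. *)
Lemma in_line_collinear n p v w : in_line n p v -> in_line n p w -> collinear v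
  w.
Proof.
move=> [/= _ v2 v3] [/= _ w2 w3]; rewrite /collinear.
have [e|e] := eqVneq (1 + p.2) 0.
  have z2 : 1 - p.2 != 0.
    have -> : p.2 = -1 by apply/eqP; rewrite -addr_eq0 addrC e.
    by rewrite opprK -mulr2n pnatr_eq0.
  apply: (@gauss_mulfI _ (gauss_of (1 - p.2) ^+ n));
    first exact: gauss_expf_neq0 (gauss_of_neq0 z2).
  by rewrite [LHS]mulrA -v3 [RHS]mulrCA -w3; ring.
apply: (@gauss_mulfI _ (gauss_of (1 + p.2) ^+ n));
  first exact: gauss_expf_neq0 (gauss_of_neq0 e).
by rewrite [LHS]mulrCA w2 [RHS]mulrA v2; ring.
Qed.

Lemma in_line_scale n p v c : in_line n p v -> in_line n p (hscale c v).
Proof.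
by move=> [e v2 v3]; split; [exact: e| |]; rewrite /= !(mulrCA _ c);
  congr (_ * _).
Qed.
Lemma in_line_add n p v w : in_line n p v -> in_line n p w -> in_line n p (hadd
  v w).
Proof. by move=> [e /= v2 v3] [_ /= w2 w3]; split; [exact: e| |];
  rewrite /= !mulrDr ?v2 ?w2 ?v3 ?w3. Qed.

(** Twice the image of c under the orthogonal projector on the tautological line
    over p; its columns are (1 + z, ubar) and (u, 1 - z). Raising the coordinates
    to the n-th power gives a section of the n-th bundle. *)
Definition spinor (c : G * G) (p : G * R) : G * G :=
  (c.1 * gauss_of (1 + p.2) + c.2 * p.1, c.1 * gconj p.1 + c.2 * gauss_of (1 -
    p.2)).
Definition spinor_pow n c p : G * G := ((spinor c p).1 ^+ n, (spinor c p).2 ^+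
  n).

Lemma pole_product (p : G * R) : on_sphere p ->
  gauss_of (1 + p.2) * gauss_of (1 - p.2) = p.1 * gconj p.1.
Proof.
move=> e; rewrite mul_gconj -rmorphM; congr gauss_of.
have -> : gnorm p.1 = 1 - p.2 ^+ 2 by rewrite -e addrK.
by ring.
Qed.

Lemma spinor_line n c p : on_sphere p -> in_line n p (spinor_pow n c p).
Proof.
move=> pS; have e := pole_product pS.
split; first exact: pS.
1,2: rewrite /= -!exprMn; congr (_ ^+ n); rewrite !mulrDr.
  by rewrite (mulrCA _ c.2) e; ring.
by rewrite !(mulrCA _ c.1) -e; ring.
Qed.
Lemma spinor_collinear c d p : on_sphere p -> collinear (spinor c p) (spinor d
  p).
Proof.
by move=> pS; have := in_line_collinear (spinor_line 1 c pS) (spinor_line 1 d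
  pS).
Qed.

Lemma spinor_pow_neq0 n c p : spinor c p <> (0, 0) -> spinor_pow n c p <> (0,
  0).
Proof.
move=> s0 /pair_eq[/= e1 e2]; apply: s0; rewrite [LHS]surjective_pairing.
have z (a : G) : a ^+ n = 0 -> a = 0.
  by move=> an; apply: contrapT => a0; exact: (gauss_expf_neq0 a0 an).
by congr (_, _); apply: z.
Qed.

Lemma sphere_eq (p q : G * R) : on_sphere p -> on_sphere q ->
  re p.1 * re q.1 + im p.1 * im q.1 + p.2 * q.2 = 1 -> p = q.
Proof.
case: p q => -[a b] z [[a' b'] z'] /=; rewrite /on_sphere /gnorm /= => pS qS e.
have : (a - a') ^+ 2 + (b - b') ^+ 2 + (z - z') ^+ 2 = 0.
  transitivity ((a ^+ 2 + b ^+ 2 + z ^+ 2) + (a' ^+ 2 + b' ^+ 2 + z' ^+ 2)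
    - 2 * (a * a' + b * b' + z * z')); first by ring.
  by rewrite pS qS e; ring.
move=> /eqP; rewrite !paddr_eq0 ?addr_ge0 ?sqr_ge0 // !expf_eq0 /= !subr_eq0.
by move=> /andP[/andP[/eqP-> /eqP->] /eqP->].
Qed.

(** A section that vanishes at most at q, and one that does not vanish at q. For
    the first, take c orthogonal to the line over q: then the squared norm of
    the section at p is a multiple of 1 - <p, q>. *)
Lemma pole_spinors (q : G * R) : on_sphere q -> exists c d : G * G,
  (forall p, on_sphere p -> p <> q -> spinor c p <> (0, 0)) /\ spinor d q <>
    (0, 0).
Proof.
move=> qS; have [z1|z1] := eqVneq (1 + q.2) 0.
  have q2 : q.2 = -1 by apply/eqP; rewrite -addr_eq0 addrC z1.
  have q1 : q.1 = 0.
    by apply: gnorm_eq0; move: qS;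
      rewrite /on_sphere q2 sqrrN expr1n => /(canRL (addrK _)) ->;
      rewrite subrr.
  exists (1, 0), (0, 1); split=> [p pS pq /pair_eq[/= e1 e2]|/pair_eq[/= _]].
    apply: pq; rewrite [p]surjective_pairing [q]surjective_pairing q1 q2.
    move: e1 e2; rewrite !mul1r !mul0r !addr0 => e1 e2; congr (_, _).
      by rewrite -[p.1]gconjK e2 rmorph0.
    by apply/eqP; rewrite -addr_eq0 addrC; apply/eqP; apply: gauss_of_inj;
      rewrite e1 rmorph0.
  rewrite mul0r add0r mul1r q2 opprK => /gauss_of_inj/eqP.
  by rewrite -mulr2n pnatr_eq0.
exists (- q.1, gauss_of (1 + q.2)), (1, 0);
  split=> [p pS pq e|/pair_eq[/= e _]]; last first.
  by move: e; rewrite mul1r mul0r addr0 => /gauss_of_inj/eqP;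
    rewrite (negbTE z1).
apply: pq; apply: sphere_eq => //.
have : hnorm (spinor (- q.1, gauss_of (1 + q.2)) p) = 0 by rewrite e /hnorm /=
  gnorm0 addr0.
have -> : hnorm (spinor (- q.1, gauss_of (1 + q.2)) p) =
   4 * (1 + q.2) * (1 - (re p.1 * re q.1 + im p.1 * im q.1 + p.2 * q.2)).
  move: pS qS; case: p q {z1 e} => -[a b] z [[a' b'] z'];
    rewrite /on_sphere /hnorm /gnorm /= => pS qS.
  (* Eliminating a^2 and a'^2 makes this a polynomial identity. *)
have {}pS : a ^+ 2 = 1 - z ^+ 2 - b ^+ 2 by rewrite -pS; ring.
  have {}qS : a' ^+ 2 = 1 - z' ^+ 2 - b' ^+ 2 by rewrite -qS; ring.
  by ring: pS qS.
move=> /eqP; rewrite !mulf_eq0 pnatr_eq0 (negbTE z1) /= subr_eq0 => /eqP <-.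
by [].
Qed.
End Lines.

(** * Linear and antilinear parts *)
Section Parts.
Variable R : realType.
Local Notation G := (gauss R).
Local Notation T := (R * R)%type.
Variables (m n : nat) (s : G * R -> G * R) (D : bpoint R -> G * G).
Hypothesis lin : linearized m n s D.
Local Notation i := (Gauss 0 1 : G).

Definition pair_cont (T : topologicalType) (v : T -> G * G) : Prop :=
  gcont (fun t => (v t).1) /\ gcont (fun t => (v t).2).
Definition base_cont (T : topologicalType) (p : T -> G * R) : Prop :=
  gcont (fun t => (p t).1) /\ continuous (fun t => (p t).2).

Definition fibre_map (p : G * R) (v : G * G) : G * G := D (BPoint p.1 p.2 v.1
  v.2).

Lemma fibre_map_comb p v w a b : in_line m p v -> in_line m p w ->
  fibre_map p (hadd (hscale (gauss_of a) v) (hscale (gauss_of b) w)) =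
  hadd (hscale (gauss_of a) (fibre_map p v)) (hscale (gauss_of b) (fibre_map p
    w)).
Proof. by move=> vI wI; exact: (lin_comb lin a b vI wI). Qed.

Definition conj_if (b : bool) (c : G) : G := if b then gconj c else c.
Lemma conj_ifX b c k : conj_if b (c ^+ k) = conj_if b c ^+ k.
Proof. by case: b => //=; rewrite rmorphXn. Qed.

(** Twice the complex-linear part for b = false, the antilinear part for
    b = true. *)
Definition complex_part (b : bool) (p : G * R) (v : G * G) : G * G :=
  hadd (fibre_map p v) (hscale (- conj_if b i) (fibre_map p (hscale i v))).

Lemma hscale_split c (v : G * G) :
  hscale c v = hadd (hscale (gauss_of (re c)) v) (hscale (gauss_of (im c))
    (hscale i v)).
Proof.
have cE : c = gauss_of (re c) + gauss_of (im c) * i by apply: gauss_eq => /=;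
  ring.
by rewrite /hadd /hscale /= !mulrA -!mulrDl -cE.
Qed.
Lemma hscaleA c d (v : G * G) : hscale c (hscale d v) = hscale (c * d) v.
Proof. by rewrite /hscale /= !mulrA. Qed.

Lemma fibre_map_scale p v c : in_line m p v ->
  fibre_map p (hscale c v) = hadd (hscale (gauss_of (re c)) (fibre_map p v))
                           (hscale (gauss_of (im c)) (fibre_map p (hscale i
                             v))).
Proof. by move=> vI; rewrite hscale_split fibre_map_comb //;
  exact: in_line_scale. Qed.

Lemma complex_part_scale b p v c : in_line m p v ->
  complex_part b p (hscale c v) = hscale (conj_if b c) (complex_part b p v).
Proof.
move=> vI; rewrite /complex_part hscaleA (fibre_map_scale c vI)
  (fibre_map_scale (i * c) vI).
move: (fibre_map p v) (fibre_map p (hscale i v)) => [x1 x2] [y1 y2].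
rewrite /hadd /hscale /=; congr (_, _); case: b; apply: gauss_eq; rewrite /=;
  ring.
Qed.

Lemma complex_part_line b p v : in_line m p v -> in_line n (s p) (complex_part
  b p v).
Proof.
case: p => a z vI; apply: in_line_add; first exact: (lin_in lin vI).
apply: in_line_scale; exact: (lin_in lin (in_line_scale i vI)).
Qed.

Lemma complex_part_sum p v : hadd (complex_part false p v) (complex_part true p
  v) = hscale 2 (fibre_map p v).
Proof.
rewrite /complex_part;
  move: (fibre_map p v) (fibre_map p (hscale i v)) => [x1 x2] [y1 y2].
have -> : conj_if true i = - i by apply: gauss_eq; rewrite /= ?oppr0.
by rewrite /hadd /hscale /=; congr (_, _); ring.
Qed.

Lemma fibre_map_ker p v : in_line m p v -> fibre_map p v = (0, 0) -> v = (0, 0).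
Proof.
by move=> vI /(lin_ker lin vI) /= [v1 v2]; rewrite [v]surjective_pairing v1 v2.
Qed.

(** Otherwise the derivative would vanish at a multiple of v. *)
Lemma complex_part_norm_neq p v : in_line m p v -> v <> (0, 0) ->
  hnorm (complex_part false p v) <> hnorm (complex_part true p v).
Proof.
move=> vI v0 e.
have AB := in_line_collinear (complex_part_line false vI) (complex_part_line
  true vI).
have [mu mu0] := antilinear_kernel AB e.
have -> : hadd (hscale mu (complex_part false p v)) (hscale (gconj mu)
  (complex_part true p v)) =
    hscale 2 (fibre_map p (hscale mu v)) by rewrite -complex_part_sum
      !complex_part_scale.
have two0 : (2 : G) <> 0.
  have -> : (2 : G) = gauss_of 2 by rewrite rmorph_nat.
  by apply: gauss_of_neq0; rewrite pnatr_eq0.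
move=> /pair_eq[/= /gauss_integral[//|d1] /gauss_integral[//|d2]].
have : hscale mu v = (0, 0).
  by apply: (fibre_map_ker (in_line_scale mu vI));
    rewrite [LHS]surjective_pairing d1 d2.
move=> /pair_eq[/= /gauss_integral[//|e1] /gauss_integral[//|e2]].
by apply: v0; rewrite [v]surjective_pairing e1 e2.
Qed.

Lemma complex_part_cont b (p : T -> G * R) (v : T -> G * G) : base_cont p ->
  pair_cont v ->
  (forall t, in_line m (p t) (v t)) ->
  base_cont (fun t => s (p t)) /\ pair_cont (fun t => complex_part b (p t) (v
    t)).
Proof.
move=> [pc zc] [v1c v2c] vI.
have [c1 c2 d1 d2] := lin_cont lin pc zc v1c v2c vI.
have cst (c : G) (f : T -> G) : gcont f -> gcont (fun t => c * f t).
  by move=> fc t; apply: gcont_atM => //; exact: gcont_at_cst.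
have [_ _ e1 e2] := lin_cont lin pc zc (cst i _ v1c) (cst i _ v2c)
  (fun t => in_line_scale i (vI t)).
have sE t : s (p t) = s ((p t).1, (p t).2) by rewrite -surjective_pairing.
split; first by split=> t; under eq_fun do rewrite sE; [exact: c1|exact: c2].
by split=> t; apply: gcont_atD; [exact: d1|exact: cst|exact: d2|exact: cst].
Qed.

Lemma spinor_cont (U : topologicalType) c (p : U -> G * R) : base_cont p ->
  pair_cont (fun t => spinor c (p t)).
Proof.
move=> [pc zc]; split=> t; apply: gcont_atD; apply: gcont_atM;
  try exact: gcont_at_cst.
- apply: gcont_at_of; apply: (@continuousD _ R);
  [exact: cst_continuous|exact: zc].
- exact: pc.
- exact: gcont_at_conj (pc t).
- apply: gcont_at_of; apply: (@continuousB _ R);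
  [exact: cst_continuous|exact: zc].
Qed.

Lemma spinor_pow_cont (U : topologicalType) k c (p : U -> G * R) : base_cont p
  ->
  pair_cont (fun t => spinor_pow k c (p t)).
Proof. by move=> /(spinor_cont c)[c1 c2]; split=> t; exact: gcont_atX. Qed.

Lemma hdot_cont (U : topologicalType) (v w : U -> G * G) : pair_cont v ->
  pair_cont w ->
  gcont (fun t => hdot (v t) (w t)).
Proof.
move=> [v1 v2] [w1 w2] t; apply: gcont_atD; apply: gcont_atM => //;
  by apply: gcont_at_conj.
Qed.

Lemma hnorm_cont (U : topologicalType) (v : U -> G * G) : pair_cont v ->
  continuous (fun t => hnorm (v t)).
Proof.
move=> [v1 v2] t.
apply: (@continuousD _ R _ (fun t => gnorm (v t).1) (fun t => gnorm (v t).2)).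
  exact: gcont_at_norm.
exact: gcont_at_norm.
Qed.

End Parts.

(** * Stereographic charts of the sphere *)
Section Plane.
Variable R : realType.
Local Notation G := (gauss R).
Local Notation T := (R * R)%type.

(** Intermediate value theorem on the segment from x0 to x. *)
Lemma positive_on_plane (h : T -> R) (x0 : T) : continuous h ->
  (forall x, h x <> 0) -> 0 < h x0 -> forall x, 0 < h x.
Proof.
move=> hc h0 hx0 x; rewrite ltNge; apply/negP => hx.
pose l (t : R) : T := (x0.1 + t * (x.1 - x0.1), x0.2 + t * (x.2 - x0.2)).
have lc (t : R) : {for t, continuous l}.
  by apply: pair_continuous; apply: (@continuousD _ R);
    try exact: cst_continuous;
    apply: (@continuousM R); try exact: cst_continuous; exact: cvg_id.
have hl : {within `[0, 1], continuous (fun t => h (l t))}.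
  apply: continuous_subspaceT => t; exact: (continuous_comp (@lc t) (hc (l t))).
have l0 : l 0 = x0 by rewrite /l !mul0r !addr0; case: (x0).
have l1 : l 1 = x by rewrite /l !mul1r ![_ + (_ - _)]addrC !subrK; case: (x).
have [|c _ hc0] := @IVT R (fun t => h (l t)) 0 1 0 ler01 hl.
  by rewrite l0 l1 ge_min hx orbT le_max (ltW hx0).
exact: h0 hc0.
Qed.

Definition zeta (x : T) : G := Gauss x.1 x.2.
Definition stereo_weight (x : T) : R := (1 + gnorm (zeta x))^-1.

Lemma zeta_cont : gcont zeta.
Proof. by move=> x; split; [exact: fst_continuous|exact: snd_continuous]. Qed.
Lemma stereo_weight_gt0 x : 0 < stereo_weight x.
Proof. by rewrite invr_gt0 ltr_pwDl // gnorm_ge0. Qed.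
Lemma stereo_weightE x : stereo_weight x * (1 + gnorm (zeta x)) = 1.
Proof. by rewrite mulVf // gt_eqF // ltr_pwDl // gnorm_ge0. Qed.
Lemma stereo_weight_cont : continuous stereo_weight.
Proof.
move=> x; apply: (@continuousV R _ (fun x => 1 + gnorm (zeta x)));
  first by rewrite gt_eqF // ltr_pwDl // gnorm_ge0.
apply: (@continuousD _ R); first exact: cst_continuous.
exact: gcont_at_norm (zeta_cont x).
Qed.

(** [chartN] is centred at the south pole and omits the north pole N, [chartS] is
    centred at N and omits the south pole. *)
Definition chartN (x : T) : G * R := (gauss_of (2 * stereo_weight x) * zeta x,
  1 - 2 * stereo_weight x).
Definition chartS (x : T) : G * R := (gauss_of (2 * stereo_weight x) * zeta x,
  2 * stereo_weight x - 1).
(** Over [chartN] the line is spanned by (zeta^k, 1), over [chartS] by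
    (1, conj zeta^k). *)
Definition frameN k (x : T) : G * G := (zeta x ^+ k, 1).
Definition frameS k (x : T) : G * G := (1, gconj (zeta x) ^+ k).

Lemma chartN_sphere x : on_sphere (chartN x).
Proof.
rewrite /on_sphere /= gnormM; have := stereo_weightE x;
  move: (gnorm (zeta x)) (stereo_weight x) => r d dr.
have -> : gnorm (gauss_of (2 * d)) = 4 * d ^+ 2 by rewrite /gnorm /=; ring.
by transitivity (1 + 4 * d * (d * (1 + r) - 1)); [ring | rewrite dr; ring].
Qed.
Lemma chartS_sphere x : on_sphere (chartS x).
Proof.
by apply: etrans (chartN_sphere x); congr (_ + _); rewrite /=; ring.
Qed.

Lemma zeta_conj x : zeta x * gconj (zeta x) = gauss_of (gnorm (zeta x)).
Proof. exact: mul_gconj. Qed.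

Lemma frameN_line k x : in_line k (chartN x) (frameN k x).
Proof.
have e := stereo_weightE x; split; first exact: chartN_sphere.
  rewrite /= mulr1 -exprMn; congr (_ ^+ k).
  rewrite rmorphM /= gconj_of -mulrA [gconj _ * _]mulrC zeta_conj -rmorphM;
    congr gauss_of.
  by transitivity (2 * (stereo_weight x * (1 + gnorm (zeta x))) - 2 *
    stereo_weight x); [rewrite e; ring | ring].
by rewrite /= mulr1 -exprMn; congr (_ ^+ k); congr (gauss_of _ * _); ring.
Qed.
Lemma frameS_line k x : in_line k (chartS x) (frameS k x).
Proof.
have e := stereo_weightE x; split; first exact: chartS_sphere.
  rewrite /= mulr1 -exprMn; congr (_ ^+ k).
  by rewrite rmorphM /= gconj_of; congr (gauss_of _ * _); ring.
rewrite /= mulr1 -exprMn; congr (_ ^+ k).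
rewrite -mulrA zeta_conj -rmorphM; congr gauss_of.
by transitivity (2 * (stereo_weight x * (1 + gnorm (zeta x))) - 2 *
  stereo_weight x); [ring | rewrite e; ring].
Qed.
Lemma frameN_neq0 k x : frameN k x <> (0, 0).
Proof. by move=> /pair_eq[_ /= /eqP]; rewrite oner_eq0. Qed.
Lemma frameS_neq0 k x : frameS k x <> (0, 0).
Proof. by move=> /pair_eq[/= /eqP]; rewrite oner_eq0. Qed.

Lemma chartN_cont : base_cont chartN.
Proof.
have dc x : {for x, continuous (fun x => 2 * stereo_weight x)}.
  by apply: (@continuousM R); [exact: cst_continuous|exact: stereo_weight_cont].
split=> x.
  by apply: gcont_atM; [exact: gcont_at_of|exact: zeta_cont].
by apply: (@continuousB _ R _ (fun=> 1) (fun x => 2 * stereo_weight x));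
  [exact: cst_continuous|exact: dc].
Qed.
Lemma chartS_cont : base_cont chartS.
Proof.
have dc x : {for x, continuous (fun x => 2 * stereo_weight x)}.
  by apply: (@continuousM R); [exact: cst_continuous|exact: stereo_weight_cont].
split=> x.
  by apply: gcont_atM; [exact: gcont_at_of|exact: zeta_cont].
by apply: (@continuousB _ R _ (fun x => 2 * stereo_weight x) (fun=> 1));
  [exact: dc|exact: cst_continuous].
Qed.
Lemma frameN_cont k : pair_cont (frameN k).
Proof. by split=> x; [apply: gcont_atX;
  exact: zeta_cont|exact: gcont_at_cst]. Qed.
Lemma frameS_cont k : pair_cont (frameS k).
Proof.
split=> x; first exact: gcont_at_cst.
by apply: gcont_atX; apply: gcont_at_conj; exact: zeta_cont.
Qed.

Lemma zeta_polar r t : zeta (polar r t) = gauss_of r * expi t.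
Proof. by apply: gauss_eq => /=; ring. Qed.

(** The two charts are related by the inversion zeta |-> 1 / conj zeta. *)
Lemma chart_polar (r t : R) : 0 < r -> chartS (polar r t) = chartN (polar r^-1
  t).
Proof.
move=> r0; have rn := lt0r_neq0 r0.
have nE (a : R) : gnorm (zeta (polar a t)) = a ^+ 2.
  by rewrite zeta_polar gnormM gnorm_expi mulr1 /gnorm /= expr0n addr0.
have s0 : 1 + r ^+ 2 != 0 by rewrite gt_eqF // ltr_pwDl // sqr_ge0.
have dE : stereo_weight (polar r^-1 t) = r ^+ 2 * stereo_weight (polar r t).
  by rewrite /stereo_weight !nE; field; rewrite s0 rn.
rewrite /chartS /chartN dE !zeta_polar; congr (_, _).
  rewrite !mulrA -!rmorphM; congr (gauss_of _ * _).
  by field.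
have := stereo_weightE (polar r t); rewrite nE; move: (stereo_weight _) => d e.
by move: e; rewrite mulrDr mulr1; lra.
Qed.
End Plane.

(** * Comparison of the degrees *)
Section Degree.
Variable R : realType.
Local Notation G := (gauss R).
Local Notation T := (R * R)%type.
Local Notation turn := (pi *+ 2 : R).
Variables (m n : nat) (s : G * R -> G * R) (D : bpoint R -> G * G).
Hypothesis lin : linearized m n s D.

(** The difference of the norms of the two parts has constant sign on each chart,
    and the charts and frames agree at zeta = 1. *)
Lemma complex_part_dominates : exists b : bool,
  (forall x, complex_part D b (chartN x) (frameN m x) <> (0, 0)) /\
  (forall x, complex_part D b (chartS x) (frameS m x) <> (0, 0)).
Proof.
pose hN b x := hnorm (complex_part D b (chartN x) (frameN m x)).
pose hS b x := hnorm (complex_part D b (chartS x) (frameS m x)).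
have hNc b : continuous (hN b).
  have [_ c] := complex_part_cont lin b (@chartN_cont R) (@frameN_cont R m)
    (@frameN_line R m).
  exact: hnorm_cont c.
have hSc b : continuous (hS b).
  have [_ c] := complex_part_cont lin b (@chartS_cont R) (@frameS_cont R m)
    (@frameS_line R m).
  exact: hnorm_cont c.
have hNn x : hN false x <> hN true x.
  exact: (complex_part_norm_neq lin (@frameN_line R m x) (@frameN_neq0 R m x)).
have hSn x : hS false x <> hS true x.
  exact: (complex_part_norm_neq lin (@frameS_line R m x) (@frameS_neq0 R m x)).
(* The point zeta = 1 lies in both charts, with the same frame, so the sign found
   there is the same on the two charts. *)
have e10 b : hS b (1, 0) = hN b (1, 0).
  rewrite /hS /hN; have -> : chartS ((1, 0) : T) = chartN ((1, 0) : T).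
    have := @chart_polar R 1 0 (@ltr01 R).
    have -> : polar 1^-1 0 = (1, 0) :> T by rewrite /polar cos0 sin0 invr1
      mulr1 mulr0.
    have -> : polar 1 0 = (1, 0) :> T by rewrite /polar cos0 sin0 mulr1 mulr0.
    by [].
  congr (hnorm (complex_part _ _ _ _)); rewrite /frameS /frameN.
  have -> : zeta ((1, 0) : T) = 1 :> G by [].
  by rewrite rmorph1 !expr1n.
have pos b : hN (~~ b) (1, 0) < hN b (1, 0) ->
    (forall x, 0 < hN b x) /\ (forall x, 0 < hS b x).
  move=> lt; split=> x.
    suff : 0 < hN b x - hN (~~ b) x by rewrite subr_gt0; apply: le_lt_trans;
      exact: hnorm_ge0.
    apply: (@positive_on_plane R (fun x => hN b x - hN (~~ b) x) (1, 0)).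
    - by move=> y; apply: (@continuousB _ R _ (hN b) (hN (~~ b))); exact: hNc.
    - move=> y /eqP; rewrite subr_eq0 => /eqP e; apply: (hNn y).
      by move: e; case: (b).
    - by rewrite subr_gt0.
  suff : 0 < hS b x - hS (~~ b) x by rewrite subr_gt0; apply: le_lt_trans;
    exact: hnorm_ge0.
  apply: (@positive_on_plane R (fun x => hS b x - hS (~~ b) x) (1, 0)).
  - by move=> y; apply: (@continuousB _ R _ (hS b) (hS (~~ b))); exact: hSc.
  - move=> y /eqP; rewrite subr_eq0 => /eqP e; apply: (hSn y).
    by move: e; case: (b).
  - by rewrite subr_gt0 !e10.
have [b lt] : exists b, hN (~~ b) (1, 0) < hN b (1, 0).
  have [lt|gt|e] := ltgtP (hN false (1, 0)) (hN true (1, 0)).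
  - by exists true.
  - by exists false.
  - by case: (hNn (1, 0)).
have [pN pS] := pos b lt; exists b; split=> x e.
  by have := pN x; rewrite /hN e /hnorm /= gnorm0 addr0 ltxx.
by have := pS x; rewrite /hS e /hnorm /= gnorm0 addr0 ltxx.
Qed.

(** [aN] and [aS] are the coordinates of the dominant part near sigma N, in the
    frames of the source over [chartN] and [chartS], with respect to the sections
    given by [c], which vanishes at most at sigma N, and by [d], which does not
    vanish there. The two sections differ by the n-th power of k, the two frames by
    the m-th power of zeta. *)
Lemma linearized_dvd : (n %| m)%N.
Proof.
have [b [XN0 XS0]] := complex_part_dominates.
pose XN x := complex_part D b (chartN x) (frameN m x).
pose XS x := complex_part D b (chartS x) (frameS m x).
have [sNc XNc] := complex_part_cont lin b (@chartN_cont R) (@frameN_cont R m)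
  (@frameN_line R m).
have [sSc XSc] := complex_part_cont lin b (@chartS_cont R) (@frameS_cont R m)
  (@frameS_line R m).
have pole : on_sphere (0 : G, 1 : R) by rewrite /on_sphere /= gnorm0 add0r
  expr1n.
have sNs x : on_sphere (s (chartN x)) := lin_sphere lin (@chartN_sphere R x).
have sSs x : on_sphere (s (chartS x)) := lin_sphere lin (@chartS_sphere R x).
have [c [d [c0 d0]]] := pole_spinors (lin_sphere lin pole).
pose aN x := hdot (XN x) (spinor_pow n c (s (chartN x))).
pose aS x := hdot (XS x) (spinor_pow n d (s (chartS x))).
have aNc : gcont aN by apply: hdot_cont => //; exact: spinor_pow_cont.
have aSc : gcont aS by apply: hdot_cont => //; exact: spinor_pow_cont.
have aN0 x : aN x <> 0.
  apply: hdot_neq0; [|exact: XN0|].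
    exact: in_line_collinear (complex_part_line lin b (@frameN_line R m x))
      (spinor_line n c (sNs x)).
  apply: spinor_pow_neq0;
    apply: c0 => // /(lin_inj lin (@chartN_sphere R x) pole).
  by move=> /pair_eq[_ /= e]; have := @stereo_weight_gt0 R x; move: e; lra.
have chartS0 : chartS ((0, 0) : T) = (0 : G, 1 : R).
  have z0 : zeta ((0, 0) : T) = 0 :> G by [].
  have d1 : stereo_weight ((0, 0) : T) = 1 :> R by rewrite /stereo_weight z0
    gnorm0 addr0 invr1.
  by rewrite /chartS z0 d1 mulr0 mulr1; congr (_, _); ring.
(* The disc of radius rho around the pole is mapped by s to points at which the
   section given by d does not vanish; the disc of radius 1 / rho of the opposite
   chart is the complement of its interior. *)
have [rho rho0 rhoP] : exists2 rho : R, 0 < rho & forall x : T, x.1 ^+ 2 + x.2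
  ^+ 2 <= rho ^+ 2 ->
    spinor d (s (chartS x)) <> (0, 0).
  have hc := hnorm_cont (spinor_cont d sSc).
  have h0 : 0 < hnorm (spinor d (s (chartS (0, 0)))) by apply: hnorm_gt0;
    rewrite chartS0.
  have := hc (0, 0) _ (@open_nbhs_nbhs _ _ _ (conj (@open_gt R 0) h0)).
  move=> /nbhs_ballP[r /= r0 rB]; exists (r / 2); first by rewrite divr_gt0.
  move=> x xr e; have : 0 < hnorm (spinor d (s (chartS x))).
    apply: rB.
    have bd (a a' : R) : a ^+ 2 + a' ^+ 2 <= (r / 2) ^+ 2 -> `|a| < r.
      move=> h; apply: (@le_lt_trans _ _ (r / 2)); last first.
        by rewrite ltr_pdivrMr // mulr_natr mulr2n ltrDl.
      rewrite -(@ler_pXn2r _ 2) ?nnegrE ?normr_ge0 ?divr_ge0 ?(ltW r0) //.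
      by rewrite real_normK ?num_real //; apply: le_trans h;
        rewrite lerDl sqr_ge0.
    split; rewrite /ball /= sub0r normrN; first exact: bd xr.
    by apply: (bd _ x.1); rewrite addrC.
  by rewrite e /hnorm /= gnorm0 addr0 ltxx.
have aS0 x : x.1 ^+ 2 + x.2 ^+ 2 <= rho ^+ 2 -> aS x <> 0.
  move=> /rhoP e; apply: hdot_neq0; [|exact: XS0|exact: spinor_pow_neq0].
  exact: in_line_collinear (complex_part_line lin b (@frameS_line R m x))
    (spinor_line n d (sSs x)).
(* The quotient of the two sections along the circle, up to a positive factor. *)
pose k t := hdot (spinor c (s (chartS (polar rho t)))) (spinor d (s (chartS
  (polar rho t)))).
have pc (t : R) : {for t, continuous (polar rho)}.
  by apply: polar_continuous; [exact: cst_continuous|exact: cvg_id].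
have kc : gcont k.
  move=> t; apply: (@gcont_at_comp R _ _ (fun x => hdot (spinor c (s (chartS
    x))) (spinor d (s (chartS x)))) (polar rho)).
    exact: pc.
  by apply: hdot_cont; exact: spinor_cont.
have normP (t : R) : (polar rho t).1 ^+ 2 + (polar rho t).2 ^+ 2 = rho ^+ 2.
  by rewrite /= !exprMn -mulrDr cos2Dsin2 mulr1.
have k0 t : k t <> 0.
  apply: hdot_neq0; [exact: spinor_collinear| |].
    rewrite chart_polar //;
      apply: c0 => // /(lin_inj lin (@chartN_sphere R _) pole).
    by move=> /pair_eq[_ /= e]; have := @stereo_weight_gt0 R (polar rho^-1 t);
      move: e; lra.
  by apply: rhoP; rewrite normP.
apply: (@winding_dvd R n m b aN aS k rho^-1 rho) => //.
- by rewrite /k polar_turn.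
move=> t _; set x := polar rho t; set y := polar rho^-1 t.
have xy : chartS x = chartN y := chart_polar t rho0.
have yx : zeta y * gconj (zeta x) = 1.
  rewrite !zeta_polar rmorphM /= gconj_of -expiN.
  have -> : forall p q r w : G, p * q * (r * w) = (p * r) * (q * w) by move=>
    *; ring.
  by rewrite -rmorphM mulVf ?gt_eqF // rmorph1 mul1r -expiD subrr expi0.
(* On the circle frameN = zeta^m frameS, and the part of index b is linear or
   antilinear. *)
have XNE : XN y = hscale (conj_if b (zeta y ^+ m)) (XS x).
  rewrite /XN /XS -xy -(complex_part_scale lin b _ (@frameS_line R m x));
    congr complex_part.
  by rewrite /frameN /hscale /= mulr1 -exprMn yx expr1n.
pose E := spinor d (s (chartS x)).
have E0 : 0 < hnorm E by apply: hnorm_gt0; apply: rhoP; rewrite normP.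
have powE : hscale (k t ^+ n) (spinor_pow n d (s (chartS x))) =
    hscale (gauss_of (hnorm E ^+ n)) (spinor_pow n c (s (chartS x))).
  have [e1 e2] := pair_eq (hdot_proj (spinor_collinear c d (sSs x))).
  rewrite /hscale /spinor_pow /= rmorphXn -!exprMn; congr (_ ^+ n, _ ^+ n).
    exact: e1.
  exact: e2.
exists (hnorm E ^+ n * rho ^+ m); first by rewrite mulr_gt0 ?exprn_gt0.
rewrite /aN XNE -xy hdot_scalel /aS.
have := congr1 (hdot (XS x)) powE;
  rewrite !hdot_scaler gconj_of rmorphXn /= => pE.
have zE : gauss_of (rho ^+ m) * conj_if b (zeta y ^+ m) = expi ((-1) ^+ b * t)
  ^+ m.
  rewrite conj_ifX rmorphXn -exprMn; congr (_ ^+ m); rewrite zeta_polar.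
  have -> : conj_if b (gauss_of rho^-1 * expi t) = gauss_of rho^-1 * expi ((-1)
    ^+ b * t).
    case: (b) => /=; first by rewrite rmorphM /= gconj_of expr1 mulN1r expiN.
    by rewrite expr0 mul1r.
  have gV : gauss_of rho * gauss_of rho^-1 = 1.
    apply: etrans (congr1 (@gauss_of R) (mulfV (lt0r_neq0 rho0))).
    by rewrite rmorphM.
  by rewrite mulrA gV mul1r.
rewrite rmorphM /= -zE -[RHS]mulrA pE.
by ring.
Qed.
End Degree.

Lemma isomorphic_bundles (R : realType) (m n : nat) :
  isomorphic (bundle R m) (bundle R n) -> m = n.
Proof.
move=> mn; apply/eqP; rewrite eqn_dvd.
have [s [D lin]] := bundle_linearization mn.
have [s' [D' lin']] := bundle_linearization (isomorphic_sym mn).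
by rewrite (linearized_dvd lin) (linearized_dvd lin').
Qed.

Theorem theorem1 (R : realType) :
  let X : functor R := product (sphere R) (affine_space R 2) in
  [/\ real_variety X, affine X, smooth X & rational_of_dim 4 X] /\
  exists F : nat -> functor R,
    (forall n : nat, real_form X (F n)) /\
    (forall m n : nat, m <> n -> ~ isomorphic (F m) (F n)).
Proof.
move=> X; have XV : real_variety X.
  by split; [exact: quasi_projective_X | exact: integral_complexified_X].
split; first by split; [|exact: affine_X|exact: smooth_X|exact: rational_X].
exists (bundle R); split=> [n|m n mn /isomorphic_bundles//].
have XF := complexified_bundle_trivial R n.
split=> //; split; first exact: quasi_projective_bundle.
exact: integral_iso XF (integral_complexified_X R).
Qed.
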